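(* There is a polynomial-time $9$-approximation algorithm for Priority Matroid Center with Outliers.
   Context: Priority Matroid Center with Outliers: the input is a finite metric space $(X,d)$, an integer $m$, a radius function $r:X\to\mathbb{R}_{>0}$, and a matroid on ground set $X$ with family of independent sets $\mathcal{F}\subseteq 2^X$. The goal is to find $S\in\mathcal{F}$ minimizing $\alpha$ such that at least $m$ points $v\in X$ satisfy $d(v,S)\le\alpha\cdot r(v)$, where $d(v,S)=\min_{s\in S}d(v,s)$. A $\rho$-approximation algorithm outputs a feasible $S$ achieving value at most $\rho$ times the optimum value of $\alpha$. *)

(* Defs.v *)
From HB Require Import structures.
From mathcomp Require Import all_boot all_order all_algebra.
From mathcomp Require Import all_classical all_reals all_analysis.

Set Implicit Arguments.
Unset Strict Implicit.
Unset Printing Implicit Defensive.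

Import Order.TTheory GRing.Theory Num.Theory.

Local Open Scope ring_scope.

#[short(type="finMetricType")]
HB.structure Definition FinMetric (K : numDomainType) :=
  { M of Finite M & Metric K M }.

Section Matroid.
Variable X : finType.

Definition is_matroid (F : {set {set X}}) : Prop :=
  [/\ finset.set0 \in F,
      forall A B : {set X}, A \subset B -> B \in F -> A \in F
    & forall A B : {set X}, A \in F -> B \in F -> (#|A| < #|B|)%N ->
        exists2 x, x \in B :\: A & x |: A \in F].

End Matroid.

Record pmc_instance (R : realType) (X : finMetricType R) := PMCInstance {
  target : nat;
  radius : X -> R;
  radius_gt0 : forall x, 0 < radius x;
  indep : {set {set X}};
  indep_matroid : is_matroid indep
}.

Section Objective.
Variables (R : realType) (X : finMetricType R) (I : pmc_instance X).

(* The distance to the empty set is +oo. *)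
Definition dist_to (v : X) (S : {set X}) : \bar R :=
  \big[Order.min/+oo%E]_(s in S) (mdist v s)%:E.

Definition covered (S : {set X}) (alpha : R) : {set X} :=
  [set v | (dist_to v S <= (alpha * radius I v)%:E)%E]%SET.

(* alpha >= 0 only matters when target = 0, where every real alpha would do;
   the infimum is attained when the set is nonempty, and it is +oo when no
   alpha works. *)
Definition objective (S : {set X}) : \bar R :=
  ereal_inf [set alpha%:E | alpha in
    [set a : R | 0 <= a /\ (target I <= #|covered S a|)%N]]%classic.

Definition optimum : \bar R :=
  \big[Order.min/+oo%E]_(S in indep I) objective S.

Definition approx_solution (rho : R) (S : {set X}) : Prop :=
  S \in indep I /\ (objective S <= rho%:E * optimum)%E.

End Objective.

(* Machine model: Jones's WHILE language (N. D. Jones, Computability and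
   Complexity from a Programming Perspective), with integers of arbitrary size
   at the leaves of the trees and with an oracle.  Tree operations have unit
   cost, since trees are shared and only leaves are ever compared; arithmetic
   has logarithmic cost; a query costs the size of its argument.  Up to
   polynomials this is the running time of an oracle Turing machine. *)

Inductive value := VNum of int | VPair of value & value.

Definition int_size (z : int) : nat := (trunc_log 2 `|z|%N).+1.

Fixpoint value_size (v : value) : nat :=
  match v with
  | VNum z => int_size z
  | VPair a b => (value_size a + value_size b).+1
  end.

Inductive binop := Add | Sub | Mul | Div | Leq.

Inductive expr :=
  | Var of nat
  | Cst of int
  | Pair of expr & expr
  | Fst of expr
  | Snd of expr
  | IsPair of expr
  | Op of binop & expr & expr.

Inductive cmd :=
  | Skip
  | Assign of nat & expr
  | Query of nat & expr
  | Seq of cmd & cmd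
  | If of expr & cmd & cmd
  | While of expr & cmd.

Definition store := nat -> value.

Definition vbool (b : bool) : value := VNum (if b then 1 else 0).

(* Ill-typed operands are read as 0, so that evaluation is total. *)
Definition vnum (v : value) : int := if v is VNum z then z else 0.
Definition vfst (v : value) : value := if v is VPair a _ then a else VNum 0.
Definition vsnd (v : value) : value := if v is VPair _ b then b else VNum 0.
Definition is_pair (v : value) : bool := if v is VPair _ _ then true else false.

Definition truth (v : value) : bool := is_pair v || (vnum v != 0).

Definition eval_op (o : binop) (x y : int) : value :=
  match o with
  | Add => VNum (x + y)
  | Sub => VNum (x - y)
  | Mul => VNum (x * y)
  | Div => VNum (x %/ y)%Z
  | Leq => vbool (x <= y)
  end.

Fixpoint eval (s : store) (e : expr) : value :=
  match e with
  | Var i => s i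
  | Cst z => VNum z
  | Pair a b => VPair (eval s a) (eval s b)
  | Fst a => vfst (eval s a)
  | Snd a => vsnd (eval s a)
  | IsPair a => vbool (is_pair (eval s a))
  | Op o a b => eval_op o (vnum (eval s a)) (vnum (eval s b))
  end.

Fixpoint eval_cost (s : store) (e : expr) : nat :=
  match e with
  | Var _ => 1
  | Cst z => int_size z
  | Pair a b => (eval_cost s a + eval_cost s b).+1
  | Fst a | Snd a | IsPair a => (eval_cost s a).+1
  | Op _ a b => (eval_cost s a + eval_cost s b
      + int_size (vnum (eval s a)) + int_size (vnum (eval s b))).+1
  end.

Definition update (s : store) (i : nat) (v : value) : store :=
  fun j => if j == i then v else s j.

(* exec O c s t s' : with oracle O, started in store s, the command c halts in
   store s' after a computation of cost t. *)
Inductive exec (O : value -> bool) : cmd -> store -> nat -> store -> Prop :=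
  | ExecSkip s : exec O Skip s 1 s
  | ExecAssign s i e :
      exec O (Assign i e) s (eval_cost s e).+1 (update s i (eval s e))
  | ExecQuery s i e :
      exec O (Query i e) s (eval_cost s e + value_size (eval s e)).+1
        (update s i (vbool (O (eval s e))))
  | ExecSeq c1 c2 s1 s2 s3 t1 t2 :
      exec O c1 s1 t1 s2 -> exec O c2 s2 t2 s3 ->
      exec O (Seq c1 c2) s1 (t1 + t2).+1 s3
  | ExecIf e c1 c2 s s' t :
      exec O (if truth (eval s e) then c1 else c2) s t s' ->
      exec O (If e c1 c2) s (eval_cost s e + t).+1 s'
  | ExecWhileDone e c s :
      ~~ truth (eval s e) -> exec O (While e c) s (eval_cost s e).+1 s
  | ExecWhileStep e c s1 s2 s3 t1 t2 :
      truth (eval s1 e) ->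
      exec O c s1 t1 s2 -> exec O (While e c) s2 t2 s3 ->
      exec O (While e c) s1 (eval_cost s1 e + t1 + t2).+1 s3.

(* Variable 0 holds the input at the start and the output at the end. *)
Definition init_store (v : value) : store :=
  fun i => if i == 0%N then v else VNum 0.

Definition enc_seq (vs : seq value) : value := foldr VPair (VNum 0) vs.

Definition enc_rat (q : rat) : value := VPair (VNum (numq q)) (VNum (denq q)).

Section Encoding.
Variables (R : realType) (X : finMetricType R).

(* A set of points is written as a list, in any order, of their positions in
   enum X; values that are not such lists decode to None. *)
Fixpoint decode_set (v : value) : option {set X} :=
  match v with
  | VPair (VNum (Posz i)) w =>
      if insub i is Some k then
        omap (fun A : {set X} => enum_val (k : 'I_#|X|) |: A) (decode_set w)
      else None
  | VNum (Posz 0) => Some finset.set0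
  | _ => None
  end.

Definition indep_oracle (I : pmc_instance X) (v : value) : bool :=
  if decode_set v is Some A then A \in indep I else false.

(* Inputs are finite objects: distances and radii are rational numbers given by
   numerator and denominator in lowest terms.  The matroid is not part of the
   input word; it is given by its independence oracle. *)
Definition encodes (v : value) (I : pmc_instance X) : Prop :=
  exists (d : X -> X -> rat) (r : X -> rat),
    [/\ forall x y : X, mdist x y = ratr (d x y),
        forall x : X, radius I x = ratr (r x)
      & v = enc_seq
          [:: VNum #|X|%:Z; VNum (target I)%:Z;
              enc_seq [seq enc_seq [seq enc_rat (d x y) | y <- enum X]
                      | x <- enum X];
              enc_seq [seq enc_rat (r x) | x <- enum X]]].

End Encoding.

Definition poly_time_approximation (R : realType) (rho : R) (c : cmd) : Prop :=
  exists P : {poly nat},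
  forall (X : finMetricType R) (I : pmc_instance X) (v : value),
    encodes v I ->
    exists (t : nat) (s : store) (S : {set X}),
      [/\ exec (indep_oracle I) c (init_store v) t s,
          (t <= P.[value_size v])%N,
          decode_set X (s 0%N) = Some S
        & approx_solution I rho S].

(* Main.v *)
Require Import Defs.
From mathcomp Require Import all_boot all_order all_algebra.
From mathcomp Require Import zify ring lra.
From mathcomp Require boolp.

(** An optimal value of [alpha] is one of the ratios [d(x, y) / r(x)], so fix such
    a candidate and let [B(v)] be the ball of radius [alpha r(v)] around [v].
    - A projected subgradient method, whose oracle is the matroid greedy algorithm,
      solves the linear program max [sum_v min(1, x(B(v)))] over the matroid polytope
      up to an error below 1.  If [m] points can be covered at [alpha], the fractional
      coverage therefore exceeds [m - 1].
    - Scanning the points by decreasing fractional coverage, assign [u] to an earlier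
      representative [v] such that [B(u)] and [B(v)] touch and [r(v) <= 2 r(u)]; if
      there is none, [u] becomes a representative.  The radii of touching
      representatives differ by a factor above 2, so the representatives whose balls
      contain a given location form a chain along which the radii at least halve.
    - Match each representative to itself (left uncovered, weight 0), to a smaller
      touching representative, or to a location in its ball (weight: the number of
      points assigned to it), the used locations forming an independent set.  Along
      the links a matched [v] reaches a used location within [3 alpha r(v)], hence a
      point [u] assigned to [v] has one within [alpha (r(u) + 4 r(v)) <= 9 alpha r(u)].
    - This weighted matching problem into a matroid has an integral dual (raise the
      prices on a set violating the condition of Rado's theorem), and sending the
      fractional solution down the chains shows that its optimum is at least [m].
      Whether the optimum is at least [m] is decided exactly by a subgradient method
      on the dual, because the optimum is an integer.
    - Delete locations as long as the optimum stays at least [m]: in the end all the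
      remaining locations are used, so they form an independent set.

    The machine keeps its whole state in variable 0 as a pair (current value, stack);
    [PT] functions are those computed this way in polynomial time, and a fold over a
    list is their only loop. *)

Set Implicit Arguments.
Unset Strict Implicit.
Unset Printing Implicit Defensive.

Import Order.TTheory GRing.Theory Num.Theory.

(** * Polynomial-time programs *)

(** Programs are specified by functions on typed data; an instance fixes how such data is laid out
    as a tree. *)
Class Enc (T : Type) := enc : T -> value.

#[global] Instance Enc_nat : Enc nat := fun n => VNum n.
#[global] Instance Enc_int : Enc int := VNum.
#[global] Instance Enc_bool : Enc bool := vbool.
#[global] Instance Enc_prod A B `{Enc A} `{Enc B} : Enc (A * B) :=
  fun p => VPair (enc p.1) (enc p.2).
#[global] Instance Enc_list A `{Enc A} : Enc (list A) :=
  fun l => enc_seq [seq enc x | x <- l].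

Notation oracle := (value -> bool).

Definition esize {A} `{Enc A} (a : A) : nat := value_size (enc a).

Lemma esize_gt0 A `{Enc A} (a : A) : 0 < esize a.
Proof. by rewrite /esize; case: (enc a). Qed.

Lemma esize_pair A B `{Enc A} `{Enc B} (a : A) (b : B) :
  esize (a, b) = (esize a + esize b).+1.
Proof. by []. Qed.

Lemma esize_cons A `{Enc A} (a : A) l : esize (a :: l) = (esize a + esize l).+1.
Proof. by []. Qed.

(** Polynomial growth in the size of the encoded argument, uniformly in the oracle. A single
    monomial is enough because sizes are positive, and bounds of this shape compose. *)
Definition PB {A} `{Enc A} (m : oracle -> A -> nat) :=
  exists C k, forall O a, m O a <= C * esize a ^ k.

Section PB.
Context {A : Type} `{Enc A}.
Implicit Types m : oracle -> A -> nat.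

Lemma PB_le m m' : PB m' -> (forall O a, m O a <= m' O a) -> PB m.
Proof.
move=> [C [k h]] hle; exists C, k => O a; exact: leq_trans (hle O a) (h O a).
Qed.

Lemma PB_const c : PB (fun _ (_ : A) => c).
Proof. by exists c, 0 => O a; rewrite muln1. Qed.

Lemma PB_size : PB (fun _ (a : A) => esize a).
Proof. by exists 1, 1 => O a; rewrite mul1n expn1. Qed.

Lemma PB_add m1 m2 : PB m1 -> PB m2 -> PB (fun O a => m1 O a + m2 O a).
Proof.
move=> [C [k h]] [C' [k' h']]; exists (C + C'), (k + k') => O a.
have s0 := esize_gt0 a; apply: leq_trans (leq_add (h O a) (h' O a)) _.
rewrite mulnDl leq_add // leq_mul2l; apply/orP; right; apply: leq_pexp2l => //.
  exact: leq_addr.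
exact: leq_addl.
Qed.

Lemma PB_mul m1 m2 : PB m1 -> PB m2 -> PB (fun O a => m1 O a * m2 O a).
Proof.
move=> [C [k h]] [C' [k' h']]; exists (C * C'), (k + k') => O a.
by apply: leq_trans (leq_mul (h O a) (h' O a)) _; rewrite expnD mulnACA.
Qed.

Lemma PB_S m : PB m -> PB (fun O a => (m O a).+1).
Proof.
move=> h; apply: PB_le (PB_add h (PB_const 1)) _ => O a; by rewrite addn1.
Qed.


Lemma PB_comp B `{Enc B} (m : oracle -> B -> nat) (f : oracle -> A -> B) :
  PB m -> PB (fun O a => esize (f O a)) -> PB (fun O a => m O (f O a)).
Proof.
move=> [C [k h]] [C' [k' h']]; exists (C * C' ^ k), (k' * k) => O a.
apply: leq_trans (h O _) _; rewrite -mulnA leq_mul2l; apply/orP; right.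
rewrite expnM -expnMn; case: (k) => // j; rewrite leq_exp2r //; exact: h'.
Qed.

End PB.

(** The machine semantics as a Hoare triple with a cost bound, so that programs are verified by
    chaining postconditions. *)
Definition runs O c s T (Q : store -> Prop) :=
  exists t s', [/\ exec O c s t s', t <= T & Q s'].

Lemma runs_weak O c s T T' (Q Q' : store -> Prop) :
  runs O c s T Q -> T <= T' -> (forall s, Q s -> Q' s) -> runs O c s T' Q'.
Proof.
move=> [t [s' [e l q]]] le h; exists t, s'; split=> //; first exact: leq_trans le.
exact: h.
Qed.

Lemma runs_assign O i e s T (Q : store -> Prop) :
  eval_cost s e < T -> Q (update s i (eval s e)) -> runs O (Assign i e) s T Q.
Proof. by move=> l q; eexists; eexists; split; [exact: ExecAssign | |]. Qed.

Lemma runs_seq O c1 c2 s T1 T2 (Q : store -> Prop) :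
  runs O c1 s T1 (fun s' => runs O c2 s' T2 Q) -> runs O (Seq c1 c2) s (T1 + T2).+1 Q.
Proof.
move=> [t [s' [e l [t2 [s2 [e2 l2 q]]]]]]; exists (t + t2).+1, s2; split=> //.
  exact: ExecSeq e e2.
by rewrite ltnS leq_add.
Qed.

Lemma runs_if O e c1 c2 s T (Q : store -> Prop) :
  runs O (if truth (eval s e) then c1 else c2) s T Q ->
  runs O (If e c1 c2) s (eval_cost s e + T).+1 Q.
Proof.
move=> [t [s' [ex l q]]]; exists (eval_cost s e + t).+1, s'; split=> //.
  exact: ExecIf.
by rewrite ltnS leq_add2l.
Qed.

(** The calling convention: the argument lies on an arbitrary stack [st] in variable 0 and is
    replaced by the result, with the stack intact. The other variables are scratch. *)
Definition computes A B `{Enc A} `{Enc B} (f : oracle -> A -> B) c (T : oracle -> A -> nat) :=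
  forall O a st s, s 0 = VPair (enc a) st ->
    runs O c s (T O a) (fun s' => s' 0 = VPair (enc (f O a)) st).

(** The output size is bounded separately from the cost: trees are shared, so a cheap program can
    build a result exponentially larger than its running time, and composition would then leave
    polynomial time. *)
Definition PT {A B} `{Enc A} `{Enc B} (f : oracle -> A -> B) :=
  PB (fun O a => esize (f O a)) /\ exists c T, PB T /\ computes f c T.

Lemma PT_PB A B `{Enc A} `{Enc B} (f : oracle -> A -> B) :
  PT f -> PB (fun O a => esize (f O a)).
Proof. by case. Qed.

Ltac pb := repeat first [assumption | apply: PB_const | apply: PB_size | apply: PT_PB; assumption
  | apply: PB_add | apply: PB_mul | apply: PB_S].

Lemma PT_expr A B `{Enc A} `{Enc B} (f : oracle -> A -> B) e T :
  PB T -> PB (fun O a => esize (f O a)) ->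
  (forall O a st s, s 0 = VPair (enc a) st ->
    eval s e = enc (f O a) /\ eval_cost s e <= T O a) ->
  PT f.
Proof.
move=> pT ps h; split=> //; exists (Assign 0 (Pair e (Snd (Var 0)))), (fun O a => T O a + 5).
split; first by apply: PB_add => //; apply: PB_const.
move=> O a st s hs; have [he hc] := h O a st s hs.
by apply: runs_assign; rewrite /= ?/update ?eqxx ?hs ?he //=; lia.
Qed.

(** * Basic combinators: composition, pairing, branching and oracle queries *)

Section Basic.
Context {A : Type} `{Enc A}.

Lemma PT_id : PT (fun _ (a : A) => a).
Proof.
apply: (PT_expr (e := Fst (Var 0)) (PB_const 2)); first exact: PB_size.
by move=> O a st s /= ->.
Qed.

Lemma PT_cst (B : Type) `{Enc B} (b : B) (z : int) :
  enc b = VNum z -> PT (fun _ (_ : A) => b).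
Proof.
move=> hb; apply: (PT_expr (e := Cst z) (PB_const (int_size z))); first exact: PB_const.
by move=> O a st s _; rewrite hb.
Qed.

Lemma PT_comp B C `{Enc B} `{Enc C} (g : oracle -> B -> C) (f : oracle -> A -> B) :
  PT g -> PT f -> PT (fun O a => g O (f O a)).
Proof.
move=> [pg [cg [Tg [pTg hg]]]] [pf [cf [Tf [pTf hf]]]]; split; first exact: PB_comp pg pf.
exists (Seq cf cg), (fun O a => (Tf O a + Tg O (f O a)).+1); split.
  by apply: PB_S; apply: PB_add => //; apply: PB_comp pTg pf.
move=> O a st s hs; apply: runs_seq; apply: runs_weak (hf _ _ _ _ hs) _ _ => // s' hs'.
exact: hg.
Qed.

Lemma PT_pair B C `{Enc B} `{Enc C} (f : oracle -> A -> B) (g : oracle -> A -> C) :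
  PT f -> PT g -> PT (fun O a => (f O a, g O a)).
Proof.
move=> [pf [cf [Tf [pTf hf]]]] [pg [cg [Tg [pTg hg]]]].
split; first by apply: PB_S; apply: PB_add.
(* A copy of the argument is pushed on the stack; after [cf] its result and the saved argument
   change places, and after [cg] the two results are paired. *)
exists (Seq (Assign 0 (Pair (Fst (Var 0)) (Var 0)))
  (Seq cf (Seq (Assign 0 (Pair (Fst (Snd (Var 0))) (Pair (Fst (Var 0)) (Snd (Snd (Var 0))))))
  (Seq cg (Assign 0 (Pair (Pair (Fst (Snd (Var 0))) (Fst (Var 0))) (Snd (Snd (Var 0)))))))))
  , (fun O a => (5 + (Tf O a + (20 + (Tg O a + 20).+1).+1).+1).+1); split.
  by repeat (apply: PB_S || apply: PB_add || apply: PB_const || assumption).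
move=> O a st s hs; apply: runs_seq; apply: runs_assign => //=.
apply: runs_seq; apply: runs_weak (hf _ a (VPair (enc a) st) _ _) _ _ => //.
  by rewrite /update eqxx hs.
move=> s1 h1; apply: runs_seq; apply: runs_assign => //=.
apply: runs_seq; apply: runs_weak (hg _ a (VPair (enc (f O a)) st) _ _) _ _ => //.
  by rewrite /update eqxx h1.
by move=> s2 h2; apply: runs_assign => //=; rewrite /update eqxx h2.
Qed.

Lemma PT_fst B C `{Enc B} `{Enc C} (f : oracle -> A -> B * C) :
  PT f -> PT (fun O a => (f O a).1).
Proof.
apply: (PT_comp (g := fun _ p => p.1)); apply: (PT_expr (e := Fst (Fst (Var 0))) (PB_const 3)).
  by apply: PB_le PB_size _ => O [a b] /=; rewrite esize_pair; lia.
by move=> O a st s /= ->.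
Qed.

Lemma PT_snd B C `{Enc B} `{Enc C} (f : oracle -> A -> B * C) :
  PT f -> PT (fun O a => (f O a).2).
Proof.
apply: (PT_comp (g := fun _ p => p.2)); apply: (PT_expr (e := Snd (Fst (Var 0))) (PB_const 3)).
  by apply: PB_le PB_size _ => O [a b] /=; rewrite esize_pair; lia.
by move=> O a st s /= ->.
Qed.


Lemma PT_if B `{Enc B} (b : oracle -> A -> bool) (f g : oracle -> A -> B) :
  PT b -> PT f -> PT g -> PT (fun O a => if b O a then f O a else g O a).
Proof.
move=> hb [pf [cf [Tf [pTf hf]]]] [pg [cg [Tg [pTg hg]]]].
split.
  apply: PB_le (PB_add pf pg) _ => O a; case: (b O a); lia.
(* The test is computed together with a copy of the argument, which the chosen branch then
   receives. *)
have [_ [cb [Tb [pTb hb']]]] := PT_pair hb PT_id.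
exists (Seq cb (If (Fst (Fst (Var 0)))
    (Seq (Assign 0 (Pair (Snd (Fst (Var 0))) (Snd (Var 0)))) cf)
    (Seq (Assign 0 (Pair (Snd (Fst (Var 0))) (Snd (Var 0)))) cg))),
  (fun O a => (Tb O a + (3 + (20 + (Tf O a + Tg O a)).+1).+1).+1); split.
  by repeat (apply: PB_S || apply: PB_add || apply: PB_const || assumption).
move=> O a st s hs; apply: runs_seq; apply: runs_weak (hb' _ _ _ _ hs) _ _ => // s1 h1.
have [t [s2 [e l q]]] : runs O (If (Fst (Fst (Var 0)))
    (Seq (Assign 0 (Pair (Snd (Fst (Var 0))) (Snd (Var 0)))) cf)
    (Seq (Assign 0 (Pair (Snd (Fst (Var 0))) (Snd (Var 0)))) cg)) s1
   (3 + (20 + (Tf O a + Tg O a)).+1).+1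
   (fun s' => s' 0 = VPair (enc (if b O a then f O a else g O a)) st).
  apply: (@runs_if O (Fst (Fst (Var 0)))).
  rewrite /= h1 /=; case: (b O a) => /=; apply: runs_seq; apply: runs_assign => //.
    apply: runs_weak (hf _ a st _ _) _ _ => //; last by lia.
    by rewrite /= /update eqxx h1.
  apply: runs_weak (hg _ a st _ _) _ _ => //; last by lia.
  by rewrite /= /update eqxx h1.
by exists t, s2.
Qed.

Lemma PT_query B `{Enc B} (f : oracle -> A -> B) :
  PT f -> PT (fun O a => O (enc (f O a))).
Proof.
move=> hf; apply: (PT_comp (g := fun O b => O (enc b)) _ hf).
split.
  apply: PB_le (PB_const 1) _ => O a; by case: (O _).
exists (Seq (Query 1 (Fst (Var 0))) (Assign 0 (Pair (Var 1) (Snd (Var 0))))),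
  (fun O a => (((esize a) + 5) + 10).+1); split.
  by repeat (apply: PB_S || apply: PB_add || apply: PB_const || apply: PB_size).
move=> O a st s hs; apply: runs_seq.
eexists; eexists; split; first exact: ExecQuery.
  by rewrite /= hs /= /esize; lia.
by apply: runs_assign => //=; rewrite /update /= hs.
Qed.

End Basic.

(** * Integer arithmetic and comparisons *)

Lemma ltn_int_size (z : int) : `|z|%N < 2 ^ int_size z.
Proof. exact: trunc_log_ltn. Qed.

Lemma int_size_le (z : int) k : 0 < k -> `|z|%N < 2 ^ k -> int_size z <= k.
Proof.
move=> k0; case: (posnP `|z|%N) => [h _|h0 hk]; first by rewrite /int_size h trunc_log0.
rewrite /int_size -(ltn_exp2l _ _ (isT : 1 < 2)); apply: leq_ltn_trans hk.
exact: trunc_logP.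
Qed.

Lemma int_size_abs (z : int) : int_size z <= `|z|%N.+1.
Proof. by apply: int_size_le => //; apply: ltn_trans (ltn_expl _ _). Qed.

Lemma int_size_add (x y z : int) : `|z|%N <= `|x|%N + `|y|%N -> int_size z <= int_size x + int_size y.
Proof.
move=> h; apply: int_size_le => //; apply: leq_ltn_trans h _.
have [hx hy] := (ltn_int_size x, ltn_int_size y).
have a1 : 1 < 2 ^ int_size x by rewrite /int_size expnS; lia.
have a2 : 1 < 2 ^ int_size y by rewrite /int_size expnS; lia.
rewrite expnD; nia.
Qed.

Lemma int_size_mul (x y : int) : int_size (x * y) <= int_size x + int_size y.
Proof.
apply: int_size_le => //; rewrite abszM expnD.
have [hx hy] := (ltn_int_size x, ltn_int_size y); nia.
Qed.

Section Ops.
Context {A : Type} `{Enc A}.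
Local Open Scope ring_scope.

Lemma PT_op (o : binop) B (eB : Enc B) (h : int -> int -> B) (f g : oracle -> A -> int) :
  (forall x y, enc (h x y) = eval_op o x y) ->
  (forall x y, (value_size (eval_op o x y) <= int_size x + int_size y)%N) ->
  PT f -> PT g -> PT (fun O a => h (f O a) (g O a)).
Proof.
move=> he hsz hf hg.
apply: (PT_comp (g := fun _ p => h p.1 p.2) (f := fun O a => (f O a, g O a))); last exact: PT_pair.
apply: (PT_expr (e := Op o (Fst (Fst (Var 0))) (Snd (Fst (Var 0))))
  (T := fun _ p => (esize p + 10)%N)).
- by apply: PB_add; [apply: PB_size | apply: PB_const].
- apply: PB_le PB_size _ => O [x y]; rewrite esize_pair /esize he; apply: leq_trans (hsz _ _) _.
  by rewrite /=; lia.
- by move=> O [x y] st s /= ->; rewrite he /=; split=> //; rewrite /esize /=; lia.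
Qed.

Lemma PT_addz (f g : oracle -> A -> int) : PT f -> PT g -> PT (fun O a => f O a + g O a).
Proof. apply: (PT_op (o := Add)) => // x y /=; apply: int_size_add; lia. Qed.

Lemma PT_subz (f g : oracle -> A -> int) : PT f -> PT g -> PT (fun O a => f O a - g O a).
Proof. apply: (PT_op (o := Defs.Sub) (h := fun x y => x - y)) => // x y /=; apply: int_size_add; lia. Qed.

Lemma PT_mulz (f g : oracle -> A -> int) : PT f -> PT g -> PT (fun O a => f O a * g O a).
Proof. apply: (PT_op (o := Mul)) => // x y /=; exact: int_size_mul. Qed.

Lemma PT_lez (f g : oracle -> A -> int) : PT f -> PT g -> PT (fun O a => f O a <= g O a).
Proof. by apply: (PT_op (o := Leq)) => // x y /=; case: (x <= y). Qed.

Lemma PT_posz (f : oracle -> A -> nat) : PT f -> PT (fun O a => (f O a)%:Z).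
Proof. by []. Qed.

Lemma PT_andb (f g : oracle -> A -> bool) : PT f -> PT g -> PT (fun O a => f O a && g O a).
Proof. by move=> hf hg; apply: (PT_if hf hg); apply: (PT_cst (z := 0)). Qed.

Lemma PT_negb (f : oracle -> A -> bool) : PT f -> PT (fun O a => ~~ f O a).
Proof.
by move=> hf; apply: (PT_if hf); [apply: (PT_cst (z := 0)) | apply: (PT_cst (z := 1))].
Qed.

Lemma PT_ext B `{Enc B} (f g : oracle -> A -> B) :
  (forall O a, g O a = f O a) -> PT f -> PT g.
Proof.
move=> e [pf [c [T [pT hc]]]]; split; first by apply: PB_le pf _ => O a; rewrite e.
by exists c, T; split=> // O a st s hs; rewrite e; apply: hc.
Qed.

Lemma PT_leqn (f g : oracle -> A -> nat) : PT f -> PT g -> PT (fun O a => (f O a <= g O a)%N).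
Proof. exact: (@PT_lez (fun O a => (f O a)%:Z) (fun O a => (g O a)%:Z)). Qed.

Lemma PT_addn (f g : oracle -> A -> nat) : PT f -> PT g -> PT (fun O a => (f O a + g O a)%N).
Proof. exact: (@PT_addz (fun O a => (f O a)%:Z) (fun O a => (g O a)%:Z)). Qed.

Lemma PT_eqn (f g : oracle -> A -> nat) : PT f -> PT g -> PT (fun O a => f O a == g O a).
Proof.
move=> hf hg; apply: PT_ext (PT_andb (PT_leqn hf hg) (PT_leqn hg hf)) => O a; exact: eqn_leq.
Qed.

End Ops.

(** * Folds and the list operations derived from them *)

Lemma esize_mem A `{Enc A} (P : seq A) i d : i < size P -> esize (nth d P i) <= esize P.
Proof.
elim: P i => //= x l IH [_|i hi]; rewrite esize_cons.
  by rewrite leqW ?leq_addr.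
by rewrite leqW // (leq_trans (IH i hi)) ?leq_addl.
Qed.

Lemma esize_len A `{Enc A} (l : seq A) : size l < esize l.
Proof. by elim: l => //= x l IH; rewrite esize_cons; lia. Qed.

(** A polynomial-time step does not suffice: one that doubles the size of its accumulator reaches
    exponential size when iterated. Hence the bound [b] on every intermediate accumulator. *)
Lemma PT_foldl A B S `{Enc A} `{Enc B} `{Enc S} (f : oracle -> A -> S -> B -> S)
   (z : oracle -> A -> S) (l : oracle -> A -> seq B) (b : oracle -> A -> nat) :
  PT (fun O p => f O p.1.1 p.1.2 p.2) -> PT z -> PT l -> PB b ->
  (forall O a i, esize (foldl (f O a) (z O a) (take i (l O a))) <= b O a) ->
  PT (fun O a => foldl (f O a) (z O a) (l O a)).
Proof.
move=> [pf [cf [Tf [[Cf [kf pTf]] hf]]]] hz hl pb hb.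
split; first by apply: PB_le pb _ => O a; have := hb O a (size (l O a)); rewrite take_size.
have [_ [c0 [T0 [pT0 h0]]]] := PT_pair hl (PT_pair hz PT_id).
(* The loop state holds the remaining list, the accumulator and the argument. The first assignment
   prepares the triple expected by [cf] and saves the tail and the argument on the stack. *)
pose body := Seq (Assign 0 (Pair
     (Pair (Pair (Snd (Snd (Fst (Var 0)))) (Fst (Snd (Fst (Var 0))))) (Fst (Fst (Fst (Var 0)))))
     (Pair (Pair (Snd (Fst (Fst (Var 0)))) (Snd (Snd (Fst (Var 0))))) (Snd (Var 0)))))
  (Seq cf (Assign 0 (Pair (Pair (Fst (Fst (Snd (Var 0))))
                          (Pair (Fst (Var 0)) (Snd (Fst (Snd (Var 0))))))
                    (Snd (Snd (Var 0)))))).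
(* A list is encoded by a pair exactly when it is nonempty. *)
pose g := IsPair (Fst (Fst (Var 0))).
pose (Tb := fun (O : oracle) (a : A) => Cf * (esize a + b O a + esize (l O a) + 2) ^ kf).
exists (Seq c0 (Seq (While g body) (Assign 0 (Pair (Fst (Snd (Fst (Var 0)))) (Snd (Var 0)))))),
  (fun O a => (T0 O a + ((100 + esize (l O a) * (Tb O a + 100)) + 20).+1).+1).
split.
  have pl : PB (fun O a => esize (l O a)) := PT_PB hl.
  have pTb : PB Tb.
    have p1 : PB (fun O a => esize a + b O a + esize (l O a) + 2).
      by repeat (apply: PB_add || apply: PB_const || apply: PB_size || assumption).
    have [C [k h]] := p1; exists (Cf * C ^ kf), (k * kf) => O a.
    rewrite /Tb -mulnA leq_mul2l expnM -expnMn; apply/orP; right.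
    by case: (kf) => // j; rewrite leq_exp2r //; apply: h.
  pb.
move=> O a st s hs; apply: runs_seq; apply: runs_weak (h0 _ _ _ _ hs) _ _ => //= {hs} s1 h1.
apply: runs_seq.
pose (Inv := fun i (s : store) => s 0 = VPair (VPair (enc (drop i (l O a)))
                  (VPair (enc (foldl (f O a) (z O a) (take i (l O a)))) (enc a))) st).
suff loop i s2 : i <= size (l O a) -> Inv i s2 ->
    runs O (While g body) s2 (100 + (size (l O a) - i) * (Tb O a + 100)) (Inv (size (l O a))).
  apply: runs_weak (loop 0 s1 _ _) _ _ => //.
  - by rewrite /Inv drop0 take0.
  - by rewrite subn0 leq_add2l leq_mul2r (ltnW (esize_len _)) orbT.
  move=> s2 i2; apply: runs_assign => //=.
  by rewrite /update eqxx i2 /= take_size.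
move: {-1}(size (l O a) - i) (erefl (size (l O a) - i)) => n.
elim: n i s2 => [|n IH] i s2 hn hi i2.
  have ei : i = size (l O a) by lia.
  exists 5, s2; split; [|by lia|by rewrite -ei].
  apply: (@ExecWhileDone O g body s2).
  by rewrite /g /= i2 /= drop_oversize ?ei.
have lti : i < size (l O a) by lia.
have d : B by case: (l O a) lti.
have [t [s3 [e le i3]]] : runs O body s2 (Tb O a + 90) (Inv i.+1).
  apply: (@runs_weak _ _ _ (40 + (Tb O a + 40).+1).+1 _ (Inv i.+1)) => //; last by lia.
  apply: runs_seq; apply: runs_assign => //.
  rewrite /= i2 (drop_nth d lti) /=.
  apply: runs_seq.
  set x := nth d _ i; set acc := foldl _ _ _.
  apply: runs_weak (hf O (a, acc, x) (VPair (VPair (enc (drop i.+1 (l O a))) (enc a)) st) _ _) _ _ => //.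
    apply: leq_trans (pTf _ _) _; rewrite /Tb leq_mul2l; apply/orP; right.
    case: (kf) => // j; rewrite leq_exp2r // !esize_pair.
    have := hb O a i; rewrite -/acc; have := @esize_mem B H0 (l O a) i d lti; rewrite -/x; lia.
  move=> s3 h3; apply: runs_assign => //=.
  rewrite /Inv /update eqxx /= h3 /= (take_nth d lti) foldl_rcons //.
have [t2 [s4 [e2 le2 i4]]] := IH i.+1 s3 ltac:(lia) ltac:(lia) i3.
exists (4 + t + t2).+1, s4; split=> //; last by rewrite mulSn; lia.
apply: (@ExecWhileStep O g body s2) e e2.
by rewrite /g /= i2 (drop_nth d lti).
Qed.

(** The successor accounts for the terminating [VNum 0], which occurs twice on the right. *)
Lemma esize_cat A `{Enc A} (l1 l2 : seq A) : (esize (l1 ++ l2)).+1 = esize l1 + esize l2.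
Proof. by elim: l1 => [|x l IH] //; rewrite cat_cons !esize_cons addSn -addnA -IH addnS. Qed.

Lemma esize_rev A `{Enc A} (l : seq A) : esize (rev l) = esize l.
Proof.
elim: l => // x l IH; rewrite rev_cons -cats1 esize_cons; apply: succn_inj.
rewrite esize_cat IH esize_cons -[esize [::]]/1; lia.
Qed.

Lemma esize_filter A `{Enc A} (p : pred A) (l : seq A) : esize (filter p l) <= esize l.
Proof. by elim: l => //= x l IH; case: (p x); rewrite !esize_cons; lia. Qed.

Lemma esize_take A `{Enc A} (l : seq A) i : esize (take i l) <= esize l.
Proof. by elim: l i => [|x l IH] [|i] //=; rewrite !esize_cons; have := IH i; lia. Qed.

Lemma esize_bound A `{Enc A} (l : seq A) M :
  all (fun x => esize x <= M) l -> esize l <= size l * M.+1 + 1.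
Proof.
by elim: l => //= x l IH /andP[h /IH {}IH]; rewrite esize_cons mulSn; lia.
Qed.

Lemma esize_all A `{Enc A} (l : seq A) : all (fun x => esize x <= esize l) l.
Proof.
elim: l => //= x l IH; rewrite esize_cons leqW ?leq_addr //=.
by apply: sub_all IH => y hy; rewrite leqW // (leq_trans hy) ?leq_addl.
Qed.

(** Turns a bound for a loop body, stated on pairs, into a bound in the outer argument alone, when
    the loop variable has bounded size. *)
Lemma PB_fiber A B `{Enc A} `{Enc B} (m : oracle -> A * B -> nat) (n : oracle -> A -> nat) :
  PB m -> PB n -> exists2 g : oracle -> A -> nat, PB g &
    forall O a x, esize x <= n O a -> m O (a, x) <= g O a.
Proof.
move=> [C [k h]] [C' [k' h']].
exists (fun O a => C * (esize a + n O a + 1) ^ k).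
  exists (C * (C' + 2) ^ k), (k' * k + k) => O a; rewrite -mulnA leq_mul2l; apply/orP; right.
  rewrite expnD expnM -!expnMn; case: (k) => // j; rewrite leq_exp2r //.
  have s0 : 0 < esize a by exact: esize_gt0.
  move: (esize a) (n O a) s0 (h' O a) => s t s0 ht.
  have : 0 < s ^ k' by rewrite expn_gt0 s0.
  by move: (s ^ k') ht => u ht u0; have : C' * u + u + s <= (C' + 2) * (u * s); nia.
move=> O a x hx; apply: leq_trans (h _ _) _; rewrite leq_mul2l; apply/orP; right.
by case: (k) => // j; rewrite leq_exp2r // esize_pair; lia.
Qed.


Lemma PT_nil A `{Enc A} B `{Enc B} : PT (fun _ (_ : A) => [::] : seq B).
Proof. exact: (PT_cst (z := 0)). Qed.

Lemma PT_cons A `{Enc A} B `{Enc B} (f : oracle -> A -> B) (g : oracle -> A -> seq B) :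
  PT f -> PT g -> PT (fun O a => f O a :: g O a).
Proof. exact: PT_pair. Qed.

Lemma PT_rev A `{Enc A} B `{Enc B} (l : oracle -> A -> seq B) : PT l -> PT (fun O a => rev (l O a)).
Proof.
move=> hl; apply: (@PT_ext _ _ _ _ (fun O a => foldl (fun acc x => x :: acc) [::] (l O a))).
  by move=> O a; rewrite -[rev _]cats0 -catrevE /rev; elim: (l O a) [::] => //=.
apply: (PT_foldl (f := fun O a acc x => x :: acc)) (PT_PB hl) _ => //.
- cbv beta; by apply: PT_cons; [apply: PT_snd PT_id | apply: PT_snd; apply: PT_fst PT_id].
- exact: PT_nil.
move=> O a i; have -> : forall s : seq B, foldl (fun acc x => x :: acc) [::] s = rev s.
  by move=> s; rewrite /rev; elim: s [::] => //=.
by rewrite esize_rev esize_take.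
Qed.

Lemma PT_map A `{Enc A} B C `{Enc B} `{Enc C} (f : oracle -> A -> B -> C) (l : oracle -> A -> seq B) :
  PT (fun O (p : A * B) => f O p.1 p.2) -> PT l -> PT (fun O a => [seq f O a x | x <- l O a]).
Proof.
move=> hf hl.
have E (g : B -> C) s : foldl (fun acc x => g x :: acc) [::] s = rev (map g s).
  by rewrite /rev; elim: s [::] => //=.
apply: (@PT_ext _ _ _ _ (fun O a => rev (foldl (fun acc x => f O a x :: acc) [::] (l O a)))).
  by move=> O a; rewrite E revK.
apply: PT_rev; have [g pg hg] := PB_fiber (PT_PB hf) (PT_PB hl).
apply: (PT_foldl (f := fun O a acc x => f O a x :: acc)
   (b := fun O a => esize (l O a) * (g O a).+1 + 1)) => //.
- cbv beta; apply: PT_cons; last by apply: PT_snd; apply: PT_fst PT_id.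
  apply: (PT_comp (g := fun O (p : A * B) => f O p.1 p.2) (f := fun O q => (q.1.1, q.2))) => //.
  by apply: PT_pair; [apply: PT_fst; apply: PT_fst PT_id | apply: PT_snd PT_id].
- exact: PT_nil.
- by pb.
move=> O a i; rewrite E esize_rev; apply: leq_trans (@esize_bound _ _ _ (g O a) _) _.
  by rewrite all_map; apply: sub_all (esize_all _) => x /= hx; apply/hg/(leq_trans hx)/esize_take.
rewrite leq_add2r leq_mul2r size_map; apply/orP; right.
exact: leq_trans (ltnW (esize_len _)) (esize_take _ i).
Qed.

Lemma PT_filter A `{Enc A} B `{Enc B} (p : oracle -> A -> B -> bool) (l : oracle -> A -> seq B) :
  PT (fun O (q : A * B) => p O q.1 q.2) -> PT l -> PT (fun O a => [seq x <- l O a | p O a x]).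
Proof.
move=> hf hl.
have E (g : B -> bool) s : foldl (fun acc x => if g x then x :: acc else acc) [::] s = rev (filter g s).
  by rewrite /rev; elim: s [::] => //= x s IH acc; rewrite IH; case: (g x).
apply: (@PT_ext _ _ _ _
   (fun O a => rev (foldl (fun acc x => if p O a x then x :: acc else acc) [::] (l O a)))).
  by move=> O a; rewrite E revK.
apply: PT_rev.
apply: (PT_foldl (f := fun O a acc x => if p O a x then x :: acc else acc)) (PT_PB hl) _ => //.
- cbv beta; have h1 : PT (fun _ (q : A * seq B * B) => q.1.2) by apply: PT_snd; apply: PT_fst PT_id.
  apply: PT_if => //; last by apply: PT_cons => //; apply: PT_snd PT_id.
  apply: (PT_comp (g := fun O (q : A * B) => p O q.1 q.2) (f := fun O q => (q.1.1, q.2))) => //.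
  by apply: PT_pair; [apply: PT_fst; apply: PT_fst PT_id | apply: PT_snd PT_id].
- exact: PT_nil.
by move=> O a i; rewrite E esize_rev (leq_trans (esize_filter _ _)) ?esize_take.
Qed.

Lemma PT_cat A `{Enc A} B `{Enc B} (f g : oracle -> A -> seq B) :
  PT f -> PT g -> PT (fun O a => f O a ++ g O a).
Proof.
move=> hf hg.
have E (s t : seq B) : foldl (fun acc x => x :: acc) t s = rev s ++ t.
  by rewrite -catrevE; elim: s t => //=.
apply: (@PT_ext _ _ _ _ (fun O a => foldl (fun acc x => x :: acc) (g O a) (rev (f O a)))).
  by move=> O a; rewrite E revK.
apply: (PT_foldl (f := fun O a acc x => x :: acc) (b := fun O a => esize (f O a) + esize (g O a))) => //.
- cbv beta; by apply: PT_cons; [apply: PT_snd PT_id | apply: PT_snd; apply: PT_fst PT_id].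
- exact: PT_rev.
- by pb.
move=> O a i; rewrite E -ltnS esize_cat esize_rev leqW // leq_add2r.
by apply: leq_trans (esize_take _ _) _; rewrite esize_rev.
Qed.

Lemma PT_flatten A `{Enc A} B `{Enc B} (f : oracle -> A -> seq (seq B)) :
  PT f -> PT (fun O a => flatten (f O a)).
Proof.
move=> hf.
have E (s : seq (seq B)) t : foldl cat t s = t ++ flatten s.
  by elim: s t => [|x s IH] t /=; rewrite ?cats0 // IH catA.
apply: (@PT_ext _ _ _ _ (fun O a => foldl cat [::] (f O a))); first by move=> O a; rewrite E.
apply: (PT_foldl (f := fun O a => cat)) (PT_PB hf) _ => //.
- cbv beta; by apply: PT_cat; [apply: PT_snd; apply: PT_fst PT_id | apply: PT_snd PT_id].
- exact: PT_nil.
move=> O a i; rewrite E /=; apply: leq_trans (esize_take _ i).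
elim: (take i _) => //= x s IH; rewrite esize_cons -ltnS esize_cat; lia.
Qed.

Lemma esize_nat (n : nat) : esize n <= n.+1.
Proof. exact: int_size_abs. Qed.

Lemma PT_size A `{Enc A} B `{Enc B} (f : oracle -> A -> seq B) : PT f -> PT (fun O a => size (f O a)).
Proof.
move=> hf.
have E (s : seq B) n : foldl (fun k _ => k + 1) n s = n + size s.
  by elim: s n => [|x s IH] n /=; rewrite ?addn0 // IH; lia.
apply: (@PT_ext _ _ _ _ (fun O a => foldl (fun k _ => k + 1) 0 (f O a))); first by move=> O a; rewrite E.
apply: (PT_foldl (f := fun O a k _ => k + 1)) (PT_PB hf) _ => //.
- cbv beta; apply: PT_addn; first by apply: PT_snd; apply: PT_fst PT_id.
  exact: (PT_cst (z := 1)).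
- exact: (PT_cst (z := 0)).
move=> O a i; rewrite E add0n; apply: leq_trans (esize_nat _) _.
exact: leq_trans (esize_len _) (esize_take _ _).
Qed.

Lemma PT_sumz A `{Enc A} (f : oracle -> A -> seq int) : PT f -> PT (fun O a => \sum_(x <- f O a) x)%R.
Proof.
move=> hf.
have E (s : seq int) n : foldl (fun k x => k + x)%R n s = (n + \sum_(x <- s) x)%R.
  by elim: s n => [|x s IH] n /=; rewrite ?big_nil ?addr0 // IH big_cons addrA.
apply: (@PT_ext _ _ _ _ (fun O a => foldl (fun k x => k + x)%R 0%R (f O a))).
  by move=> O a; rewrite E add0r.
apply: (PT_foldl (f := fun O a k x => k + x)%R) (PT_PB hf) _ => //.
- cbv beta; by apply: PT_addz; [apply: PT_snd; apply: PT_fst PT_id | apply: PT_snd PT_id].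
- exact: (PT_cst (z := 0)).
move=> O a i; rewrite E add0r; apply: leq_trans (esize_take _ i).
elim: (take i _) => [|x s IH]; first by rewrite big_nil.
rewrite big_cons esize_cons leqW //; apply: leq_trans (leq_add (leqnn (esize x)) IH).
by change (int_size (x + \sum_(j <- s) j)%R <= int_size x + int_size (\sum_(j <- s) j)%R);
  apply: int_size_add; lia.
Qed.

(** The length is that of a given list and not a given number: numbers are binary, so counting up to
    one may take exponential time. *)
Lemma PT_iota A `{Enc A} B `{Enc B} (f : oracle -> A -> seq B) : PT f -> PT (fun O a => iota 0 (size (f O a))).
Proof.
move=> hf.
pose st := fun (p : nat * seq nat) (_ : B) => (p.1 + 1, p.1 :: p.2).
have E (s : seq B) n t : foldl st (n, t) s = (n + size s, rev (iota n (size s)) ++ t).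
  elim: s n t => [|x s IH] n t /=; first by rewrite addn0.
  by rewrite IH rev_cons cat_rcons !addn1 addSnnS.
apply: (@PT_ext _ _ _ _ (fun O a => rev (foldl st (0, [::]) (f O a)).2)).
  by move=> O a; rewrite E /= cats0 revK.
apply: PT_rev; apply: PT_snd.
apply: (PT_foldl (f := fun O a => st)
    (b := fun O a => (esize (f O a) + (esize (f O a) * (esize (f O a)).+1 + 1)).+1)) => //.
- cbv beta; have h : PT (fun _ (q : A * (nat * seq nat) * B) => q.1.2) by apply: PT_snd; apply: PT_fst PT_id.
  apply: PT_pair; last by apply: PT_cons; [apply: PT_fst | apply: PT_snd].
  by apply: PT_addn; [apply: PT_fst | apply: (PT_cst (z := 1))].
- by apply: PT_pair; [apply: (PT_cst (z := 0)) | apply: PT_nil].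
- by pb.
move=> O a i; rewrite E esize_pair cats0 esize_rev add0n.
have hs : size (take i (f O a)) < esize (f O a).
  exact: leq_trans (esize_len _) (esize_take _ _).
apply: leq_ltn_trans (leq_add (esize_nat _) (@esize_bound _ _ _ (esize (f O a)) _)) _.
  apply/allP => j; rewrite mem_iota add0n => /andP[_ hj].
  by apply: leq_trans (esize_nat _) _; apply: leq_trans (ltnW hs); apply: hj.
by rewrite size_iota; nia.
Qed.

Lemma PT_nth A `{Enc A} B `{Enc B} (d : oracle -> A -> B) (l : oracle -> A -> seq B) (i : oracle -> A -> nat) :
  PT d -> PT l -> PT i -> PT (fun O a => nth (d O a) (l O a) (i O a)).
Proof.
move=> hd hl hi.
pose st := fun i (p : nat * B) x => (p.1 + 1, if p.1 == i then x else p.2).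
(* Once the counter has passed [n], the stored element no longer changes. *)
have E1 (s : seq B) n k t : n < k -> foldl (st n) (k, t) s = (k + size s, t).
  elim: s k t => [|x s IH] k t lk; first by rewrite addn0.
  by rewrite /= {2}/st /= gtn_eqF // addn1 IH ?addSnnS // ltnW.
have E (s : seq B) n k t : k <= n -> foldl (st n) (k, t) s = (k + size s, nth t s (n - k)).
  elim: s k t => [|x s IH] k t lk; first by rewrite addn0 nth_nil.
  rewrite /= {2}/st /= addn1 addnS -addSn; case: eqP => [->|ne].
    by rewrite subnn E1 //.
  by rewrite IH; [rewrite (_ : n - k = (n - k.+1).+1) //; lia | lia].
apply: (@PT_ext _ _ _ _ (fun O a => (foldl (st (i O a)) (0, d O a) (l O a)).2)).
  by move=> O a; rewrite E // subn0.
apply: PT_snd.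
apply: (PT_foldl (f := fun O a => st (i O a))
    (b := fun O a => (esize (l O a) + (esize (d O a) + esize (l O a))).+1)) => //.
- cbv beta; have h : PT (fun _ (q : A * (nat * B) * B) => q.1.2) by apply: PT_snd; apply: PT_fst PT_id.
  apply: PT_pair; first by apply: PT_addn; [apply: PT_fst | apply: (PT_cst (z := 1))].
  apply: PT_if; [|exact: PT_snd PT_id|exact: PT_snd].
  apply: PT_eqn; first exact: PT_fst.
  apply: (PT_comp (g := i) (f := fun O q => q.1.1)) => //.
  by apply: PT_fst; apply: PT_fst PT_id.
- by apply: PT_pair => //; apply: (PT_cst (z := 0)).
- by pb.
move=> O a j; rewrite E // esize_pair add0n subn0 ltnS; apply: leq_add.
  by apply: leq_trans (esize_nat _) _; exact: leq_trans (esize_len _) (esize_take _ _).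
case: (ltnP (i O a) (size (take j (l O a)))) => hj.
  apply: leq_trans (esize_mem _ hj) _; apply: leq_trans (esize_take _ _) _; exact: leq_addl.
by rewrite nth_default // leq_addr.
Qed.

Lemma PT_count A `{Enc A} B `{Enc B} (p : oracle -> A -> B -> bool) (l : oracle -> A -> seq B) :
  PT (fun O (q : A * B) => p O q.1 q.2) -> PT l -> PT (fun O a => count (p O a) (l O a)).
Proof.
move=> hp hl; apply: PT_ext (PT_size (PT_filter hp hl)) => O a; by rewrite size_filter.
Qed.

Lemma PT_has A `{Enc A} B `{Enc B} (p : oracle -> A -> B -> bool) (l : oracle -> A -> seq B) :
  PT (fun O (q : A * B) => p O q.1 q.2) -> PT l -> PT (fun O a => has (p O a) (l O a)).
Proof.
move=> hp hl.
apply: PT_ext (PT_leqn (PT_cst (z := 1) (b := 1) (erefl _)) (PT_count hp hl)) => O a.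
by rewrite has_count.
Qed.

(** * Matroids *)

Section Rank.
Variables (R : finType) (N : {set {set R}}).
Hypothesis hN : is_matroid N.

Definition mrank (A : {set R}) := \max_(I in N | I \subset A) #|I|.

Lemma mrank_ge (I A : {set R}) : I \in N -> I \subset A -> #|I| <= mrank A.
Proof. by move=> h1 h2; rewrite /mrank; apply: (bigop.bigmax_sup I); rewrite ?h1. Qed.

Lemma mrank_mono (A B : {set R}) : A \subset B -> mrank A <= mrank B.
Proof.
move=> h; apply/bigop.bigmax_leqP => I /andP[h1 h2]; apply: mrank_ge => //; exact: subset_trans h.
Qed.

(** As long as [I] is smaller than a maximum independent subset of [A], the exchange axiom supplies
    an element of that subset to add. *)
Lemma mrank_ext (I A : {set R}) : I \in N -> I \subset A ->
  exists J, [/\ J \in N, I \subset J, J \subset A & #|J| = mrank A].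
Proof.
case: hN => n0 nd nx hI IA.
have [k] := ubnP (mrank A - #|I|); elim: k I hI IA => // k IH I hI IA hk.
have := mrank_ge hI IA; rewrite leq_eqVlt => /orP[/eqP e|lt]; first by exists I.
have [K /andP[hK KA] eK] : {K : {set R} | (K \in N) && (K \subset A) & mrank A = #|K|}.
  by apply: (@bigop.eq_bigmax_cond _ (fun K : {set R} => (K \in N) && (K \subset A)) (fun K => #|K|));
     apply/card_gt0P; exists set0; rewrite unfold_in n0 sub0set.
rewrite eK in lt; have [x] := nx _ _ hI hK lt. rewrite inE => /andP[xI xK] hx.
have xA : x |: I \subset A by rewrite subUset sub1set IA (subsetP KA).
have [] := IH _ hx xA; first by rewrite cardsU1 xI; move: hk lt; rewrite -eK; lia.
by move=> J [h1 h2 h3 h4]; exists J; split=> //; apply: subset_trans h2; apply: subsetUr.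
Qed.

(** Submodularity: extend a basis [I] of the intersection within [A] to [J], and then to a basis [K]
    of the union; inclusion-exclusion for the traces of [K] on [A] and [B] gives the bound. *)
Lemma mrank_sub (A B : {set R}) : mrank (A :|: B) + mrank (A :&: B) <= mrank A + mrank B.
Proof.
case: (hN) => n0 nd nx.
have [I [hI _ IAB eI]] := mrank_ext n0 (sub0set (A :&: B)).
have [J [hJ IJ JA eJ]] := mrank_ext hI (subset_trans IAB (subsetIl A B)).
have [K [hK JK KAB eK]] := mrank_ext hJ (subset_trans JA (subsetUl A B)).
have h1 : #|K :&: A| <= mrank A.
  by apply: mrank_ge; [apply: nd hK; apply: subsetIl | apply: subsetIr].
have h2 : #|K :&: B| <= mrank B.
  by apply: mrank_ge; [apply: nd hK; apply: subsetIl | apply: subsetIr].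
have h3 : #|I| <= #|K :&: (A :&: B)|.
  by apply: subset_leq_card; rewrite subsetI IAB andbT (subset_trans IJ).
have := cardsUI (K :&: A) (K :&: B).
rewrite -setIUr (setIidPl KAB) -setIIr; lia.
Qed.

Definition mweight (p : R -> nat) := \max_(I in N) \sum_(x in I) p x.

Lemma mweight_ge p (I : {set R}) : I \in N -> \sum_(x in I) p x <= mweight p.
Proof. by move=> h; rewrite /mweight; apply: (bigop.bigmax_sup I). Qed.

Lemma mweight_ex p : exists2 I, I \in N & mweight p = \sum_(x in I) p x.
Proof.
case: hN => n0 _ _.
have [|I hI e] := @bigop.eq_bigmax_cond _ (mem N) (fun I : {set R} => \sum_(x in I) p x).
  by apply/card_gt0P; exists set0.
by exists I.
Qed.

Definition level (p : R -> nat) k := [set x | k < p x].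

Lemma sum_level p b (I : {set R}) : (forall x, p x <= b) ->
  \sum_(x in I) p x = \sum_(k < b) #|I :&: level p k|.
Proof.
move=> hb; transitivity (\sum_(x in I) \sum_(k < b) (k < p x)).
  have S m c : \sum_(k < c) (k < m) = minn c m.
    by elim: c => [|c IH]; rewrite ?big_ord0 ?min0n // big_ord_recr /= IH; lia.
  by apply: eq_bigr => x _; rewrite S; have := hb x; lia.
rewrite exchange_big; apply: eq_bigr => k _ /=.
rewrite -sum1_card big_mkcond [RHS]big_mkcond /=; apply: eq_bigr => x _.
by rewrite !inE; case: (x \in I) => //=; case: (_ < _).
Qed.

(** Optimality of the greedy method: a set extended through the level sets, from the highest
    threshold down, has a trace of maximum size on all of them at once. *)
Lemma mweight_level p b : (forall x, p x <= b) -> mweight p = \sum_(k < b) mrank (level p k).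
Proof.
move=> hb; case: (hN) => n0 nd _; apply/eqP; rewrite eqn_leq; apply/andP; split.
  apply/bigop.bigmax_leqP => I hI; rewrite (sum_level _ hb); apply: leq_sum => k _.
  by apply: mrank_ge; [apply: nd hI; apply: subsetIl | apply: subsetIr].
have [B hB eB] : exists2 B, B \in N & forall k, k < b -> mrank (level p k) <= #|B :&: level p k|.
  suff aux j : exists B, [/\ B \in N, B \subset level p (b - j) &
      forall k, b - j <= k -> k < b -> mrank (level p k) <= #|B :&: level p k|].
    by have [B [h1 _ h2]] := aux b; exists B => // k; apply: h2; rewrite subnn.
  elim: j => [|j [B [hB hs hk]]].
    by exists set0; split; rewrite ?sub0set // => k; lia.
  have hs' : B \subset level p (b - j.+1).
    by apply: subset_trans hs _; apply/subsetP => x; rewrite !inE; lia.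
  have [J [hJ BJ Js eJ]] := mrank_ext hB hs'; exists J; split=> // k k1 k2.
  case: (ltnP k (b - j)) => hkj.
    by rewrite (_ : k = b - j.+1) -?eJ ?(setIidPl Js) //; lia.
  apply: leq_trans (hk k hkj k2) _; apply: subset_leq_card; exact: setSI.
apply: leq_trans (mweight_ge p hB); rewrite (sum_level _ hb); apply: leq_sum => k _; exact: eB.
Qed.

Definition bump_price (p : R -> nat) (Y : {set R}) x := p x + (x \in Y).

Lemma mweight_bump p (Y : {set R}) (I : {set R}) :
  \sum_(x in I) bump_price p Y x = \sum_(x in I) p x + #|I :&: Y|.
Proof.
rewrite big_split /=; congr (_ + _); rewrite -sum1_card big_mkcond [RHS]big_mkcond /=.
by apply: eq_bigr => x _; rewrite !inE; case: (x \in I) => //=; case: (_ \in _).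
Qed.

(** At each threshold the level sets for [Y] and [Z] have as union and intersection those for
    [Y :|: Z] and [Y :&: Z], so rank submodularity can be summed over the thresholds. *)
Lemma mweight_sub p (Y Z : {set R}) :
  mweight (bump_price p (Y :|: Z)) + mweight (bump_price p (Y :&: Z)) <=
  mweight (bump_price p Y) + mweight (bump_price p Z).
Proof.
pose b := (\max_x p x).+1.
have hb U x : bump_price p U x <= b.
  have : p x <= \max_x p x by apply: bigop.leq_bigmax.
  by rewrite /bump_price /b; case: (_ \in _); lia.
rewrite !(@mweight_level _ b) // -!big_split /=; apply: leq_sum => k _.
apply: leq_trans (mrank_sub _ _); apply: leq_add; apply: mrank_mono.
all: by apply/subsetP => x; rewrite !inE /bump_price !inE; case: (x \in Y); case: (x \in Z) => /=; lia.
Qed.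


Lemma mweight_mono p (Y Z : {set R}) : Y \subset Z ->
  mweight (bump_price p Y) <= mweight (bump_price p Z).
Proof.
move=> h; have [I hI ->] := mweight_ex (bump_price p Y).
apply: leq_trans (mweight_ge _ hI); rewrite !mweight_bump leq_add2l subset_leq_card //.
exact: setIS.
Qed.

Lemma mweight_bump0 p : mweight (bump_price p set0) = mweight p.
Proof. by apply: eq_bigr => I _; apply: eq_bigr => x _; rewrite /bump_price inE addn0. Qed.

End Rank.

(* Rado's theorem by Welsh's argument: thin out the lists while Hall's condition holds. *)
Lemma rado (L R : finType) (f : {set R} -> nat) (G : L -> {set R}) :
  (forall Y Z, f (Y :|: Z) + f (Y :&: Z) <= f Y + f Z) ->
  (forall Y Z : {set R}, Y \subset Z -> f Y <= f Z) ->
  f set0 = 0 ->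
  (forall A : {set L}, #|A| <= f (\bigcup_(l in A) G l)) ->
  exists mu : L -> R, (forall l, mu l \in G l) /\ forall A : {set L}, #|A| <= f (mu @: A).
Proof.
move=> fsub fmono f0.
have [k] := ubnP (\sum_l #|G l|); elim: k G => // k IH G hk hall.
have ne l : 0 < #|G l|.
  have := hall [set l]; rewrite big_set1 cards1 => h.
  by rewrite card_gt0; apply/eqP => e; rewrite e f0 in h.
case: (boolP [forall l, #|G l| == 1]) => [/forallP h1|].
  have hx l : {x | G l == [set x]}.
    by apply: sigW; have /cards1P[x ->] := h1 l; exists x.
  exists (fun l => sval (hx l)); split=> [l|A]; first by case: (hx l) => x /= /eqP ->; rewrite inE.
  apply: leq_trans (hall A) _; apply: fmono; apply/bigcupsP => l lA.
  have e : G l = [set sval (hx l)] by case: (hx l) => x /= /eqP.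
  by rewrite e sub1set; apply: imset_f.
case/forallPn => l hl.
have [x [y [xG yG xy]]] : exists x y, [/\ x \in G l, y \in G l & x != y].
  have : 1 < #|G l| by have := ne l; lia.
  by case/card_gt1P => x [y [h1 h2 h3]]; exists x, y.
pose Gm z := fun l' => if l' == l then G l :\ z else G l'.
have sm z : z \in G l -> \sum_l' #|Gm z l'| < \sum_l' #|G l'|.
  move=> zG; rewrite (bigD1 l) //= [X in _ < X](bigD1 l) //= /Gm eqxx (cardsD1 z (G l)) zG.
  by rewrite addSn ltnS leq_add2l; apply: eq_leq; apply: eq_bigr => l' /negPf ->.
have try z : z \in G l -> ~ (exists mu : L -> R, (forall l, mu l \in G l) /\ forall A : {set L}, #|A| <= f (mu @: A)) ->
   exists2 A : {set L}, l \notin A & f (\bigcup_(l' in A) G l' :|: (G l :\ z)) <= #|A|.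
  move=> zG nex.
  case: (boolP [forall A : {set L}, #|A| <= f (\bigcup_(l' in A) Gm z l')]) => [/forallP h|].
    case: nex; have [|mu [h1 h2]] := IH (Gm z) _ h.
      by have := sm z zG; lia.
    exists mu; split=> // l'; have := h1 l'; rewrite /Gm; case: eqP => // ->.
    by rewrite inE => /andP[].
  case/forallPn => A; rewrite -ltnNge => hA.
  have lA : l \in A.
    apply: contraLR hA => lA; rewrite -leqNgt; apply: leq_trans (hall A) _; apply: fmono.
    apply/bigcupsP => l' l'A; rewrite (bigcup_max l') // /Gm; case: eqP => // e.
    by rewrite -e l'A in lA.
  exists (A :\ l); first by rewrite !inE eqxx.
  rewrite -ltnS; move: hA; rewrite (cardsD1 l A) lA add1n; apply: leq_ltn_trans; apply: fmono.
  rewrite subUset; apply/andP; split.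
    apply/bigcupsP => l'; rewrite !inE => /andP[ne' l'A].
    by rewrite (bigcup_max l') // /Gm (negPf ne').
  by rewrite (bigcup_max l) // /Gm eqxx.
apply: boolp.contrapT => nex.
have [A lA hA] := try x xG nex; have [B lB hB] := try y yG nex.
(* The two violators contradict submodularity: the union of their sets contains the lists of [l],
   [A] and [B], because [x] and [y] differ, and the intersection contains those of [A :&: B]. *)
have := fsub (\bigcup_(l' in A) G l' :|: G l :\ x) (\bigcup_(l' in B) G l' :|: G l :\ y).
have h1 : #|l |: (A :|: B)| <= f (\bigcup_(l' in A) G l' :|: G l :\ x :|: (\bigcup_(l' in B) G l' :|: G l :\ y)).
  apply: leq_trans (hall _) _; apply: fmono; apply/bigcupsP => l'; rewrite !inE => /or3P[/eqP->|h|h].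
  - apply/subsetP => z zG; rewrite !inE zG !andbT; case: (eqVneq z x) => [->|]; last by rewrite orbT.
    by rewrite xy !orbT.
  - by apply: subset_trans (bigcup_sup _ h) _; rewrite -setUA subsetUl.
  - apply: subset_trans (bigcup_sup _ h) _; rewrite setUA setUAC subsetUr //.
have h2 : #|A :&: B| <= f ((\bigcup_(l' in A) G l' :|: G l :\ x) :&: (\bigcup_(l' in B) G l' :|: G l :\ y)).
  apply: leq_trans (hall _) _; apply: fmono; apply/bigcupsP => l'; rewrite inE => /andP[h h'].
  by rewrite subsetI !subsetU // (bigcup_sup l') ?orbT.
move: h1; rewrite cardsU1 !inE (negPf lA) (negPf lB) /=.
by have := cardsUI A B; lia.
Qed.

(** * Integral duality for weighted matching into a matroid *)

Section Duality.
Local Open Scope ring_scope.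
Variables (L R : finType) (N : {set {set R}}) (E : L -> {set R}) (w : L -> R -> nat).
Hypothesis hN : is_matroid N.
Hypothesis rkN : forall I, I \in N -> (#|I| <= #|L|)%N.

(** The linear programming dual with prices [p] and profits [u]; the exponentially many rank
    constraints are folded into the single term [mweight N p] of [dual_value]. *)
Definition dual_feasible (p : R -> nat) (u : L -> int) :=
  forall l r, r \in E l -> (w l r)%:Z - (p r)%:Z <= u l.

Definition dual_value (p : R -> nat) (u : L -> int) : int :=
  \sum_l u l + (mweight N p)%:Z.

Definition matching (mu : L -> R) :=
  [/\ injective mu, forall l, mu l \in E l & mu @: setT \in N].

Lemma sum_posz (I : finType) (P : pred I) (F : I -> nat) :
  (\sum_(i | P i) F i)%N%:Z = \sum_(i | P i) (F i)%:Z.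
Proof. exact: (big_morph Posz PoszD (erefl (Posz 0))). Qed.

Lemma weak_duality p u mu : dual_feasible p u -> matching mu ->
  (\sum_l w l (mu l))%N%:Z <= dual_value p u.
Proof.
move=> hf [inj hE hM]; rewrite /dual_value.
have h1 : (\sum_(r in mu @: setT) p r <= mweight N p)%N by apply: mweight_ge.
rewrite big_imset /= in h1; last by move=> x y _ _; apply: inj.
have h2 : \sum_l ((w l (mu l))%:Z - (p (mu l))%:Z) <= \sum_l u l.
  by apply: ler_sum => l _; apply: hf.
rewrite big_split /= sumrN -!sum_posz in h2.
have e : (\sum_(i in [set: L]) p (mu i) = \sum_i p (mu i))%N by apply: eq_bigl => l; rewrite inE.
by move: h1 h2; rewrite e; move: (\sum_i p (mu i))%N (\sum_l w l (mu l))%N (\sum_l u l) (mweight N p) => a b c d; lia.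
Qed.

(** If Hall's condition fails for the tight edges on a set [A], raise the prices on its tight
    neighbourhood and lower [u] on [A]: feasibility is kept and the value drops. Otherwise Rado's
    theorem yields a tight matching of the same value. A step raises each price by at most 1 and
    lowers the value, which stays nonnegative, by at least 1; this bounds [p]. *)
Lemma strong_duality p0 u0 mu0 : dual_feasible p0 u0 -> matching mu0 ->
  exists p u mu, [/\ dual_feasible p u, matching mu,
    forall r, (p r)%:Z <= (p0 r)%:Z + dual_value p0 u0
    & (\sum_l w l (mu l))%N%:Z = dual_value p u].
Proof.
move=> hf0 hmu0.
have pos p u : dual_feasible p u -> 0 <= dual_value p u.
  by move=> hf; apply: le_trans (weak_duality hf hmu0); lia.
suff main k p u : (`|dual_value p u| < k)%N -> dual_feasible p u ->
  exists p' u' mu, [/\ dual_feasible p' u', matching mu,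
    forall r, (p' r)%:Z <= (p r)%:Z + dual_value p u
    & (\sum_l w l (mu l))%N%:Z = dual_value p' u'].
  exact: (main `|dual_value p0 u0|.+1).
elim: k p u => // k IH p u hk hf.
pose G l := [set r in E l | (w l r)%:Z - (p r)%:Z == u l].
(* The increase of the maximum weight plays the role of the rank in Rado's theorem. *)
pose f Y := (mweight N (bump_price p Y) - mweight N p)%N.
have ge0 Y : (mweight N p <= mweight N (bump_price p Y))%N.
  by rewrite -{1}(mweight_bump0 N p); apply: mweight_mono => //; apply: sub0set.
case: (boolP [forall A : {set L}, (#|A| <= f (\bigcup_(l in A) G l))%N]) => [/forallP hall|].
  have [mu [muG hmu]] : exists mu : L -> R, (forall l, mu l \in G l) /\
      forall A : {set L}, (#|A| <= f (mu @: A))%N.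
    apply: rado hall.
    - move=> Y Z; rewrite /f; have := mweight_sub hN p Y Z.
      by have := (ge0 Y, ge0 Z, ge0 (Y :|: Z), ge0 (Y :&: Z)) => -[[[]]]; lia.
    - by move=> Y Z YZ; rewrite /f; apply: leq_sub2r; apply: mweight_mono.
    - by rewrite /f mweight_bump0 subnn.
  have := hmu setT; rewrite cardsT /f; set M := mu @: _ => hM.
  have cM : (#|M| <= #|L|)%N by rewrite -cardsT leq_imset_card.
  have [B hB eB] := mweight_ex hN (bump_price p M).
  have g0 := ge0 M; rewrite eB mweight_bump in hM g0.
  have h1 := mweight_ge p hB; have h2 := rkN hB.
  have h3 : (#|B :&: M| <= #|M|)%N by rewrite subset_leq_card ?subsetIr.
  (* Equality must hold throughout: [B] contains at least [#|L|] elements of [M], while neither set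
     has more than [#|L|] elements. Hence [M] is independent and of maximum price, and [mu] is
     injective. *)
  have eBM : B = M.
    have s1 : B :&: M = M by apply/eqP; rewrite eqEcard subsetIr; move: (#|_|) (#|_|) h3 cM hM h1 h2 => *; lia.
    by apply/esym/eqP; rewrite eqEcard; apply/andP; split; [rewrite -s1 subsetIl | rewrite s1 in hM; lia].
  subst B; have inj : injective mu.
    have : #|M| == #|[set: L]| by rewrite cardsT; rewrite setIid in hM; lia.
    by move/imset_injP => h x y; apply: h; rewrite inE.
  exists p, u, mu; split=> //.
  - by split=> // l; have := muG l; rewrite inE => /andP[].
  - by move=> r; rewrite lerDl; apply: pos.
  rewrite setIid in hM g0.
  have e1 : mweight N p = (\sum_(x in M) p x)%N.
    by move: hM h1 cM g0; move: (mweight N p) (\sum_(x in M) p x)%N #|M| #|L| => a b c d; lia.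
  rewrite /dual_value e1 big_imset /=; last by move=> x y _ _; apply: inj.
  have -> : (\sum_(i in [set: L]) p (mu i) = \sum_i p (mu i))%N by apply: eq_bigl => l; rewrite inE.
  rewrite !sum_posz -big_split /=; apply: eq_bigr => l _.
  by have := muG l; rewrite inE => /andP[_ /eqP <-]; rewrite subrK.
case/forallPn => A; rewrite -ltnNge => hA.
set Y := \bigcup_(l in A) G l in hA.
pose p' := bump_price p Y; pose u' l := u l - (l \in A)%:Z.
have hf' : dual_feasible p' u'.
  move=> l r rE; have := hf l r rE; rewrite /p' /u' /bump_price.
  case lA: (l \in A) => /=; last by case: (r \in Y); lia.
  case rY: (r \in Y) => /=; first lia.
  suff : (w l r)%:Z - (p r)%:Z != u l by lia.
  apply: contraFneq rY => e; apply/bigcupP; exists l => //; by rewrite inE rE e eqxx.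
have dl : dual_value p' u' <= dual_value p u - 1.
  rewrite /dual_value /u' sumrB -sum_posz.
  have -> : (\sum_l (l \in A) = #|A|)%N by rewrite -sum1_card [RHS]big_mkcond; apply: eq_bigr => l _; case: (_ \in _).
  move: hA (ge0 Y); rewrite /f -/p'.
  by move: (mweight N p) (mweight N p') (\sum_l u l) #|A| => a b c d; lia.
have [|p2 [u2 [mu [h1 h2 h3 h4]]]] := IH p' u' _ hf'.
  by have := (pos _ _ hf', pos _ _ hf) => -[]; lia.
exists p2, u2, mu; split=> // r; have := h3 r; move: dl.
rewrite [p' r]/bump_price; move: (dual_value p' u') (dual_value p u) => a b.
by case: (r \in Y) => /=; lia.
Qed.

End Duality.

(** * Packing representatives into locations *)

Section PathPacking.
Variables (n : nat) (F : {set {set 'I_n}}) (near ed : rel 'I_n) (w : 'I_n -> nat).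
Hypothesis hF : is_matroid F.
Local Open Scope ring_scope.

Local Notation slot := ('I_n + 'I_n)%type.
Local Notation rho := (mrank F setT).

Definition locs (I : {set slot}) : {set 'I_n} := [set f | inr f \in I].

(** The direct sum of the free matroid on the representatives ([inl]) and [F] on the locations
    ([inr]). *)
Definition slot_indep : {set {set slot}} := [set I | locs I \in F].

Definition links (al : {set 'I_n}) (v : 'I_n) : {set slot} :=
  inl v |: [set r | match r with inl u => ed v u | inr f => (f \in al) && near v f end].

Definition gain (v : 'I_n) (r : slot) : nat := if r == inl v then 0%N else w v.

(** When [ed] descends, the links followed from a representative matched off its own slot pass
    through smaller ones to a location: a matching is a family of disjoint chains ending in an
    independent set. *)
Definition packing al m := exists2 mu, matching slot_indep (links al) mu &
  (m <= \sum_v gain v (mu v))%N.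

Lemma slot_card (I : {set slot}) : #|I| = (#|[set u | inl u \in I]| + #|locs I|)%N.
Proof.
rewrite -sum1_card big_sumType /= -!sum1_card.
by congr (_ + _)%N; apply: eq_bigl => x; rewrite inE.
Qed.

Lemma slot_matroid : is_matroid slot_indep.
Proof.
have [f0 fd fx] := hF; split.
- by rewrite inE (_ : locs _ = set0) //; apply/setP => x; rewrite !inE.
- move=> A B AB; rewrite !inE; apply: fd; apply/subsetP => x; rewrite !inE; exact: (subsetP AB).
move=> A B; rewrite !inE => hA hB lt.
case: (boolP [exists u, (inl u \in B) && (inl u \notin A)]) => [/existsP[u /andP[uB uA]]|].
  exists (inl u); first by rewrite inE uA.
  by rewrite inE (_ : locs _ = locs A) //; apply/setP => x; rewrite !inE.
rewrite negb_exists => /forallP h.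
have [x] : exists2 x, x \in locs B :\: locs A & x |: locs A \in F.
  apply: fx => //; move: lt; rewrite !slot_card.
  have : (#|[set u | inl u \in B]| <= #|[set u | inl u \in A]|)%N.
    apply: subset_leq_card; apply/subsetP => u; rewrite !inE => uB.
    by have := h u; rewrite uB /= negbK.
  by lia.
rewrite !inE => /andP[xA xB] hx; exists (inr x); first by rewrite inE xA.
by rewrite inE (_ : locs _ = x |: locs A) //; apply/setP => y; rewrite !inE.
Qed.

Lemma slot_rank I : I \in slot_indep -> (#|I| <= n + rho)%N.
Proof.
rewrite inE slot_card => h; apply: leq_add; last exact: mrank_ge.
by rewrite -[X in (_ <= X)%N]card_ord max_card.
Qed.

(** The left side is padded with [rho] dummies of weight 0 linked to every slot, so that it is as
    large as any independent set, as [strong_duality] requires. The dual variable of a dummy is at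
    least [- p r] for every [r], whence the term in [rho]. The initial dual has zero prices and
    value [\sum_v w v], which bounds the final prices. *)
Lemma packing_dual al m : ~ packing al m -> exists p u,
  [/\ dual_feasible (links al) gain p u, forall r, (p r <= \sum_v w v)%N
    & forall r, \sum_v u v - rho%:Z * (p r)%:Z + (mweight slot_indep p)%:Z < m%:Z].
Proof.
move=> hno.
pose L := ('I_n + 'I_rho)%type.
pose E' (l : L) := if l is inl v then links al v else setT.
pose w' (l : L) r := if l is inl v then gain v r else 0%N.
have [f0 fd fx] := hF.
have [B [hB _ _ eB]] := mrank_ext hF f0 (sub0set setT).
(* Every representative starts on its own slot and the dummies on a basis of [F]. *)
pose mu0 (l : L) : slot := match l with inl v => inl v | inr i => inr (enum_val (cast_ord (esym eB) i)) end.
have hmu0 : matching slot_indep E' mu0.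
  split.
  - move=> [x|x] [y|y] //= [] // => [->|/enum_val_inj/cast_ord_inj ->] //.
  - by case=> [v|i] /=; rewrite !inE ?eqxx.
  rewrite inE; apply: fd hB; apply/subsetP => f; rewrite inE => /imsetP[[v|i] _] //= [->].
  exact: enum_valP.
have rk I : I \in slot_indep -> (#|I| <= #|{: L}|)%N.
  by move=> h; rewrite card_sum !card_ord; apply: slot_rank.
pose p0 := fun _ : slot => 0%N.
pose u0 := fun l : L => if l is inl v then (w v)%:Z else 0.
have hf0 : dual_feasible E' w' p0 u0.
  by case=> [v|i] r _; rewrite /= /p0 /gain; [case: ifP|]; lia.
have [p [u [mu [h1 [inj hE hM] h3 h4]]]] := strong_duality slot_matroid rk hf0 hmu0.
have e0 : dual_value slot_indep p0 u0 = (\sum_v w v)%N%:Z.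
  rewrite /dual_value big_sumType /= [X in _ + X + _]big1 // addr0 -sum_posz.
  suff -> : mweight slot_indep p0 = 0%N by rewrite addr0.
  by apply/eqP; rewrite -leqn0; apply/bigop.bigmax_leqP => I _; rewrite big1.
exists p, (fun v => u (inl v)); split.
- by move=> v r hr; apply: (h1 (inl v)).
- by move=> r; have := h3 r; rewrite e0 /p0; lia.
move=> r; have lt : (\sum_v gain v (mu (inl v)) < m)%N.
  rewrite ltnNge; apply/negP => le; apply: hno; exists (mu \o inl) => //; split.
  - by move=> x y /= /inj [].
  - by move=> l; apply: (hE (inl l)).
  - have [_ sd _] := slot_matroid; apply: sd hM; apply/subsetP => x /imsetP[v _ ->].
    by apply/imsetP; exists (inl v).
move: h4; rewrite big_sumType /= [X in (_ + X)%N]big1 // addn0 /dual_value big_sumType /=.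
have : - (rho%:Z * (p r)%:Z) <= \sum_(i < rho) u (inr i).
  apply: (@le_trans _ _ (\sum_(i < rho) - (p r)%:Z)).
    by rewrite sumr_const card_ord -mulr_natl natz mulrN.
  by apply: ler_sum => i _; have := h1 (inr i) r (in_setT _) => /=; lia.
move: lt; move: (\sum_v gain _ _)%N (\sum_i u (inl i)) (\sum_(i < rho) u (inr i)) (mweight _ _) (rho%:Z * _) => a b c d e.
lia.
Qed.

Section Fractional.
Variable rad : 'I_n -> rat.
Hypothesis rad_ed : forall v u, ed v u -> rad u < rad v.
Hypothesis near_ed : forall v u f, (0 < w v)%N -> (0 < w u)%N -> near v f -> near u f ->
  v != u -> ed v u || ed u v.

(* The active balls around a location form a path, each handing over to the next smaller one. *)
Lemma chain_dual p u (C : {set 'I_n}) f : dual_feasible (links setT) gain p u ->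
  (forall v, v \in C -> near v f && (0 < w v)%N) ->
  exists q, (if q is inl v then v \in C /\ (forall v', v' \in C -> rad v' <= rad v)
             else C = set0 /\ q = inr f) /\
   \sum_(v in C) ((w v)%:Z - (p (inl v))%:Z) + (p q)%:Z - (p (inr f))%:Z <= \sum_(v in C) u v.
Proof.
move=> hf; have [k] := ubnP #|C|; elim: k C => // k IH C hk hC.
have [->|[v0 v0C]] := set_0Vmem C.
  by exists (inr f); split=> //; rewrite !big_set0 add0r subrr.
case: (arg_maxP rad v0C) => v vC' vmax; have vC : v \in C := vC'.
have {}vmax j : j \in C -> rad j <= rad v by exact: vmax.
have [||q [hq le]] := IH (C :\ v).
- by move: hk; rewrite (cardsD1 v C) vC add1n ltnS.
- by move=> v'; rewrite inE => /andP[_ /hC].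
(* The largest ball [v] is put in front of the chain. Its link to the former head [q] gives
   [w v - p q <= u v], and the sums telescope. *)
exists (inl v); split=> //.
rewrite !(big_setD1 v vC) /=.
have [nv wv] := andP (hC v vC).
have wq : (w v)%:Z - (p q)%:Z <= u v.
  have := hf v q; rewrite /gain; case: q hq {le} => [v'|f'] [h1 h2].
    have [h3 h4] := setD1P h1; have [nv' wv'] := andP (hC _ h4).
    rewrite (inj_eq (@inl_inj _ _)) (negPf h3); apply; rewrite !inE.
    rewrite eq_sym in h3; have := near_ed wv wv' nv nv' h3.
    case/orP => [->|/rad_ed]; first by rewrite orbT.
    by rewrite ltNge vmax.
  by case: h2 => ->; apply; rewrite !inE nv.
move: le wq; lra.
Qed.

Lemma subset_card (T : finType) (B : {set T}) k : (k <= #|B|)%N ->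
  exists2 A : {set T}, A \subset B & #|A| = k.
Proof.
move=> h; exists [set x in take k (enum B)].
  by apply/subsetP => x; rewrite inE => /mem_take; rewrite mem_enum.
rewrite cardsE (card_uniqP _) ?take_uniq ?enum_uniq // size_take -cardE.
by case: ltnP => //; lia.
Qed.

(** The average of [T] bases is a fractional solution, and everything is multiplied by [T]. Every
    copy of a location serves the balls that use it along a chain; the unserved share of [v] stays
    on its own slot; each basis together with all representative slots is independent, so its price
    is at most [mweight]. Adding these inequalities is weak duality for the fractional packing. *)
Lemma packing_fractional T (I : nat -> {set 'I_n}) p u r :
  (forall t, I t \in F /\ #|I t| = rho) ->
  dual_feasible (links setT) gain p u -> (forall r', (p r <= p r')%N) ->
  \sum_v (w v)%:Z * (minn T (\sum_(t < T) #|I t :&: [set f | near v f]|))%N%:Z <=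
  T%:Z * (\sum_v u v - rho%:Z * (p r)%:Z + (mweight slot_indep p)%:Z).
Proof.
move=> hI hf hr.
(* One copy of a location for each basis containing it. For positive weight, [A v] will select as
   many copies near [v] as the truncated coverage allows. *)
pose Q := [set x : 'I_T * 'I_n | x.2 \in I x.1].
pose B v := [set x in Q | near v x.2].
pose c v := minn T (\sum_(t < T) #|I t :&: [set f | near v f]|).
have cB v : #|B v| = (\sum_(t < T) #|I t :&: [set f | near v f]|)%N.
  rewrite -sum1_card (eq_bigl (fun x : 'I_T * 'I_n => (x.2 \in I x.1) && near v x.2)); last first.
    by move=> x; rewrite !inE.
  rewrite -(pair_big_dep xpredT (fun t f => (f \in I (t : 'I_T)) && near v f) (fun _ _ => 1%N)) /=.
  apply: eq_bigr => t _; rewrite -sum1_card; apply: eq_bigl => f; by rewrite !inE.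
have exA v : exists A : {set 'I_T * 'I_n}, A \subset B v /\ #|A| = if (0 < w v)%N then c v else 0%N.
  case: ifP => _; last by exists set0; rewrite sub0set cards0.
  by have [|A h1 h2] := @subset_card _ (B v) (c v); [rewrite cB geq_minr | exists A].
have [A hA] := boolp.choice exA.
have AQ v x : x \in A v -> x \in Q.
  by have [/subsetP h _] := hA v => /h; rewrite inE => /andP[].
have swap (g : 'I_n -> int) : \sum_(x in Q) \sum_(v | x \in A v) g v = \sum_v (#|A v|)%:Z * g v.
  rewrite (exchange_big_dep xpredT) //=; apply: eq_bigr => v _.
  rewrite (eq_bigl (mem (A v))); last by move=> x; apply: andb_idl; apply: AQ.
  by rewrite sumr_const -mulr_natl natz.
have sumQ (g : 'I_n -> int) : \sum_(x in Q) g x.2 = \sum_(t < T) \sum_(f in I t) g f.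
  rewrite (pair_big_dep xpredT (fun (t : 'I_T) f => f \in I t) (fun _ f => g f)) /=.
  by apply: eq_bigl => x; rewrite inE.
have lt v : (#|A v| <= T)%N.
  by have [_ ->] := hA v; case: ifP => // _; apply: geq_minl.
have h1 : \sum_(x in Q) (\sum_(v | x \in A v) ((w v)%:Z - (p (inl v))%:Z) + ((p r)%:Z - (p (inr x.2))%:Z))
    <= \sum_(x in Q) \sum_(v | x \in A v) u v.
  apply: ler_sum => x xQ; pose C := [set v | x \in A v].
  have [|q [_ le]] := @chain_dual p u C x.2 hf.
    move=> v; rewrite inE => xA; have [/subsetP/(_ x xA) + eA] := hA v.
    rewrite inE => /andP[_ ->] /=; move: eA; case: ifP => // _ e0.
    by have : (0 < #|A v|)%N by [apply/card_gt0P; exists x]; rewrite e0.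
  have eC (g : 'I_n -> int) : \sum_(v | x \in A v) g v = \sum_(v in C) g v.
    by apply: eq_bigl => v; rewrite inE.
  rewrite !eC.
  (* The head of the chain is replaced by the cheapest slot [r]. *)
  by apply: le_trans _ le; rewrite -!addrA lerD2l lerD2r lez_nat hr.
rewrite big_split /= !swap sumrB sumr_const (sumQ (fun f => (p (inr f))%:Z)) in h1.
have cQ : #|Q| = (T * rho)%N.
  have := sumQ (fun _ => 1); rewrite sumr_const (eq_bigr (fun _ => rho%:Z)); last first.
    by move=> t _; rewrite sumr_const (hI t).2 natz.
  rewrite sumr_const card_ord -[_ *+ T]mulr_natl !natz => e.
  by apply/eqP; rewrite -eqz_nat PoszM e.
have h2 : \sum_v (T%:Z - #|A v|%:Z) * - (p (inl v))%:Z <= \sum_v (T%:Z - #|A v|%:Z) * u v.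
  apply: ler_sum => v _; apply: ler_wpM2l; first by have := lt v; lia.
  by have := hf v (inl v); rewrite /gain eqxx sub0r; apply; rewrite !inE eqxx.
have h3 : \sum_(t < T) (\sum_v (p (inl v))%:Z + \sum_(f in I t) (p (inr f))%:Z) <=
    T%:Z * (mweight slot_indep p)%:Z.
  apply: (@le_trans _ _ (\sum_(t < T) (mweight slot_indep p)%:Z)); last first.
    by rewrite sumr_const card_ord -mulr_natl natz.
  apply: ler_sum => t _; pose J := [set s : slot | if s is inr f then f \in I t else true].
  have hJ : J \in slot_indep.
    by rewrite inE (_ : locs J = I t) ?(hI t).1 //; apply/setP => f; rewrite !inE.
  have := mweight_ge p hJ; rewrite big_sumType /= => h.
  rewrite -!sum_posz -PoszD lez_nat; apply: leq_trans h; apply: leq_add.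
    by apply: eq_leq; apply: eq_bigl => v; rewrite inE.
  by apply: eq_leq; apply: eq_bigl => v; rewrite inE.
rewrite big_split sumr_const card_ord /= in h3.
have e1 : \sum_v #|A v|%:Z * ((w v)%:Z - (p (inl v))%:Z) =
    \sum_v (w v)%:Z * (c v)%:Z - \sum_v #|A v|%:Z * (p (inl v))%:Z.
  rewrite -sumrB; apply: eq_bigr => v _; rewrite mulrBr; congr (_ - _).
  by have [_ ->] := hA v; case: posnP => [->|]; rewrite ?mulr0 // mulrC.
have e2 (g : 'I_n -> int) : \sum_v (T%:Z - #|A v|%:Z) * g v = T%:Z * \sum_v g v - \sum_v #|A v|%:Z * g v.
  by rewrite mulr_sumr -sumrB; apply: eq_bigr => v _; rewrite mulrBl.
rewrite e1 in h1; rewrite !e2 sumrN in h2.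
have e3 : \sum_v #|A v|%:Z * - (p (inl v))%:Z = - \sum_v #|A v|%:Z * (p (inl v))%:Z.
  by rewrite -sumrN; apply: eq_bigr => v _; rewrite mulrN.
rewrite e3 in h2; rewrite cQ -[_ *+ (T * rho)]mulr_natl natz in h1; rewrite -[_ *+ T]mulr_natl natz in h3.
rewrite -/c.
move: h1 h2 h3; rewrite PoszM.
move: (\sum_v (w v)%:Z * _) (\sum_v _ * (p (inl v))%:Z) (\sum_v u v) (\sum_(t < T) _) (\sum_v _ * u v) (mweight _ _) (\sum_v (p (inl v))%:Z) => a b d e f g h.
nia.
Qed.

End Fractional.

Section Cover.
Variables (dist : 'I_n -> 'I_n -> rat) (rad : 'I_n -> rat).
Hypothesis tri : forall x y z, dist x z <= dist x y + dist y z.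
Hypothesis ed_dist : forall v u, ed v u -> dist v u <= rad v + rad u.
Hypothesis ed_rad : forall v u, ed v u -> 2 * rad u <= rad v.
Hypothesis near_dist : forall v f, near v f -> dist v f <= rad v.
Hypothesis rad_ge0 : forall v, 0 <= rad v.
Variable height : 'I_n -> rat.
Hypothesis ed_height : forall v u, ed v u -> height u < height v.

(** If [v] is linked to [u], injectivity forces [u] off its own slot, so induction applies to it,
    and [rad v + rad u + 3 * rad u <= 3 * rad v] because radii halve. Descent is measured by
    [height] because the radii are scaled by the ratio and may all vanish. *)
Lemma packing_cover al mu v : matching slot_indep (links al) mu -> mu v != inl v ->
  exists2 f, f \in al & dist v f <= 3 * rad v.
Proof.
move=> [inj hE _]; have [k] := ubnP #|[set x | (height x < height v)%R]|; elim: k v => // k IH v hk nv.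
have := hE v; rewrite !inE (negPf nv) /=; case e : (mu v) => [u|f].
  move=> hed; have [||f fal hd] := IH u.
  - have lt := ed_height hed.
    suff : (#|[set x | (height x < height u)%R]| < #|[set x | (height x < height v)%R]|)%N by lia.
    apply: proper_card; apply/properP; split; last by exists u; rewrite !inE ?ltxx.
    by apply/subsetP => x; rewrite !inE => /lt_trans; apply.
  - by apply: contra nv => /eqP e'; rewrite -e' in e; rewrite (inj _ _ e) e'.
  exists f => //; have := tri v u f; have := ed_dist hed; have := ed_rad hed; lra.
by case/andP => fal /near_dist h; exists f => //; have := rad_ge0 v; lra.
Qed.

End Cover.

End PathPacking.

(** * The algorithm *)

Section Program.
Variable O : oracle.
Local Open Scope ring_scope.
Implicit Types (V : seq nat) (M : seq (seq bool)) (lam : seq int).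

Definition sortd T (key : T -> int) (l : seq T) : seq T :=
  foldl (fun acc x => [seq y <- acc | key x <= key y] ++ x :: [seq y <- acc | ~~ (key x <= key y)])
    [::] l.

Definition greedy T (P : seq T -> bool) (l : seq T) : seq T :=
  foldl (fun J f => if P (f :: J) then f :: J else J) [::] l.

(** Lists the representatives of all points, newest first and with repetitions, so that occurrences
    count as weight. The default of [nth] makes a point with no admissible representative its
    own. *)
Definition targets T (ok : T -> T -> bool) (l : seq T) : seq T :=
  foldl (fun tg u => nth u [seq v <- tg | ok u v] 0 :: tg) [::] l.

Definition at2 M i j := nth false (nth [::] M i) j.

(** Elements with a negative key are taken too: the result is a basis of maximum weight among
    bases. *)
Definition max_basis V (key : seq int) : seq nat :=
  greedy (fun s => O (enc s)) (sortd (fun i => nth 0 key i) V).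

Definition pairs_with (l1 l2 : seq nat) : seq nat := flatten [seq l2 | _ <- l1].

(* A list of length (n+1)^10; loops run over lists, so this serves as a loop bound. *)
Definition ticks V : seq nat :=
  let l := 0%N :: V in let l2 := pairs_with l l in
  let l5 := pairs_with l (pairs_with l2 l2) in pairs_with l5 l5.

Definition clip (K x : int) : int := if x <= 0 then 0 else if K <= x then K else x.

(** [st.1] holds the multipliers, scaled by [K], of the constraints that the coverage of [v] is at
    most x(B(v)). The greedy basis [J] is a best response to them, and [nth 0 c v - 1] is the
    subgradient component at [v]. *)
Definition cover_step V M (K : int) (st : seq int * seq int) : seq int * seq int :=
  let J := max_basis V [seq \sum_(x <- [seq (if at2 M v f then nth 0 st.1 v else 0) | v <- V]) x | f <- V] in
  let c := [seq (count (fun f => at2 M v f) J)%:Z | v <- V] in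
  ([seq clip K (nth 0 st.1 v - nth 0 c v + 1) | v <- V], [seq nth 0 st.2 v + nth 0 c v | v <- V]).

Definition cube V : int := (size V)%:Z * (size V)%:Z * (size V)%:Z.

(* Projected subgradient method for the dual of the fractional covering problem;
   the second component accumulates the primal solution. *)
Definition cover_loop V M : seq int * seq int :=
  foldl (fun st _ => cover_step V M (cube V) st) ([seq 0 | _ <- V], [seq 0 | _ <- V]) (ticks V).

(** Scaled by the number of iterations, so that coverages are integers and 1 becomes [T]. *)
Definition coverage V M : seq int :=
  let T := (size (ticks V))%:Z in
  let X := (cover_loop V M).2 in
  [seq (if nth 0 X v <= T then nth 0 X v else T) | v <- V].

Definition argmax (sc : nat -> int) (x0 : nat) (l : seq nat) : nat :=
  foldl (fun b j => if sc j <= sc b then b else j) x0 l.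

Definition score (K : int) (w lam : seq int) v j : int :=
  (if j == v then 0 else K * nth 0 w v) - nth 0 lam j.

(** Slots are coded as numbers: [u] for a representative and [size V + f] for a location. *)
Definition options V (near ed : seq (seq bool)) (al : seq nat) v : seq nat :=
  [seq u <- V | at2 ed v u] ++ [seq (size V + f)%N | f <- [seq f <- al | at2 near v f]].

Definition V2 V := iota 0 (size (V ++ V)).

(** Every representative demands its most profitable slot, every dummy (one for each element of [J])
    the cheapest slot [r0]; the supply [Jf] is a dearest basis. Prices move by demand minus supply,
    and [D] is the dual value at the current prices. *)
Definition price_step V near ed (w : seq int) (K m : int) al (st : seq int * bool) : seq int * bool :=
  let lam := st.1 in
  let cs := [seq argmax (score K w lam v) v (options V near ed al v) | v <- V] in
  let r0 := argmax (fun j => 0 - nth 0 lam j) 0%N (V2 V) in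
  let J := max_basis V [seq nth 0 lam (size V + f) | f <- V] in
  let ch := cs ++ [seq r0 | _ <- J] in
  let Jf := V ++ [seq (size V + f)%N | f <- J] in
  let D := \sum_(x <- [seq (if nth 0%N cs v == v then 0 else K * nth 0 w v) | v <- V]) x
         - \sum_(x <- [seq nth 0 lam j | j <- ch]) x + \sum_(x <- [seq nth 0 lam j | j <- Jf]) x in
  ([seq nth 0 lam j + (count (fun x => x == j) ch)%:Z - (count (fun x => x == j) Jf)%:Z | j <- V2 V],
   st.2 && (K * m <= D)).

(* Subgradient method for the dual of the path packing problem, scaled by K: the
   flag is cleared as soon as a dual value below K m is met. *)
Definition test V near ed w (m : int) al : bool :=
  (foldl (fun st _ => price_step V near ed w (16 * ((size V)%:Z * (size V)%:Z)) m al st)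
     ([seq 0 | _ <- V2 V], true) (ticks V)).2.

Definition prune V near ed w m : seq nat :=
  foldl (fun al f => let al' := [seq g <- al | ~~ (g == f)] in
      if test V near ed w m al' then al' else al) V V.

Definition weights V (tg : seq nat) : seq int := [seq (count (fun x => x == v) tg)%:Z | v <- V].

Definition decide V near ok ed (m : int) : seq nat :=
  let cv := coverage V near in
  let w := weights V (targets (at2 ok) (sortd (fun i => nth 0 cv i) V)) in
  prune V near ed w m.

Notation frac := (int * int)%type.

(** Fractions are never reduced: all expressions have bounded depth, so sizes stay polynomial. Cross
    multiplication presupposes positive denominators. *)
Definition fle (x y : frac) : bool := x.1 * y.2 <= y.1 * x.2.
Definition fmul (x y : frac) : frac := (x.1 * y.1, x.2 * y.2).
Definition fadd (x y : frac) : frac := (x.1 * y.2 + y.1 * x.2, x.2 * y.2).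

Definition fdist (d : seq (seq frac)) v f : frac := nth (0, 1) (nth [::] d v) f.
Definition frad (r : seq frac) v : frac := nth (0, 1) r v.

Definition touch d r (a : frac) u v : bool := fle (fdist d u v) (fmul a (fadd (frad r u) (frad r v))).
Definition shrink r u v : bool := fle (frad r v) (fmul (2, 1) (frad r u)).

Definition near_mx V d r a := [seq [seq fle (fdist d v f) (fmul a (frad r v)) | f <- V] | v <- V].
(** For touching [u] and [v], either [u] may be assigned to [v] ([ok_mx]) or [v] is linked down to
    [u] ([ed_mx]), according to whether r(v) is at most 2 r(u). *)
Definition ok_mx V d r a := [seq [seq touch d r a u v && shrink r u v | v <- V] | u <- V].
Definition ed_mx V d r a := [seq [seq touch d r a v u && ~~ shrink r u v | u <- V] | v <- V].

(** Checks the factor 9 directly, so a kept set is certified even if the ratio it was computed for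
    is infeasible. *)
Definition accepts V d r (m : nat) (a : frac) (S : seq nat) : bool :=
  O (enc S) &&
  (m <= count (fun v => has (fun f => (fle (fdist d v f) (fmul (9, 1) (fmul a (frad r v))))%R) S) V)%N.

Definition cand_ratio d r x y : frac := ((fdist d x y).1 * (frad r x).2, (fdist d x y).2 * (frad r x).1).

Definition try_ratio V d r (m : nat) (best : bool * (frac * seq nat)) (a : frac) : bool * (frac * seq nat) :=
  let S := decide V (near_mx V d r a) (ok_mx V d r a) (ed_mx V d r a) m%:Z in
  if accepts V d r m a S && (~~ best.1 || ~~ fle best.2.1 a) then (true, (a, S)) else best.

(** The final [nat] of the input type absorbs the [VNum 0] that ends the four-element input list. *)
Definition solve (inp : nat * (nat * (seq (seq frac) * (seq frac * nat)))) : seq nat :=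
  let m := inp.2.1 in let d := inp.2.2.1 in let r := inp.2.2.2.1 in
  let V := iota 0 (size r) in
  (foldl (fun best a => try_ratio V d r m best a) (false, ((0, 1), [::]))
    (flatten [seq [seq cand_ratio d r x y | y <- V] | x <- V])).2.2.

End Program.

(** * Correctness *)

Section ListAlgorithms.
Local Open Scope ring_scope.

(** The program handles numbers and the proofs handle ordinals; this lemma and its two companions
    move between them. *)
Lemma sortd_map T U (h : T -> U) (key : U -> int) l :
  sortd key (map h l) = map h (sortd (key \o h) l).
Proof.
rewrite /sortd -[in LHS](_ : map h [::] = [::]) //; elim: l [::] => //= x l IH acc.
by rewrite -IH map_cat /= !filter_map.
Qed.

Lemma greedy_map T U (h : T -> U) P l :
  greedy P (map h l) = map h (greedy (P \o map h) l).
Proof.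
rewrite /greedy -[in LHS](_ : map h [::] = [::]) //; elim: l [::] => //= x l IH acc.
by rewrite -IH /=; case: (P _).
Qed.

Lemma targets_map T U (h : T -> U) ok l :
  targets ok (map h l) = map h (targets (fun x y => ok (h x) (h y)) l).
Proof.
rewrite /targets -[in LHS](_ : map h [::] = [::]) //; elim: l [::] => //= x l IH acc.
rewrite -IH /= filter_map; congr (foldl _ (_ :: _) _).
by case: [seq _ <- acc | _].
Qed.

Lemma sortd_rcons T (key : T -> int) l x : sortd key (rcons l x) =
  [seq y <- sortd key l | key x <= key y] ++ x :: [seq y <- sortd key l | ~~ (key x <= key y)].
Proof. by rewrite /sortd foldl_rcons. Qed.

Lemma sortd_perm (T : eqType) (key : T -> int) l : perm_eq (sortd key l) l.
Proof.
elim/last_ind: l => // l x IH; rewrite sortd_rcons perm_catC /= perm_sym perm_rcons perm_sym perm_cons.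
by rewrite perm_catC; apply: perm_trans IH; rewrite perm_filterC.
Qed.

Lemma sortd_pairwise (T : eqType) (key : T -> int) l :
  pairwise (fun x y => key y <= key x) (sortd key l).
Proof.
elim/last_ind: l => // l x IH; rewrite sortd_rcons pairwise_cat pairwise_cons.
apply/and4P; split; try exact: subseq_pairwise (filter_subseq _ _) IH.
- apply/allrelP => y z; rewrite mem_filter inE => /andP[xy _] /orP[/eqP->//|].
  by rewrite mem_filter -ltNge => /andP[/ltW zx _]; apply: le_trans xy.
- by apply/allP => z; rewrite mem_filter -ltNge => /andP[/ltW].
Qed.

Lemma greedy_rcons T (P : seq T -> bool) l x :
  greedy P (rcons l x) = if P (x :: greedy P l) then x :: greedy P l else greedy P l.
Proof. by rewrite /greedy foldl_rcons. Qed.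

Section Greedy.
Variables (T : finType) (F : {set {set T}}) (key : T -> int).
Hypothesis hF : is_matroid F.

Let P (s : seq T) := [set x in s] \in F.

(** The last conjunct follows by exchange: an element augmenting the greedy set would either be the
    one just rejected or contradict the induction hypothesis. *)
Lemma greedy_indep s : uniq s -> [/\ {subset greedy P s <= s}, uniq (greedy P s),
  [set x in greedy P s] \in F & forall B, B \in F -> (count (mem B) s <= size (greedy P s))%N].
Proof.
have [f0 fd fx] := hF.
elim/last_ind: s => [_|s y IH].
  split=> //; rewrite (_ : [set x in _] = set0) //; by apply/setP => x; rewrite !inE.
rewrite rcons_uniq => /andP[ys us]; have [h1 h2 h3 h4] := IH us.
rewrite greedy_rcons; case: ifP => hP.
  split=> //.
  - by move=> x; rewrite mem_rcons !inE => /orP[->//|/h1 ->]; rewrite orbT.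
  - by rewrite /= h2 andbT; apply: contra ys => /h1.
  - by move=> B /h4; rewrite -cats1 count_cat /=; case: (y \in B); lia.
split=> //; first by move=> x /h1; rewrite mem_rcons inE orbC => ->.
move=> B hB; rewrite leqNgt; apply/negP => lt.
pose B' := B :&: [set x in rcons s y].
have hB' : B' \in F by apply: fd hB; apply: subsetIl.
have cB' : #|B'| = count (mem B) (rcons s y).
  rewrite -size_filter -(card_uniqP _) ?filter_uniq ?rcons_uniq ?ys //.
  by apply: eq_card => x; rewrite mem_filter !inE.
have cJ : #|[set x in greedy P s]| = size (greedy P s) by rewrite cardsE; apply/card_uniqP.
have lt' : (#|[set x in greedy P s]| < #|B'|)%N by rewrite cB' cJ.
have [x] := fx _ _ h3 hB' lt'.
rewrite !inE mem_rcons inE => /andP[xJ /andP[_ /orP[/eqP e|xs]]] hx.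
  by move/negP: hP; apply; rewrite /P -e; move: hx; congr (_ \in F); apply/setP => z; rewrite !inE.
have := h4 _ hx; rewrite leqNgt => /negP; apply.
rewrite -cJ -size_filter -(card_uniqP _) ?filter_uniq //.
have : (#|x |: [set x0 in greedy P s]| <= #|[seq x0 <- s | mem (x |: [set x0 in greedy P s]) x0]|)%N.
  apply: subset_leq_card; apply/subsetP => z; rewrite mem_filter !inE.
  by case/orP => [/eqP->|zJ]; rewrite ?eqxx ?xs // zJ orbT /= h1.
by rewrite cardsU1 !inE xJ add1n.
Qed.

(** Abel summation in inductive form: on each prefix the greedy set has a nonnegative surplus in
    cardinality, valued at a lower bound [m] of the keys that decreases along the list. *)
Lemma greedy_opt s B m : uniq s -> pairwise (fun x y => key y <= key x) s -> B \in F ->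
  (forall x, x \in s -> m <= key x) ->
  m * ((size (greedy P s))%:Z - (count (mem B) s)%:Z) <=
  \sum_(x <- greedy P s) key x - \sum_(x <- s | x \in B) key x.
Proof.
elim/last_ind: s m => [m _ _ _ _|s y IH m].
  by rewrite !big_nil /= subrr mulr0.
rewrite rcons_uniq pairwise_rcons => /andP[ys us] /andP[hy ps] hB hm.
have le : key y * ((size (greedy P s))%:Z - (count (mem B) s)%:Z) <=
  \sum_(x <- greedy P s) key x - \sum_(x <- s | x \in B) key x.
  by apply: IH => // x xs; exact: (allP hy).
have [_ _ _ /(_ B hB) hle] := @greedy_indep (rcons s y) ltac:(by rewrite rcons_uniq ys).
have my : m <= key y by apply: hm; rewrite mem_rcons mem_head.
apply: (@le_trans _ _ (key y * ((size (greedy P (rcons s y)))%:Z - (count (mem B) (rcons s y))%:Z))).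
  by apply: ler_wpM2r => //; lia.
rewrite greedy_rcons -cats1 count_cat big_cat /= addn0 [X in _ - (_ + X)]big_mkcond big_cons big_nil /=.
move: le.
have -> : (size (if P (y :: greedy P s) then y :: greedy P s else greedy P s) =
  size (greedy P s) + (P (y :: greedy P s)))%N by case: ifP => _ /=; lia.
have -> : \sum_(x <- if P (y :: greedy P s) then y :: greedy P s else greedy P s) key x =
  key y *+ P (y :: greedy P s) + \sum_(x <- greedy P s) key x.
  by case: ifP => _; rewrite ?big_cons ?add0r.
suff gen (p q : bool) (k S1 : int) (S2 : int) (a b' : nat) : k * (a%:Z - b'%:Z) <= S1 - S2 ->
    k * ((a + p)%N%:Z - (b' + q)%N%:Z) <= k *+ p + S1 - (S2 + ((if q then k else 0) + 0)).
  exact: gen.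
by case: p; case: q; rewrite ?mulr1n ?mulr0n; nia.
Qed.

End Greedy.

(** The last property holds because the later of two representatives was opened only when no earlier
    one was admissible for it. *)
Lemma targets_spec (T : eqType) (key : T -> int) (ok : rel T) s :
  (forall x, ok x x) -> uniq s -> pairwise (fun x y => key y <= key x) s ->
  exists a : T -> T, [/\ targets ok s = rev (map a s),
    forall u, u \in s -> [/\ a u \in s, ok u (a u) & key u <= key (a u)] &
    forall u v, u \in s -> v \in s -> a u != a v -> ~~ ok (a u) (a v) || ~~ ok (a v) (a u)].
Proof.
move=> okr; elim/last_ind: s => [_ _|s x IH]; first by exists id.
rewrite rcons_uniq pairwise_rcons => /andP[xs us] /andP[hx ps].
have [a [e h1 h2]] := IH us ps.
pose c := nth x [seq v <- targets ok s | ok x v] 0.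
pose a' u := if u == x then c else a u.
have ea u : u \in s -> a' u = a u by rewrite /a'; case: eqP => // ->; rewrite (negPf xs).
have ex : a' x = c by rewrite /a' eqxx.
have mt v : v \in targets ok s -> exists2 u, u \in s & v = a u.
  by rewrite e mem_rev => /mapP[u us' ->]; exists u.
have hc : (c = x /\ forall v, v \in targets ok s -> ~~ ok x v) \/
          (ok x c /\ c \in targets ok s).
  rewrite /c; case ef : [seq v <- targets ok s | ok x v] => [|y l] /=.
    left; split=> // v vt; apply/negP => okv.
    by have := mem_filter (fun v => ok x v) v (targets ok s); rewrite ef okv vt.
  by right; have := mem_filter (fun v => ok x v) y (targets ok s); rewrite ef mem_head => /esym/andP.
exists a'; split.
- rewrite /targets foldl_rcons -/(targets ok s) map_rcons rev_rcons ex -/c e.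
  by congr (_ :: rev _); apply/esym/eq_in_map.
- move=> u; rewrite mem_rcons inE => /orP[/eqP->|us'].
    rewrite ex; case: hc => [[-> _]|[h3 /mt[v vs ev]]]; first by rewrite mem_rcons mem_head okr.
    have [h4 _ _] := h1 v vs; split=> //; first by rewrite ev mem_rcons inE h4 orbT.
    by rewrite ev; apply: (allP hx).
  by rewrite ea // mem_rcons inE; have [-> -> ->] := h1 u us'; rewrite orbT.
have aux v : v \in s -> a v != c -> ~~ ok (a v) c || ~~ ok c (a v).
  move=> vs; case: hc => [[-> hc] _|[h3 /mt[u us' ->]]]; last exact: h2.
  by rewrite hc ?orbT // e mem_rev map_f.
move=> u v; rewrite !mem_rcons !inE => /orP[/eqP->|us'] /orP[/eqP->|vs]; rewrite ?ex ?ea //.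
- by rewrite eqxx.
- by rewrite eq_sym orbC; apply: aux.
- exact: aux.
exact: h2.
Qed.

End ListAlgorithms.

(** * Loop lengths and the regret bound of the covering subgradient method *)

Lemma nth_map_iota A (d : A) (g : nat -> A) n i : i < n -> nth d [seq g j | j <- iota 0 n] i = g i.
Proof. by move=> h; rewrite (nth_map 0) ?size_iota // nth_iota. Qed.

Lemma foldl_iter A B (f : A -> A) z (l : seq B) : foldl (fun s _ => f s) z l = iter (size l) f z.
Proof. by elim: l z => //= x l IH z; rewrite IH -iterSr. Qed.

Lemma size_pairs_with l1 l2 : size (pairs_with l1 l2) = size l1 * size l2.
Proof. by elim: l1 => //= x l IH; rewrite /pairs_with /= size_cat -/(pairs_with l l2) IH mulSn. Qed.

Lemma size_ticks V : size (ticks V) = (size V).+1 ^ 10.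
Proof. by rewrite /ticks !size_pairs_with /= !expnS expn0 muln1 !mulnA. Qed.

Lemma sum_val n (g : nat -> int) : (\sum_(i <- iota 0 n) g i = \sum_(i < n) g i)%R.
Proof. by rewrite -(big_mkord xpredT) /index_iota subn0. Qed.

Lemma clip_range (K x : int) : (0 <= K -> 0 <= clip K x <= K)%R.
Proof. by rewrite /clip; case: ifP => //; case: ifP => //; lia. Qed.

Lemma clip_dist (K x mu : int) : (0 <= mu <= K -> (clip K x - mu) ^+ 2 <= (x - mu) ^+ 2)%R.
Proof. by rewrite /clip; case: ifP => [|/negbT]; [|case: ifP => [|/negbT]]; nia. Qed.

(** The potential is the squared distance to the multipliers [mu] that are best in hindsight: [K]
    where the coverage is below [T] and 0 elsewhere. The squared subgradient is at most n * n^2 = K.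
    Relative to [T], this costs at most 1/2, and the initial distance, at most n K^2, costs less
    than 1/2 because T > n K. *)
Lemma cover_regret n (C : {set 'I_n}) (lam : nat -> 'I_n -> int) (c : nat -> 'I_n -> nat) (T m : nat) :
  let K := (n%:Z * n%:Z * n%:Z)%R in
  (forall v, lam 0 v = 0%R) ->
  (forall t v, lam t.+1 v = clip K (lam t v - (c t v)%:Z + 1)%R) ->
  (forall t v, c t v <= n) -> m <= #|C| ->
  (forall t, \sum_(v in C) lam t v <= \sum_v lam t v * (c t v)%:Z)%R ->
  n * n ^ 3 < T ->
  (T%:Z * (m%:Z - 1) < \sum_v (minn T (\sum_(t < T) c t v))%:Z)%R.
Proof.
move=> K l0 lS cn mC opt lt; pose X v := \sum_(t < T) c t v.
pose mu v : int := if X v < T then K else 0%R.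
have K0 : (0 <= K)%R by rewrite /K; lia.
have muK v : (0 <= mu v <= K)%R by rewrite /mu; case: ifP => _; lia.
have lK t v : (0 <= lam t v <= K)%R by case: t => [|t]; rewrite ?l0 ?lS ?clip_range //; lia.
pose dist t := (\sum_v (lam t v - mu v) ^+ 2)%R.
have step t : (dist t.+1 <= dist t + 2 * K * (n%:Z - m%:Z) + 2 * (\sum_v mu v * ((c t v)%:Z - 1)) + K)%R.
  have h1 : (dist t.+1 <= \sum_v ((lam t v - mu v) ^+ 2 - 2 * (lam t v * ((c t v)%:Z - 1))
       + 2 * (mu v * ((c t v)%:Z - 1)) + n%:Z * n%:Z))%R.
    apply: ler_sum => v _; rewrite lS; apply: le_trans (clip_dist _ (muK v)) _.
    have n0 : 0 < n by apply: leq_ltn_trans (ltn_ord v).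
    have sq : (((c t v)%:Z - 1) ^+ 2 <= n%:Z * n%:Z)%R.
      by have := cn t v; move: (c t v) => x hx; nia.
    rewrite (_ : (lam t v - (c t v)%:Z + 1 - mu v) ^+ 2 = (lam t v - mu v) ^+ 2
      - 2 * (lam t v * ((c t v)%:Z - 1)) + 2 * (mu v * ((c t v)%:Z - 1)) + ((c t v)%:Z - 1) ^+ 2)%R.
      by rewrite lerD2l.
    by ring.
  (* At most [n - m] points lie outside [C], each with a multiplier of at most [K]. *)
  have h2 : (- (K * (n%:Z - m%:Z)) <= \sum_v lam t v * ((c t v)%:Z - 1))%R.
    have e : (\sum_v lam t v * ((c t v)%:Z - 1) = \sum_v lam t v * (c t v)%:Z - \sum_v lam t v)%R.
      by rewrite -sumrB; apply: eq_bigr => v _; rewrite mulrBr mulr1.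
    have h3 : (\sum_v lam t v - \sum_(v in C) lam t v <= K * (n%:Z - m%:Z))%R.
      rewrite (bigID (mem C)) /= addrAC subrr add0r.
      apply: (@le_trans _ _ (\sum_(v | v \notin C) K)%R).
        by apply: ler_sum => v _; case/andP: (lK t v).
      rewrite sumr_const -mulr_natl natz mulrC; apply: ler_wpM2l => //.
      rewrite (eq_card (B := mem (~: C))); last by move=> v; rewrite !inE.
      by have := cardsC C; rewrite card_ord; move: #|C| #|~: C| mC => x y; lia.
    by rewrite e; have := opt t; lra.
  move: h1; rewrite !big_split /= sumrN -!mulr_sumr sumr_const card_ord -mulr_natl natz.
  by move: h2; rewrite /K; move: (\sum_v _ * (_ - 1))%R => a; rewrite -/(dist t); lra.
have tot s : (dist s <= n%:Z * K * K + s%:Z * (2 * K * (n%:Z - m%:Z) + K)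
    + 2 * \sum_(t < s) \sum_v mu v * ((c t v)%:Z - 1))%R.
  elim: s => [|s IH].
    rewrite big_ord0 mulr0 mul0r !addr0 /dist.
    apply: (@le_trans _ _ (\sum_(v < n) K * K)%R).
      by apply: ler_sum => v _; rewrite l0; have := muK v; nia.
    by rewrite sumr_const card_ord -mulr_natl natz mulrA.
  rewrite big_ord_recr /=; have := step s; rewrite intS; lra.
have dT : (0 <= dist T)%R by apply: sumr_ge0 => v _; exact: sqr_ge0.
have e : (\sum_(t < T) \sum_v mu v * ((c t v)%:Z - 1) = K * (\sum_v (minn T (X v))%:Z) - K * n%:Z * T%:Z)%R.
  rewrite exchange_big /=.
  rewrite (eq_bigr (fun v => K * (minn T (X v))%:Z - K * T%:Z)%R); last first.
    move=> v _; rewrite -mulr_sumr sumrB -sum_posz sumr_const card_ord natz -/(X v) /mu.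
    by case: ltnP => h; [rewrite -mulrBr; congr (_ * _)%R; lia | rewrite mul0r; lia].
  by rewrite sumrB -mulr_sumr sumr_const card_ord -mulr_natl natz; ring.
have key : (0 <= K * (n%:Z * K + T%:Z * (2 * (n%:Z - m%:Z) + 1) + 2 * (\sum_v (minn T (X v))%:Z) - 2 * n%:Z * T%:Z))%R.
  by apply: le_trans dT _; apply: le_trans (tot T) _; rewrite e; lra.
have cC : #|C| <= n by rewrite -[X in _ <= X]card_ord max_card.
have [n0|n0] := posnP n.
  rewrite big1 => [|v _]; last by have := ltn_ord v; rewrite {2}n0.
  by move: mC cC lt n0; move: #|C| (n * n ^ 3) => x y; case: (m) => [|m'] ; nia.
have K1 : (0 < K)%R by rewrite /K; nia.
move: key; rewrite pmulr_rge0 //.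
have lt' : (n%:Z * K < T%:Z)%R.
  have e3 : n * n ^ 3 = n * (n * n * n) by rewrite !expnS expn0 muln1 !mulnA.
  by move: lt; rewrite e3 -ltz_nat.
move: lt'; move: (n%:Z * K)%R (\sum_v _)%R => a b; lra.
Qed.

(** * Greedy bases, representatives and the existence of a packing *)

Section Correctness.
Variables (n : nat) (F : {set {set 'I_n}}) (O : oracle).
Hypothesis hF : is_matroid F.
Hypothesis hO : forall s : seq 'I_n, O (enc [seq val i | i <- s]) = ([set x in s] \in F).
Local Open Scope ring_scope.
Local Notation V := (iota 0 n).
Local Notation rho := (mrank F setT).

Definition basis key : {set 'I_n} := [set i | val i \in max_basis O V key].

(** Either condition on [B] makes the cardinality term of [greedy_opt] vanish: equal sizes, or
    nonnegative keys with lower bound 0. *)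
Lemma max_basis_spec key :
  [/\ perm_eq (max_basis O V key) [seq val i | i <- enum (basis key)],
      basis key \in F, #|basis key| = rho &
      forall B, B \in F -> #|B| = rho \/ (forall i : 'I_n, 0 <= nth 0 key i) ->
        \sum_(i in B) nth 0 key i <= \sum_(i in basis key) nth 0 key i].
Proof.
pose k (i : 'I_n) : int := nth 0 key i.
pose s := sortd k (enum 'I_n).
have us : uniq s by rewrite (perm_uniq (sortd_perm _ _)) enum_uniq.
have ms i : i \in s by rewrite (perm_mem (sortd_perm _ _)) mem_enum.
pose P (s : seq 'I_n) := [set x in s] \in F.
have e : max_basis O V key = [seq val i | i <- greedy P s].
  rewrite /max_basis -val_enum_ord sortd_map greedy_map -/s; congr map.
  rewrite /greedy; elim: s [::] {us ms} => //= x s IH acc.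
  have := hO (x :: acc); rewrite /= => ->; exact: IH.
have [h1 h2 h3 h4] := greedy_indep hF us.
have eb : basis key = [set x in greedy P s].
  by apply/setP => i; rewrite !inE e mem_map //; apply: val_inj.
have cb : #|basis key| = size (greedy P s) by rewrite eb cardsE; apply/card_uniqP.
have cs (B : {set 'I_n}) : count (mem B) s = #|B|.
  rewrite -size_filter -(card_uniqP _) ?filter_uniq //.
  by apply: eq_card => x; rewrite mem_filter ms andbT.
have rk : #|basis key| = rho.
  apply/eqP; rewrite eqn_leq mrank_ge ?eb ?subsetT //= -eb cb.
  by apply/bigop.bigmax_leqP => B /andP[/h4 + _]; rewrite cs.
split=> //; last 2 first.
- by rewrite eb.
- move=> B hB hc; have [m hm le0] : exists2 m : int, (forall i, m <= k i) & 0 <= m * (#|basis key|%:Z - #|B|%:Z).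
    case: hc => [cB|pos].
      exists (- \sum_i `|k i|); last by rewrite rk cB subrr mulr0.
      move=> i; rewrite lerNl (bigD1 i) //=; apply: le_trans (ler_norm _) _; rewrite normrN lerDl.
      exact: sumr_ge0.
    by exists 0; rewrite ?mul0r.
  have := @greedy_opt _ F k hF s B m us (sortd_pairwise _ _) hB (fun x _ => hm x).
  rewrite cs -cb => le; have := le_trans le0 le.
  have -> : \sum_(x <- greedy P s) k x = \sum_(i in basis key) k i.
    by rewrite eb big_uniq //=; apply: eq_bigl => x; rewrite inE.
  have -> : \sum_(x <- s | x \in B) k x = \sum_(i in B) k i.
    by rewrite big_mkcond big_uniq //= [RHS]big_mkcond /=; apply: eq_big => // x; rewrite ms.
  by rewrite subr_ge0.
rewrite e; apply: perm_map; apply: uniq_perm => //; first exact: enum_uniq.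
by move=> x; rewrite mem_enum eb inE.
Qed.

Lemma count_max_basis key (p : pred nat) :
  count p (max_basis O V key) = #|basis key :&: [set i : 'I_n | p i]|.
Proof.
have [h _ _ _] := max_basis_spec key; rewrite (permP h) count_map -size_filter.
rewrite -(card_uniqP (filter_uniq _ (enum_uniq _))).
by apply: eq_card => i; rewrite mem_filter mem_enum !inE andbC.
Qed.

Lemma size_max_basis key : size (max_basis O V key) = rho.
Proof.
by have [h _ <- _] := max_basis_spec key; rewrite (perm_size h) size_map -cardE.
Qed.

Section Cover.
Variable M : seq (seq bool).
Local Notation near := (fun v f : 'I_n => at2 M v f).

Let st t := iter t (cover_step O V M (cube V)) ([seq 0 | _ <- V], [seq 0 | _ <- V]).
Let lam t (v : 'I_n) := nth 0 (st t).1 v.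
Let key t := [seq \sum_(x <- [seq (if at2 M v f then nth 0 (st t).1 v else 0) | v <- V]) x | f <- V].
Let c t (v : 'I_n) := #|basis (key t) :&: [set f | near v f]|.

Lemma cover_loop_nth (v : 'I_n) :
  nth 0 (cover_loop O V M).2 v = (\sum_(t < size (ticks V)) c t v)%N%:Z.
Proof.
rewrite /cover_loop foldl_iter -/(st _); move: (size _) => T.
elim: T => [|T IH]; first by rewrite big_ord0 nth_map_iota.
rewrite big_ord_recr PoszD -IH /st iterS {1}/cover_step /= !nth_map_iota //.
by congr (_ + Posz _); rewrite count_max_basis.
Qed.

(** Each greedy basis weighs at least as much as [S], in whose weight every point covered by [S]
    counts its multiplier at least once. *)
Lemma coverage_bound (S : {set 'I_n}) m :
  S \in F -> (m <= #|[set v | [exists f in S, near v f]]|)%N ->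
  (size (ticks V))%:Z * (m%:Z - 1) <
    \sum_v (minn (size (ticks V)) (\sum_(t < size (ticks V)) c t v))%N%:Z.
Proof.
move=> hS hm; apply: (cover_regret (lam := lam) (c := c) (n := n)) hm _ _.
- by move=> v; rewrite /lam /st /= nth_map_iota.
- move=> t v; rewrite /lam /st iterS {1}/cover_step /= !nth_map_iota // count_max_basis /cube size_iota.
  by rewrite /c /key /st /cube size_iota.
- move=> t v; apply: leq_trans (max_card _) _; by rewrite card_ord.
- move=> t.
  have lam0 v : 0 <= lam t v.
    case: t => [|t]; first by rewrite /lam /st /= nth_map_iota.
    rewrite /lam /st iterS {1}/cover_step /= !nth_map_iota //.
    have K0 : 0 <= cube V by rewrite /cube; lia.
    by set x := (X in clip _ X); have /andP[] := clip_range x K0.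
  have ek (f : 'I_n) : nth 0 (key t) f = \sum_(v | near v f) lam t v.
    rewrite /key nth_map_iota // big_map sum_val [RHS]big_mkcond /=; apply: eq_bigr => v _.
    by case: ifP.
  have [_ _ _ /(_ S hS)] := max_basis_spec (key t).
  move/(_ (or_intror _)) => h.
  apply: (@le_trans _ _ (\sum_(i in S) nth 0 (key t) i)); last first.
    apply: le_trans (h _) _; first by move=> i; rewrite ek; apply: sumr_ge0.
    under eq_bigr => i _ do rewrite ek.
    rewrite (exchange_big_dep xpredT) //=; apply: ler_sum => v _.
    rewrite sumr_const -mulr_natr natz /c; apply: ler_wpM2l => //.
    by rewrite lez_nat; apply: eq_leq; apply: eq_card => f; rewrite in_setI [f \in [set _ | _]]inE.
  under [X in _ <= X]eq_bigr => i _ do rewrite ek.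
  rewrite (exchange_big_dep xpredT) //= [X in X <= _]big_mkcond /=; apply: ler_sum => v _.
  case: ifP => [|_]; last by apply: sumr_ge0.
  rewrite inE => /existsP[f /andP[fS nf]]; rewrite (bigD1 f) /=; last by rewrite fS.
  by rewrite lerDl; apply: sumr_ge0.
rewrite size_ticks size_iota; case: (posnP n) => [->//|n0].
rewrite -expnS; apply: (@leq_trans (n.+1 ^ 4)); first by rewrite ltn_exp2r.
by rewrite leq_pexp2l.
Qed.

Variables (ok ed : seq (seq bool)) (rad : 'I_n -> rat).
Hypothesis ok_refl : forall v : 'I_n, at2 ok v v.
Hypothesis ed_rad : forall v u : 'I_n, at2 ed v u -> rad u < rad v.
Hypothesis near_ok : forall v u f : 'I_n, at2 M v f -> at2 M u f -> at2 ok v u || at2 ed u v.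

Definition scheme := targets (at2 ok) (sortd (fun i => nth 0 (coverage O V M) i) V).

Lemma scheme_spec : exists a : 'I_n -> 'I_n,
  [/\ forall v : 'I_n, count (fun x => x == val v) scheme = #|[set u | a u == v]|,
      forall u : 'I_n, at2 ok u (a u),
      forall u : 'I_n, nth 0 (coverage O V M) u <= nth 0 (coverage O V M) (a u) &
      forall u v, a u != a v -> ~~ at2 ok (a u) (a v) || ~~ at2 ok (a v) (a u)].
Proof.
pose k (i : 'I_n) := nth 0 (coverage O V M) i.
pose s := sortd k (enum 'I_n).
have us : uniq s by rewrite (perm_uniq (sortd_perm _ _)) enum_uniq.
have ms i : i \in s by rewrite (perm_mem (sortd_perm _ _)) mem_enum.
have [a [e h1 h2]] := targets_spec (ok := fun u v : 'I_n => at2 ok u v) ok_refl us (sortd_pairwise _ _).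
exists a; split.
- move=> v.
  have -> : scheme = [seq val i | i <- targets (fun u v : 'I_n => at2 ok u v) s].
    have := sortd_map (val : 'I_n -> nat) (fun i => nth 0 (coverage O V M) i) (enum 'I_n).
    by rewrite val_enum_ord /scheme => ->; rewrite targets_map.
  rewrite e count_map count_rev count_map.
  rewrite -size_filter -(card_uniqP _) ?filter_uniq //.
  by apply: eq_card => u; rewrite mem_filter ms andbT !inE.
- by move=> u; have [] := h1 u (ms u).
- by move=> u; have [] := h1 u (ms u).
- by move=> u v; apply: h2.
Qed.

(** Otherwise an integral dual of value at most [m - 1] bounds the fractional packing. But points
    are scanned by decreasing coverage, so moving each one to its representative loses no coverage,
    and the fractional value exceeds [m - 1]. *)
Lemma packing_exists (S : {set 'I_n}) m (w : 'I_n -> nat) : (0 < n)%N ->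
  (forall v : 'I_n, w v = count (fun x => x == val v) scheme) ->
  S \in F -> (m <= #|[set v | [exists f in S, near v f]]|)%N ->
  packing F near (fun v u => at2 ed v u) w setT m.
Proof.
move=> n0 hw hS hm; apply: boolp.contrapT => /(packing_dual hF)[p [u [hf _ lt]]].
have [a [ca oka cova sepa]] := scheme_spec.
pose T := size (ticks V).
pose X v := minn T (\sum_(t < T) c t v).
have covX (v : 'I_n) : nth 0 (coverage O V M) v = (X v)%:Z.
  by rewrite /coverage nth_map_iota // cover_loop_nth -/T /X /minn lez_nat; case: ltngtP => // ->.
have [r hr] : exists r, forall r', (p r <= p r')%N.
  have [r _ h] := @arg_minnP _ (inl (Ordinal n0)) xpredT p isT; exists r => r'; exact: h.
have bI t : basis (key t) \in F /\ #|basis (key t)| = rho.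
  by have [_ ? ? _] := max_basis_spec (key t).
(* Two representatives that share a location are not mutually admissible, so one is linked to the
   other. *)
have hsep : forall v u f : 'I_n, (0 < w v)%N -> (0 < w u)%N -> near v f -> near u f -> v != u ->
   at2 ed v u || at2 ed u v.
  move=> v u' f; rewrite !hw !ca => /card_gt0P[x]; rewrite inE => /eqP <- /card_gt0P[y].
  rewrite inE => /eqP <- nv nu ne; have := sepa _ _ ne; have := near_ok nv nu; have := near_ok nu nv.
  by do 2 case: (at2 ok _ _); do 2 case: (at2 ed _ _).
have le := packing_fractional ed_rad hsep T bI hf hr.
have le2 : \sum_v (X v)%:Z <= \sum_v (w v)%:Z * (X v)%:Z.
  apply: (@le_trans _ _ (\sum_v (X (a v))%:Z)); first by apply: ler_sum => v _; rewrite -!covX.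
  rewrite (partition_big a xpredT) //=; apply: ler_sum => v _.
  rewrite (eq_bigr (fun _ => (X v)%:Z)) => [|x /eqP -> //].
  by rewrite sumr_const -mulr_natl natz hw ca cardsE.
have := coverage_bound hS hm; have := lt r.
have T0 : 0 < T%:Z by rewrite /T size_ticks.
move: le le2; rewrite -/T -/X.
move: (\sum_v u v - _ + _) (\sum_v (X v)%:Z) (\sum_v _ * (X v)%:Z) => x y z; nia.
Qed.

End Cover.

End Correctness.

(** * Exactness of the price loop, and pruning *)

Lemma argmax_spec (sc : nat -> int) x0 l : argmax sc x0 l \in x0 :: l /\
  forall j, j \in x0 :: l -> (sc j <= sc (argmax sc x0 l))%R.
Proof.
rewrite /argmax; elim: l x0 => [|y l IH] x0 /=.
  by split=> [|j]; rewrite inE // => /eqP ->.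
case: ifP => le; have [h1 h2] := IH (if (sc y <= sc x0)%R then x0 else y); rewrite le in h1 h2.
  split; first by move: h1; rewrite !inE => /orP[->//|->]; rewrite !orbT.
  move=> j; rewrite !inE => /or3P[/eqP->|/eqP->|jl]; try by apply: h2; rewrite inE ?eqxx ?jl ?orbT.
  by apply: le_trans le _; apply: h2; rewrite inE eqxx.
split; first by move: h1; rewrite !inE => /orP[->|->]; rewrite !orbT.
move=> j; rewrite !inE => /or3P[/eqP->|/eqP->|jl]; try by apply: h2; rewrite inE ?eqxx ?jl ?orbT.
by apply: (@le_trans _ _ (sc y)); [lia | apply: h2; rewrite inE eqxx].
Qed.

Lemma sum_count (T : finType) (s : seq T) (g : T -> int) :
  (\sum_r g r * (count_mem r s)%:Z = \sum_(x <- s) g x)%R.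
Proof.
elim: s => [|y s IH]; first by rewrite big_nil big1 // => r _; rewrite mulr0.
rewrite big_cons -IH (eq_bigr (fun r => g r * (y == r)%:Z + g r * (count_mem r s)%:Z)%R); last first.
  by move=> r _; rewrite /= PoszD mulrDr.
rewrite big_split /= (bigD1 y) //= eqxx mulr1 big1 ?addr0 // => r.
by rewrite eq_sym => /negPf ->; rewrite mulr0.
Qed.

Section PriceLoop.
Variables (n : nat) (F : {set {set 'I_n}}) (O : oracle).
Hypothesis hF : is_matroid F.
Hypothesis hO : forall s : seq 'I_n, O (enc [seq val i | i <- s]) = ([set x in s] \in F).
Hypothesis n0 : (0 < n)%N.
Local Open Scope ring_scope.
Local Notation V := (iota 0 n).
Local Notation rho := (mrank F setT).
Local Notation slot := ('I_n + 'I_n)%type.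

Variables (nearM edM : seq (seq bool)) (ws : seq int) (w : 'I_n -> nat) (m : nat).
Hypothesis hw : forall v : 'I_n, nth 0 ws v = (w v)%:Z.
Let near (v f : 'I_n) := at2 nearM v f.
Let ed (v u : 'I_n) := at2 edM v u.
Let K : int := 16 * (n%:Z * n%:Z).

Definition code (r : slot) : nat := match r with inl u => u | inr f => (n + f)%N end.

Lemma code_inj : injective code.
Proof.
move=> [x|x] [y|y] /= h; first by rewrite (val_inj h).
- by have := ltn_ord x; lia.
- by have := ltn_ord y; lia.
- by move/addnI/val_inj: h => ->.
Qed.

Lemma code_lt r : (code r < size (V ++ V))%N.
Proof. by rewrite size_cat size_iota; case: r => x /=; have := ltn_ord x; lia. Qed.

Lemma code_surj j : (j < n + n)%N -> exists r, code r = j.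
Proof.
move=> h; case: (ltnP j n) => hj; first by exists (inl (Ordinal hj)).
have h' : (j - n < n)%N by lia.
by exists (inr (Ordinal h')) => /=; lia.
Qed.

Definition aset (al : seq nat) : {set 'I_n} := [set f | val f \in al].

Lemma options_spec (al : seq nat) (v : 'I_n) r : {subset al <= V} ->
  (code r \in val v :: options V nearM edM al v) = (r \in links near ed (aset al) v).
Proof.
move=> sal; rewrite /options size_iota inE mem_cat mem_filter !inE -(inj_eq code_inj) /=.
congr (_ || _); case: r => [u|f] /=.
  rewrite mem_iota leq0n ltn_ord !andbT [X in _ || X](_ : _ = false) ?orbF //.
  by apply/negP => /mapP[f _ e]; have := ltn_ord u; lia.
rewrite mem_iota add0n ltnNge leq_addr !andbF /= mem_map; last exact: addnI.
by rewrite mem_filter /aset inE andbC.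
Qed.

(** The [rho] copies of [r0] are the choices of the dummies of [packing_dual]. *)
Definition demand (mu : 'I_n -> slot) (r0 : slot) : seq slot :=
  [seq mu v | v <- enum 'I_n] ++ nseq rho r0.

Definition supply (J : {set 'I_n}) : seq slot :=
  [seq inl u | u <- enum 'I_n] ++ [seq inr f | f <- enum J].

Definition price (lam : seq int) (r : slot) : int := nth 0 lam (code r).

Lemma price_step_spec (al : seq nat) lam b : {subset al <= V} -> exists mu r0 J,
  let g := price lam in let st := price_step O V nearM edM ws K m%:Z al (lam, b) in
  [/\ [/\ forall v, mu v \in links near ed (aset al) v, J \in F & #|J| = rho],
      [/\ forall v r, r \in links near ed (aset al) v ->
            K * (gain w v r)%:Z - g r <= K * (gain w v (mu v))%:Z - g (mu v),
          forall r, g r0 <= g r &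
          forall B, B \in F -> #|B| = rho -> \sum_(f in B) g (inr f) <= \sum_(f in J) g (inr f)],
      forall r, price st.1 r = g r + (count_mem r (demand mu r0))%:Z - (count_mem r (supply J))%:Z &
      st.2 = b && (K * m%:Z <= \sum_v K * (gain w v (mu v))%:Z
           - \sum_(r <- demand mu r0) g r + \sum_(r <- supply J) g r)].
Proof.
move=> sal.
pose cs := [seq argmax (score K ws lam v) v (options V nearM edM al v) | v <- V].
have ecs (v : 'I_n) : nth 0%N cs v = argmax (score K ws lam v) v (options V nearM edM al v).
  by rewrite nth_map_iota.
have in2n (v : 'I_n) j : j \in val v :: options V nearM edM al v -> (j < n + n)%N.
  rewrite inE /options mem_cat mem_filter mem_iota size_iota => /or3P[/eqP->|/andP[_]|].
  - by have := ltn_ord v => /=; lia.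
  - lia.
  case/mapP => f; rewrite mem_filter => /andP[_ /sal]; rewrite mem_iota => h ->; lia.
have /boolp.choice[mu hmu] : forall v : 'I_n, exists r, code r = nth 0%N cs v.
  by move=> v; apply: code_surj; rewrite ecs; apply: (in2n v); have [] := argmax_spec (score K ws lam v) v (options V nearM edM al v).
have mul v : mu v \in links near ed (aset al) v.
  by rewrite -options_spec // hmu ecs; have [] := argmax_spec (score K ws lam v) v (options V nearM edM al v).
pose j0 := argmax (fun j => 0 - nth 0 lam j) 0%N (V2 V).
have hV2 : size (V ++ V) = (n + n)%N by rewrite size_cat !size_iota.
have [hj0 mj0] := argmax_spec (fun j => 0 - nth 0 lam j) 0%N (V2 V).
have [r0 hr0] : exists r, code r = j0.
  by apply: code_surj; move: hj0; rewrite -/j0 inE /V2 hV2 mem_iota => /orP[/eqP->|]; lia.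
pose key := [seq nth 0 lam (size V + f)%N | f <- V].
pose J := @basis n O key.
have [pJ JF cJ optJ] := max_basis_spec hF hO key.
have sJ : size (max_basis O V key) = rho by rewrite (size_max_basis hF hO).
have ech : cs ++ [seq j0 | _ <- max_basis O V key] = map code (demand mu r0).
  rewrite /demand map_cat map_nseq hr0 -map_comp; congr (_ ++ _).
    rewrite /cs -val_enum_ord -map_comp; apply: eq_map => v /=.
    by rewrite hmu ecs val_enum_ord.
  by rewrite -sJ; elim: (max_basis O V key) => //= x s ->.
have eJf : perm_eq (V ++ [seq (size V + f)%N | f <- max_basis O V key]) (map code (supply J)).
  rewrite /supply map_cat -(map_comp code inl) -(map_comp code inr) perm_cat //.
    by rewrite (_ : map _ _ = V) //; rewrite -[RHS]val_enum_ord; apply: eq_map.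
  by apply: perm_trans (perm_map _ pJ) _; rewrite -map_comp size_iota.
have sc (v : 'I_n) r : score K ws lam v (code r) = K * (gain w v r)%:Z - price lam r.
  rewrite /score /gain -(inj_eq code_inj) /= hw /price.
  by case: eqP => _; rewrite ?mulr0.
exists mu, r0, J; split.
- by [].
- split.
  + move=> v r hr; rewrite -!sc hmu ecs; have [_] := argmax_spec (score K ws lam v) v (options V nearM edM al v).
    by apply; rewrite options_spec.
  + move=> r; rewrite /price hr0; have := mj0 (code r); rewrite -/j0 => h.
    have : 0 - nth 0 lam (code r) <= 0 - nth 0 lam j0.
      by apply: h; rewrite inE /V2 mem_iota code_lt orbT.
    by rewrite lerD2l lerN2.
  + move=> B hB cB; have := optJ B hB (or_introl cB).
    by congr (_ <= _); apply: eq_bigr => f _; rewrite /key nth_map_iota // size_iota.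
- move=> r; rewrite /price_step /= -/cs -/j0 -/key ech {1}/price /V2 nth_map_iota ?code_lt //.
  rewrite (permP eJf) !count_map.
  have ec (s : seq slot) : count (preim code (fun x => x == code r)) s = count_mem r s.
    by apply: eq_count => x /=; rewrite (inj_eq code_inj).
  by rewrite !ec.
rewrite /price_step /= -/cs -/j0 -/key ech; congr (_ && (_ <= _)).
rewrite !big_map (perm_big _ eJf) big_map /=; congr (_ - _ + _).
rewrite sum_val; apply: eq_bigr => v _; rewrite -hmu hw /gain -(inj_eq code_inj) /=.
by case: eqP => _; rewrite ?mulr0.
Qed.

Lemma sum_demand (g : slot -> int) mu r0 :
  \sum_(r <- demand mu r0) g r = \sum_v g (mu v) + rho%:Z * g r0.
Proof.
by rewrite /demand big_cat big_map big_enum /= big_nseq -Monoid.iteropE /= -[iterop _ _ _ _]/(g r0 *+ rho) -mulr_natl natz.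
Qed.

Lemma sum_supply (g : slot -> int) J :
  \sum_(r <- supply J) g r = \sum_u g (inl u) + \sum_(f in J) g (inr f).
Proof. by rewrite /supply big_cat !big_map !big_enum. Qed.

Let start : seq int * bool := ([seq 0 | _ <- V2 V], true).
Let st al t := iter t (price_step O V nearM edM ws K m%:Z al) start.

Lemma test_iter al : test O V nearM edM ws m%:Z al = (st al (size (ticks V))).2.
Proof. by rewrite /test foldl_iter /st /K size_iota. Qed.

(** Weak duality at arbitrary prices. The locations used by the packing extend to a basis; with all
    representative slots this makes [n + rho] slots, of which [n] are used by the packing and the
    other [rho] cost at least as much as [r0]. *)
Lemma test_sound (al : seq nat) : {subset al <= V} -> packing F near ed w (aset al) m ->
  test O V nearM edM ws m%:Z al.
Proof.
move=> sal [mu' [inj hE hM] le]; rewrite test_iter.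
elim: (size _) => // t; rewrite /st iterS -/(st al t); case: (st al t) => lam b hb.
have [mu [r0 [J [[h1 h2 h3] [h4 h5 h6] _ ->]]]] := price_step_spec lam b sal.
rewrite (hb : b) andTb sum_demand sum_supply; set g := price lam.
rewrite inE in hM; have [BL [hBL sBL _ cBL]] := mrank_ext hF hM (subsetT _).
pose Bs : {set slot} := [set r | if r is inr f then f \in BL else true].
have sM : [set mu' x | x in [set: 'I_n]] \subset Bs.
  apply/subsetP => r rM; rewrite inE; case: r rM => // f fM.
  by apply: (subsetP sBL); rewrite inE.
have eBs : \sum_(r in Bs) g r = \sum_u g (inl u) + \sum_(f in BL) g (inr f).
  by rewrite big_sumType /=; congr (_ + _); apply: eq_bigl => x; rewrite inE.
have cBs : #|Bs| = (n + rho)%N.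
  rewrite -sum1_card big_sumType /= -cBL -sum1_card; congr (_ + _)%N; last by apply: eq_bigl => x; rewrite inE.
  by rewrite (eq_bigl xpredT) ?sum1_card ?card_ord // => x; rewrite inE.
have : \sum_v g (mu' v) + rho%:Z * g r0 <= \sum_(r in Bs) g r.
  rewrite (bigID (mem [set mu' x | x in [set: 'I_n]])) /=; apply: lerD.
    have -> : \sum_v g (mu' v) = \sum_(r in [set mu' x | x in [set: 'I_n]]) g r.
      by rewrite big_imset /=; [apply: eq_bigl => v; rewrite inE | move=> x y _ _ /inj].
    by rewrite le_eqVlt; apply/orP; left; apply/eqP; apply: eq_bigl => r; rewrite andb_idl //; apply: (subsetP sM).
  apply: (@le_trans _ _ (\sum_(r in Bs | r \notin [set mu' x | x in [set: 'I_n]]) g r0)).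
    rewrite sumr_const -mulr_natl natz.
    rewrite (eq_card (B := mem (Bs :\: [set mu' x | x in [set: 'I_n]]))); last by move=> r; rewrite [RHS]in_setD andbC.
    by rewrite cardsD (setIidPr sM) card_imset // cardsT card_ord cBs addKn.
  by apply: ler_sum.
have : \sum_v (K * (gain w v (mu' v))%:Z - g (mu' v)) <= \sum_v (K * (gain w v (mu v))%:Z - g (mu v)).
  by apply: ler_sum => v _; apply: h4.
have eK (nu : 'I_n -> slot) : \sum_v K * (gain w v (nu v))%:Z = K * (\sum_v gain w v (nu v))%N%:Z.
  by rewrite sum_posz mulr_sumr.
have := h6 BL hBL cBL; rewrite -/g eBs !sumrB !eK => a1 a2 a3.
have a4 : K * m%:Z <= K * (\sum_v gain w v (mu' v))%N%:Z.
  by apply: ler_wpM2l; rewrite ?lez_nat // /K; lia.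
apply: le_trans a4 _.
suff lin (x1 x2 s1 s2 b1 b2 y z : int) : b1 <= b2 -> x1 - s1 <= x2 - s2 -> s1 + z <= y + b1 ->
    x1 <= x2 - (s2 + z) + (y + b2) by exact: lin a1 a2 a3.
by lia.
Qed.

(** Without a packing there is an integral dual [p] of value at most [m - 1]. While the flag stays
    set the current value is at least [K * m], so in the squared distance to [K * p] the linear term
    of a step is at most -2K, and the quadratic one at most K. Starting from at most 2n (Kn)^2, the
    distance would become negative before the loop ends. *)
Lemma test_complete (al : seq nat) : {subset al <= V} -> (\sum_v w v <= n)%N ->
  test O V nearM edM ws m%:Z al -> packing F near ed w (aset al) m.
Proof.
move=> sal sw; rewrite test_iter => hT.
apply: boolp.contrapT => /(packing_dual hF)[p [u [hf hp lt]]].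
pose dist t := \sum_r (price (st al t).1 r - K * (p r)%:Z) ^+ 2.
have rn : (rho <= n)%N.
  apply/bigop.bigmax_leqP => I _; by rewrite -[X in (_ <= X)%N]card_ord max_card.
have K0 : 0 < K by rewrite /K; nia.
have step t : (st al t.+1).2 -> dist t.+1 <= dist t - K.
  rewrite /dist /st iterS -/(st al t); case: (st al t) => lam b.
  have [mu [r0 [J [[h1 h2 h3] _ h4 ->]]]] := price_step_spec lam b sal.
  case/andP => _ ge.
  pose d r : int := (count_mem r (demand mu r0))%:Z - (count_mem r (supply J))%:Z.
  have e1 : \sum_r (price (price_step O V nearM edM ws K m%:Z al (lam, b)).1 r - K * (p r)%:Z) ^+ 2 =
     \sum_r (price lam r - K * (p r)%:Z) ^+ 2 + 2 * \sum_r (price lam r - K * (p r)%:Z) * d r + \sum_r d r ^+ 2.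
    rewrite mulr_sumr -!big_split /=; apply: eq_bigr => r _; rewrite h4 /d; ring.
  have e2 : \sum_r (price lam r - K * (p r)%:Z) * d r =
    \sum_(r <- demand mu r0) (price lam r - K * (p r)%:Z) - \sum_(r <- supply J) (price lam r - K * (p r)%:Z).
    by rewrite -(sum_count (demand mu r0)) -(sum_count (supply J)) -sumrB; apply: eq_bigr => r _; rewrite mulrBr.
  (* Demand and supply together have [2 * (n + rho)] entries, at most [4 * n]. This bounds both the
     largest entry of [d] and the sum of their absolute values, whence the 16 in [K]. *)
  have e3 : \sum_r d r ^+ 2 <= K.
    pose a r : nat := (count_mem r (demand mu r0) + count_mem r (supply J))%N.
    have ea : (\sum_r a r = 2 * (n + rho))%N.
      apply/eqP; rewrite -eqz_nat sum_posz (eq_bigr (fun r => 1 * (count_mem r (demand mu r0))%:Z + 1 * (count_mem r (supply J))%:Z)).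
        rewrite big_split /= !sum_count -!(big_map (fun _ => 1) xpredT id).
        have S (s : seq slot) : \sum_(r <- [seq 1 | _ <- s]) r = (size s)%:Z :> int.
          by elim: s => [|x s IH]; rewrite ?big_nil //= big_cons IH intS.
        rewrite !S /demand /supply !size_cat (size_map mu) (size_map inl) (size_map inr) size_nseq.
        by rewrite !size_enum_ord -cardE h3; apply/eqP; congr Posz; lia.
      by move=> r _; rewrite !mul1r.
    have le r : (a r <= 4 * n)%N.
      have : (a r <= \sum_r a r)%N by rewrite (bigD1 r) //= leq_addr.
      by rewrite ea; lia.
    apply: (@le_trans _ _ (\sum_r (4 * n%:Z) * (a r)%:Z)).
      apply: ler_sum => r _; have := le r; rewrite /d /a; move: (count_mem _ _) (count_mem _ _) => x y; nia.
    by rewrite -mulr_sumr -sum_posz ea /K; nia.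
  have hu : \sum_v ((gain w v (mu v))%:Z - (p (mu v))%:Z) <= \sum_v u v.
    by apply: ler_sum => v _; apply: hf.
  have hs : \sum_(r <- supply J) (p r)%:Z <= (mweight (slot_indep F) p)%:Z.
    pose Bs : {set slot} := [set r | if r is inr f then f \in J else true].
    have hB : Bs \in slot_indep F by rewrite inE (_ : locs Bs = J) //; apply/setP => f; rewrite !inE.
    rewrite sum_supply -!sum_posz -PoszD lez_nat; apply: leq_trans (mweight_ge p hB).
    by rewrite big_sumType /=; apply: eq_leq; congr (_ + _)%N; apply: eq_bigl => x; rewrite inE.
  have hr : \sum_v u v - rho%:Z * (p r0)%:Z + (mweight (slot_indep F) p)%:Z <= m%:Z - 1.
    by rewrite -ltzD1 subrK; apply: lt.
  have hd := sum_demand (fun r => (p r)%:Z) mu r0.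
  rewrite e1 e2 !sumrB -!mulr_sumr; rewrite sumrB in hu; rewrite -mulr_sumr in ge.
  have hK : K * (\sum_v (gain w v (mu v))%:Z - \sum_(r <- demand mu r0) (p r)%:Z + \sum_(r <- supply J) (p r)%:Z) <= K * (m%:Z - 1).
    apply: ler_wpM2l; first exact: ltW.
    suff lin (G pm U z M mm s : int) : G - pm <= U -> s <= M -> U - z + M <= mm -> G - (pm + z) + s <= mm.
      by rewrite hd; exact: lin hu hs hr.
    by lia.
  suff lin (k G pd ps gd gs mm d0 d2 : int) : k * (G - pd + ps) <= k * (mm - 1) ->
      k * mm <= k * G - gd + gs -> d2 <= k ->
      d0 + 2 * (gd - k * pd - (gs - k * ps)) + d2 <= d0 - k by exact: lin hK ge e3.
  by nia.
have flag t : (t <= size (ticks V))%N -> (st al t).2.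
  move=> ht; move: hT; rewrite -(subnK ht) addnC; elim: (_ - _)%N => [|k IH]; first by rewrite addn0.
  rewrite addnS /st iterS -/(st al (t + k)); case: (st al (t + k)) IH => lam b IH.
  by have [? [? [? [_ _ _ ->]]]] := price_step_spec lam b sal => /andP[/IH].
have tot t : (t <= size (ticks V))%N -> dist t <= dist 0%N - K * t%:Z.
  elim: t => [|t IH] ht; first by rewrite mulr0 subr0.
  suff lin (d1 d2 d3 k x : int) : d3 <= d2 - k -> d2 <= d1 - k * x -> d3 <= d1 - k * (1 + x).
    by rewrite intS; exact: lin (step t (flag _ ht)) (IH (ltnW ht)).
  by lia.
have d0 : dist 0%N <= (n + n)%N%:Z * (K * n%:Z) * (K * n%:Z).
  apply: (@le_trans _ _ (\sum_(r : slot) (K * n%:Z) * (K * n%:Z))).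
    apply: ler_sum => r _; rewrite /st /= /price /V2 nth_map_iota ?code_lt //.
    rewrite sub0r sqrrN expr2; have h : (p r)%:Z <= n%:Z by rewrite lez_nat (leq_trans (hp r)).
    have hK : 0 <= K * (p r)%:Z by apply: mulr_ge0 => //; exact: ltW.
    have hK2 : K * (p r)%:Z <= K * n%:Z by apply: ler_wpM2l => //; exact: ltW.
    exact: ler_pM.
  by rewrite sumr_const card_sum !card_ord -mulr_natl natz mulrA.
have dT : 0 <= dist (size (ticks V)) by apply: sumr_ge0 => r _; exact: sqr_ge0.
have hle := tot _ (leqnn _).
have : K * (size (ticks V))%:Z <= (n + n)%N%:Z * (K * n%:Z) * (K * n%:Z).
  by rewrite -subr_ge0; apply: le_trans dT (le_trans hle _); apply: lerB.
rewrite (_ : (n + n)%N%:Z * (K * n%:Z) * (K * n%:Z) = K * (K * ((n + n) * n * n)%N%:Z)); last by rewrite !PoszM; ring.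
rewrite ler_pM2l // /K -!PoszM lez_nat leqNgt => /negP; apply; rewrite size_ticks size_iota.
rewrite (_ : (16 * (n * n) * ((n + n) * n * n) = 32 * n ^ 5)%N); last by rewrite !expnS expn0; lia.
rewrite -[10%N]/(5 + 5)%N expnD; apply: (@leq_ltn_trans (n.+1 ^ 5 * n ^ 5)%N).
  rewrite leq_mul2r; apply/orP; right; by rewrite -[32%N]/(2 ^ 5)%N leq_exp2r.
by rewrite ltn_mul2l expn_gt0 /= ltn_exp2r.
Qed.

Lemma packing_sub (al al' : {set 'I_n}) : al \subset al' ->
  packing F near ed w al m -> packing F near ed w al' m.
Proof.
move=> /subsetP sub [mu [h1 h2 h3] h4]; exists mu => //; split=> // v.
have := h2 v; rewrite !inE; case/orP => [->//|]; case: (mu v) => [u|f]; first by move=> ->; rewrite orbT.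
by case/andP => /sub -> ->; rewrite orbT.
Qed.

(** A location that is kept cannot be dropped without losing the packing, and this persists as the
    list shrinks. So in the end the packing uses every remaining location, and the used locations
    are independent. *)
Lemma prune_spec : (\sum_v w v <= n)%N -> packing F near ed w setT m ->
  let S := prune O V nearM edM ws m%:Z in
  [/\ {subset S <= V}, aset S \in F & exists2 mu,
    matching (slot_indep F) (links near ed (aset S)) mu & (m <= \sum_v gain w v (mu v))%N].
Proof.
move=> sw pk S.
pose body al f := if test O V nearM edM ws m%:Z [seq g <- al | ~~ (g == f)]
  then [seq g <- al | ~~ (g == f)] else al.
have inv l : {subset l <= V} -> [/\ {subset foldl body V l <= V},
    packing F near ed w (aset (foldl body V l)) m &
    forall f : 'I_n, val f \in l -> f \in aset (foldl body V l) ->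
      ~ packing F near ed w (aset (foldl body V l) :\ f) m].
  elim/last_ind: l => [_|l f IH sl].
    split=> //; apply: packing_sub pk; apply/subsetP => f _; by rewrite inE mem_iota /=.
  have [|h1 h2 h3] := IH; first by move=> x xl; apply: sl; rewrite mem_rcons inE xl orbT.
  rewrite foldl_rcons /body; set al := foldl _ _ _ in h1 h2 h3 *; set al' := [seq g <- al | _].
  have s' : {subset al' <= V} by move=> x; rewrite mem_filter => /andP[_ /h1].
  have fV : (f < n)%N by have := sl f; rewrite mem_rcons mem_head mem_iota => /(_ isT).
  have ea : aset al' = aset al :\ Ordinal fV.
    by apply/setP => x; rewrite !inE mem_filter.
  case: ifP => ht.
    split=> //; first exact: test_complete ht.
    move=> f'; rewrite mem_rcons inE => /orP[/eqP e|f'l]; rewrite ea !inE => /andP[ne f'a].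
      by move: ne; rewrite -val_eqE /= e eqxx.
    move=> pk'; apply: (h3 f' f'l); first by rewrite inE.
    by apply: packing_sub pk'; apply: setSD; apply: subsetDl.
  split=> // f'; rewrite mem_rcons inE => /orP[/eqP e|f'l] f'a; last exact: h3.
  move=> pk'; move/negP: ht; apply; apply: test_sound => //.
  by rewrite ea (_ : Ordinal fV = f') //; apply: val_inj.
have [h1 h2 h3] := inv V (fun _ h => h); rewrite -/(prune O V nearM edM ws m%:Z) -/S in h1 h2 h3.
split=> //.
have [mu [inj hE hM] le] := h2.
have [_ fd _] := hF; rewrite inE in hM; apply: (fd _ _ _ hM); apply/subsetP => f fS; rewrite inE.
apply/negPn/negP => nf; apply: (h3 f _ fS); first by rewrite mem_iota /=.
exists mu => //; split=> //; last by rewrite inE.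
move=> v; have := hE v; rewrite !inE; case e : (mu v) => [u|f'] //=.
case/andP => h1' h2'; rewrite h2' andbT in_setD1 h1' andbT.
by apply: contra nf => /eqP <-; apply/imsetP; exists v.
Qed.

End PriceLoop.

(** * The approximation guarantee for one candidate ratio *)

Section Decide.
Variables (n : nat) (F : {set {set 'I_n}}) (O : oracle).
Hypothesis hF : is_matroid F.
Hypothesis hO : forall s : seq 'I_n, O (enc [seq val i | i <- s]) = ([set x in s] \in F).
Hypothesis n0 : (0 < n)%N.
Local Open Scope ring_scope.
Local Notation V := (iota 0 n).

Variables (dist : 'I_n -> 'I_n -> rat) (rad : 'I_n -> rat) (alpha : rat).
Hypothesis dist0 : forall x, dist x x = 0.
Hypothesis dist_sym : forall x y, dist x y = dist y x.
Hypothesis tri : forall x y z, dist x z <= dist x y + dist y z.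
Hypothesis rad0 : forall x, 0 < rad x.
Hypothesis alpha0 : 0 <= alpha.

Variables (near ok ed : seq (seq bool)).
Hypothesis nearE : forall v f : 'I_n, at2 near v f = (dist v f <= alpha * rad v).
Hypothesis okE : forall u v : 'I_n,
  at2 ok u v = (dist u v <= alpha * (rad u + rad v)) && (rad v <= 2 * rad u).
Hypothesis edE : forall v u : 'I_n,
  at2 ed v u = (dist v u <= alpha * (rad v + rad u)) && ~~ (rad v <= 2 * rad u).

Definition reach (c : rat) (S : {set 'I_n}) := [set v | [exists f in S, dist v f <= c * rad v]].

Lemma decide_spec (S0 : {set 'I_n}) m : S0 \in F ->
  (m <= #|reach alpha S0|)%N ->
  let S := decide O V near ok ed m%:Z in
  [/\ {subset S <= V}, aset n S \in F &
    (m <= #|reach (9 * alpha) (aset n S)|)%N].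
Proof.
move=> hS0 hm S.
pose w (v : 'I_n) := count (fun x => x == val v) (scheme n O near ok).
have okr (v : 'I_n) : at2 ok v v.
  by rewrite okE dist0; have := rad0 v; move: (rad v) => r r0; apply/andP; split; [apply: mulr_ge0 => // |]; lra.
have edr (v u : 'I_n) : at2 ed v u -> rad u < rad v.
  by rewrite edE => /andP[_]; have := rad0 u; rewrite -ltNge; lra.
have nok (v u f : 'I_n) : at2 near v f -> at2 near u f -> at2 ok v u || at2 ed u v.
  rewrite !nearE okE edE => h1 h2.
  have h3 : dist v u <= alpha * (rad v + rad u).
    by have := tri v f u; rewrite (dist_sym f u) mulrDr; lra.
  by rewrite (dist_sym u v) [rad u + _]addrC h3 /=; case: (_ <= _).
have [a [ca oka _ _]] := scheme_spec O near okr.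
have cw v : w v = #|[set u | a u == v]| := ca v.
have sw : (\sum_v w v <= n)%N.
  rewrite -[X in (_ <= X)%N](card_ord n) -sum1_card [X in (_ <= X)%N](partition_big a xpredT) //=.
  by apply: leq_sum => v _; rewrite cw -sum1_card; apply: eq_leq; apply: eq_bigl => u; rewrite inE.
have hm' : (m <= #|[set v : 'I_n | [exists f in S0, at2 near v f]]|)%N.
  apply: leq_trans hm _; apply: subset_leq_card; apply/subsetP => v; rewrite !inE.
  by move=> /existsP[f hf]; apply/existsP; exists f; rewrite nearE.
have hw0 : forall v : 'I_n, w v = count (fun x => x == val v) (scheme n O near ok) by [].
have pk := packing_exists hF hO okr edr nok n0 hw0 hS0 hm'.
pose ws := weights V (scheme n O near ok).
have hws (v : 'I_n) : nth 0 ws v = (w v)%:Z by rewrite /ws /weights nth_map_iota.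
have [h1 h2 [mu hmu le]] := prune_spec hF hO n0 hws sw pk.
split=> //; apply: leq_trans le _.
(* The gain is the number of points whose representative is matched off its own slot. *)
have -> : (\sum_v gain w v (mu v) = #|[set u | mu (a u) != inl (a u)]|)%N.
  rewrite -sum1_card [RHS](partition_big a xpredT) //=; apply: eq_bigr => v _.
  rewrite /gain; case: eqP => e.
    by rewrite big_pred0 // => u; rewrite inE; apply/negP => /andP[/eqP h /eqP ea]; rewrite ea in h.
  rewrite cw -sum1_card; apply: eq_bigl => u; rewrite !inE.
  by case: (eqVneq (a u) v) => [->|]; rewrite ?andbF // andbT; apply/esym/eqP.
apply: subset_leq_card; apply/subsetP => u; rewrite !inE => nu.
have [f fS hd] : exists2 f, f \in aset n S & dist (a u) f <= 3 * (alpha * rad (a u)).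
  (* The height is the unscaled radius, which decreases strictly even when [alpha] is 0. *)
  apply: (packing_cover (rad := fun v => alpha * rad v) (height := rad) tri _ _ _ _ _ hmu nu).
  - by move=> x y; rewrite edE mulrDr => /andP[].
  - by move=> x y; rewrite edE -ltNge => /andP[_ h]; rewrite mulrCA; apply: ler_wpM2l => //; exact: ltW.
  - by move=> x y; rewrite nearE.
  - by move=> x; apply: mulr_ge0 => //; exact: ltW.
  - exact: edr.
(* The distance from [u] to [f] is at most alpha (r(u) + 4 r(a u)), and r(a u) is at most 2 r(u):
   hence the factor 9. *)
apply/existsP; exists f; rewrite fS /= -mulrA.
have := oka u; rewrite okE => /andP[h3 h4]; have := tri u (a u) f.
have h5 : alpha * rad (a u) <= alpha * (2 * rad u) by apply: ler_wpM2l.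
by move: hd h3 h5; rewrite mulrDr mulrCA; lra.
Qed.

End Decide.

(** * Running time *)

Lemma PT_orb A `{Enc A} (f g : oracle -> A -> bool) : PT f -> PT g -> PT (fun O a => f O a || g O a).
Proof. by move=> hf hg; apply: (PT_if hf _ hg); apply: (PT_cst (z := 1%R)). Qed.

(** Reads a program off the syntax of the function. Subtraction is matched before addition, being
    the addition of an opposite. *)
Ltac pt1 := cbv beta zeta; lazymatch goal with
  | |- PT (fun O a => a) => apply PT_id
  | |- PT (fun O a => fst (@?f O a)) => apply (@PT_fst _ _ _ _ _ _ f)
  | |- PT (fun O a => snd (@?f O a)) => apply (@PT_snd _ _ _ _ _ _ f)
  | |- PT (fun O a => (@?f O a, @?g O a)) => apply (@PT_pair _ _ _ _ _ _ f g)
  | |- PT (fun O a => @nil _) => apply PT_nil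
  | |- PT (fun O a => cons (@?f O a) (@?g O a)) => apply (@PT_cons _ _ _ _ f g)
  | |- PT (fun O a => if _ then _ else _) => apply PT_if
  | |- PT (fun O a => andb (@?f O a) (@?g O a)) => apply (@PT_andb _ _ f g)
  | |- PT (fun O a => orb (@?f O a) (@?g O a)) => apply (@PT_orb _ _ f g)
  | |- PT (fun O a => negb (@?f O a)) => apply (@PT_negb _ _ f)
  | |- PT (fun O a => addn (@?f O a) (@?g O a)) => apply (@PT_addn _ _ f g)
  | |- PT (fun O a => leq (@?f O a) (@?g O a)) => apply (@PT_leqn _ _ f g)
  | |- PT (fun O a => @eq_op _ (@?f O a) (@?g O a)) => apply (@PT_eqn _ _ f g)
  | |- PT (fun O a => GRing.add (@?f O a) (GRing.opp (@?g O a))) => apply (@PT_subz _ _ f g)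
  | |- PT (fun O a => GRing.add (@?f O a) (@?g O a)) => apply (@PT_addz _ _ f g)
  | |- PT (fun O a => GRing.mul (@?f O a) (@?g O a)) => apply (@PT_mulz _ _ f g)
  | |- PT (fun O a => Order.le (@?f O a) (@?g O a)) => apply (@PT_lez _ _ f g)
  | |- PT (fun O a => map (@?f O a) (@?l O a)) => apply (@PT_map _ _ _ _ _ _ f l)
  | |- PT (fun O a => filter (@?f O a) (@?l O a)) => apply (@PT_filter _ _ _ _ f l)
  | |- PT (fun O a => count (@?f O a) (@?l O a)) => apply (@PT_count _ _ _ _ f l)
  | |- PT (fun O a => has (@?f O a) (@?l O a)) => apply (@PT_has _ _ _ _ f l)
  | |- PT (fun O a => cat (@?f O a) (@?g O a)) => apply (@PT_cat _ _ _ _ f g)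
  | |- PT (fun O a => flatten (@?f O a)) => apply (@PT_flatten _ _ _ _ f)
  | |- PT (fun O a => iota 0 (size (@?f O a))) => apply (@PT_iota _ _ _ _ f)
  | |- PT (fun O a => size (@?f O a)) => apply (@PT_size _ _ _ _ f)
  | |- PT (fun O a => nth (@?d O a) (@?l O a) (@?i O a)) => apply (@PT_nth _ _ _ _ d l i)
  | |- PT (fun O a => (\sum_(x <- @?l O a) x)%R) => apply (@PT_sumz _ _ l)
  | |- PT (fun O a => O (enc (@?f O a))) => apply (@PT_query _ _ _ _ f)
  | |- PT (fun O a => Posz (@?f O a)) => apply (@PT_posz _ _ f)
  | h : PT ?f |- PT (fun O a => ?f O (@?g O a)) => apply (@PT_comp _ _ _ _ _ _ f g h)
  | h : PT (fun O (p : _ * _) => ?f O (fst p) (snd p)) |- PT (fun O a => ?f O (@?g O a) (@?x O a)) =>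
      apply (@PT_comp _ _ _ _ _ _ (fun O p => f O p.1 p.2) (fun O a => (g O a, x O a)) h)
  | |- PT (fun O a => @GRing.zero _) => apply (@PT_cst _ _ int _ 0%R (Posz 0)); reflexivity
  | |- PT (fun O a => @GRing.one _) => apply (@PT_cst _ _ int _ 1%R (Posz 1)); reflexivity
  | |- PT (fun O a => @GRing.natmul _ _ ?n) => apply (@PT_cst _ _ int _ _ (Posz n)); reflexivity
  | |- PT (fun O a => Datatypes.O) => apply (@PT_cst _ _ nat _ 0 (Posz 0)); reflexivity
  | |- PT (fun O a => true) => apply (@PT_cst _ _ bool _ true (Posz 1)); reflexivity
  | |- PT (fun O a => false) => apply (@PT_cst _ _ bool _ false (Posz 0)); reflexivity
  | |- _ => idtac
  end.

Ltac pt := repeat (progress pt1); try assumption.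

Lemma esize_filterC A `{Enc A} (p : pred A) (l : seq A) :
  (esize l).+1 = esize (filter p l) + esize (filter (fun x => ~~ p x) l).
Proof.
by elim: l => //= x l IH; case: (p x) => /=; rewrite !esize_cons; lia.
Qed.

Lemma esize_sortd A `{Enc A} (key : A -> int) l : esize (sortd key l) = esize l.
Proof.
assert (aux : forall acc, (esize (foldl (fun acc x => [seq y <- acc | (key x <= key y)%R] ++
   x :: [seq y <- acc | ~~ (key x <= key y)%R]) acc l)).+1 = esize acc + esize l).
  elim: l => [|x l IH] acc; first exact: esym (addn1 _).
  rewrite /= IH; apply: succn_inj; rewrite -addSn esize_cat !esize_cons.
  pose proof (esize_filterC (fun y => (key x <= key y)%R) acc) as e; cbv beta in e.
  lia.
by apply: succn_inj; rewrite /sortd aux.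
Qed.

Section Procedures.
Context {A : Type} `{Enc A}.

Lemma PT_sortd B `{Enc B} (key : oracle -> A -> B -> int) (l : oracle -> A -> seq B) :
  PT (fun O (p : A * B) => key O p.1 p.2) -> PT l -> PT (fun O a => sortd (key O a) (l O a)).
Proof.
move=> hk hl; rewrite /sortd.
apply: (PT_foldl (f := fun O a acc x => [seq y <- acc | (key O a x <= key O a y)%R] ++
   x :: [seq y <- acc | ~~ (key O a x <= key O a y)%R])) (PT_PB hl) _ => //; try by pt.
by move=> O a i; rewrite -/(sortd _ _) esize_sortd esize_take.
Qed.

Lemma esize_greedy B `{Enc B} (P : seq B -> bool) l : esize (greedy P l) <= esize l.
Proof.
assert (aux : forall acc,
    (esize (foldl (fun J f => if P (f :: J) then f :: J else J) acc l)).+1 <= esize acc + esize l).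
  elim: l => [|x l IH] acc; first by rewrite addn1.
  apply: leq_trans (IH _) _; rewrite esize_cons; case: (P _); rewrite ?esize_cons; lia.
by rewrite -ltnS; apply: leq_trans (aux [::]) _; rewrite add1n.
Qed.

Lemma PT_max_basis (V : oracle -> A -> seq nat) (key : oracle -> A -> seq int) :
  PT V -> PT key -> PT (fun O a => max_basis O (V O a) (key O a)).
Proof.
move=> hV hk; rewrite /max_basis /greedy.
have hs : PT (fun O a => sortd (fun i => nth 0%R (key O a) i) (V O a)).
  by apply: (PT_sortd (key := fun O a i => nth 0%R (key O a) i)) => //; pt.
apply: (PT_foldl (f := fun O a J f => if O (enc (f :: J)) then f :: J else J)) (PT_PB hs) _ => //; try by pt.
move=> O a i; rewrite -/(greedy (fun s => O (enc s)) _).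
exact: leq_trans (esize_greedy _ _) (esize_take _ _).
Qed.

Lemma PT_pairs_with (f g : oracle -> A -> seq nat) :
  PT f -> PT g -> PT (fun O a => pairs_with (f O a) (g O a)).
Proof. by move=> hf hg; rewrite /pairs_with; pt. Qed.

Lemma PT_argmax (sc : oracle -> A -> nat -> int) (x0 : oracle -> A -> nat) (l : oracle -> A -> seq nat) :
  PT (fun O (p : A * nat) => sc O p.1 p.2) -> PT x0 -> PT l ->
  PT (fun O a => argmax (sc O a) (x0 O a) (l O a)).
Proof.
move=> hs hx hl; rewrite /argmax.
apply: (PT_foldl (f := fun O a b j => if (sc O a j <= sc O a b)%R then b else j)
  (b := fun O a => esize (x0 O a) + esize (l O a))) => //; try by pt.
- by pb.
move=> O a i; apply: (@leq_trans (esize (x0 O a) + esize (take i (l O a)))); last first.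
  by rewrite leq_add2l esize_take.
elim: (take i _) (x0 O a) => [|x s IH] y /=; first exact: leq_addr.
by apply: leq_trans (IH _) _; rewrite esize_cons; case: ifP => _; lia.
Qed.

(** A target is the point itself or an earlier target, so all entries are elements of the input list
    and have bounded size. *)
Lemma PT_targets (ok : oracle -> A -> nat -> nat -> bool) (l : oracle -> A -> seq nat) :
  PT (fun O (p : A * nat * nat) => ok O p.1.1 p.1.2 p.2) -> PT l ->
  PT (fun O a => targets (ok O a) (l O a)).
Proof.
move=> hok hl; rewrite /targets.
apply: (PT_foldl (f := fun O a tg u => nth u [seq v <- tg | ok O a u v] 0 :: tg)
   (b := fun O a => esize (l O a) * (esize (l O a)).+1 + 1)) => //; try by pt.
- pt.
  apply: (PT_comp (g := fun O p => ok O p.1.1 p.1.2 p.2)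
     (f := fun O (p : A * seq nat * nat * nat) => (p.1.1.1, p.1.2, p.2))) hok _; pt.
- by pb.
move=> O a i; set f := (fun tg u => _).
have inv s acc : all (fun x => esize x <= esize (l O a)) s -> all (fun x => esize x <= esize (l O a)) acc ->
   size (foldl f acc s) = size acc + size s /\ all (fun x => esize x <= esize (l O a)) (foldl f acc s).
  elim: s acc => [|x s IH] acc /=; first by rewrite addn0.
  move=> /andP[hx hs] hacc; have [|h1 h2] := IH (f acc x) hs.
    rewrite /f /= hacc andbT; have := filter_all; case e : [seq v <- acc | ok O a x v] => [|y t] //= _.
    have : y \in acc by have := mem_filter (ok O a x) y acc; rewrite e mem_head => /esym/andP[].
    by move/(allP hacc).
  by rewrite h1 /= addSnnS.
have ht : all (fun x => esize x <= esize (l O a)) (take i (l O a)).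
  by apply/allP => x /mem_take; apply: (allP (esize_all _)).
have [h1 h2] := inv (take i (l O a)) [::] ht isT.
apply: leq_trans (esize_bound h2) _; rewrite h1 add0n leq_add2r leq_mul2r; apply/orP; right.
exact: leq_trans (ltnW (esize_len _)) (esize_take _ _).
Qed.

End Procedures.

Ltac pt2 := repeat (cbv beta zeta; lazymatch goal with
  | |- PT (fun O a => max_basis O _ _) => apply PT_max_basis
  | |- PT (fun O a => pairs_with _ _) => apply PT_pairs_with
  | |- PT (fun O a => argmax _ _ _) => apply PT_argmax
  | |- PT (fun O a => sortd _ _) => apply PT_sortd
  | |- PT (fun O a => targets _ _) => apply PT_targets
  | |- _ => progress pt1
  end); try assumption.

Lemma esize_ints (l : seq int) B : all (fun x => `|x|%N <= B) l -> esize l <= size l * B.+2 + 1.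
Proof.
move=> h; apply: esize_bound; apply: sub_all h => x /= hx.
exact: leq_trans (int_size_abs x) _.
Qed.

Lemma size_max_basis_le O V key : size (max_basis O V key) <= size V.
Proof.
rewrite /max_basis -(perm_size (sortd_perm (fun i => nth 0%R key i) V)).
elim/last_ind: (sortd _ _) => // l x IH; rewrite greedy_rcons size_rcons.
by case: ifP => _; [rewrite ltnS | apply: leqW].
Qed.


Lemma PT_ticks A `{Enc A} (V : oracle -> A -> seq nat) : PT V -> PT (fun O a => ticks (V O a)).
Proof. by move=> h; rewrite /ticks; pt2. Qed.

Lemma PT_cover_step A `{Enc A} (V : oracle -> A -> seq nat) (M : oracle -> A -> seq (seq bool)) (K : oracle -> A -> int)
    (st : oracle -> A -> seq int * seq int) :
  PT V -> PT M -> PT K -> PT st -> PT (fun O a => cover_step O (V O a) (M O a) (K O a) (st O a)).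
Proof. by move=> *; rewrite /cover_step /clip /at2; pt2. Qed.

Lemma PT_cube A `{Enc A} (V : oracle -> A -> seq nat) : PT V -> PT (fun O a => cube (V O a)).
Proof. by move=> *; rewrite /cube; pt2. Qed.

Lemma PB_pow A `{Enc A} (m : oracle -> A -> nat) k : PB m -> PB (fun O a => m O a ^ k).
Proof.
move=> [C [e h]]; exists (C ^ k), (e * k) => O a; rewrite expnM -expnMn.
by case: k => // j; rewrite leq_exp2r.
Qed.

Lemma PB_len A `{Enc A} (V : oracle -> A -> seq nat) : PT V -> PB (fun O a => size (V O a)).
Proof. by move=> h; apply: PB_le (PT_PB h) _ => O a; apply: ltnW (esize_len _). Qed.

(** With n = [size (V O a)], multipliers are clipped at n^3 and accumulated counts grow by at most n
    per step, so over the (n+1)^10 steps all numbers stay below [B]. *)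
Lemma PT_cover_loop A `{Enc A} (V : oracle -> A -> seq nat) (M : oracle -> A -> seq (seq bool)) :
  PT V -> PT M -> PT (fun O a => cover_loop O (V O a) (M O a)).
Proof.
move=> hV hM; rewrite /cover_loop.
pose B := fun O a => (size (V O a)).+1 ^ 20.
pose b := fun O a => (size (V O a) * (B O a).+2 + 1 + (size (V O a) * (B O a).+2 + 1)).+1.
have pB : PB B by apply: PB_pow; apply: PB_S; exact: PB_len.
apply: (PT_foldl (f := fun O a st _ => cover_step O (V O a) (M O a) (cube (V O a)) st) (b := b)).
- by cbv beta; apply: PT_cover_step; [| |apply: PT_cube|]; pt2.
- by pt2.
- exact: PT_ticks.
- by rewrite /b; have hl := PB_len hV; pb.
move=> O a i; rewrite /b; set v := V O a; set m := M O a.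
suff : let st := foldl (fun st _ => cover_step O v m (cube v) st) ([seq 0%R | _ <- v], [seq 0%R | _ <- v]) (take i (ticks v)) in
  [/\ size st.1 = size v, size st.2 = size v, all (fun x => `|x|%N <= B O a) st.1 &
      all (fun x => `|x|%N <= B O a) st.2].
  case: (foldl _ _ _) => s1 s2 /= [e1 e2 h1 h2]; rewrite esize_pair ltnS.
  by apply: leq_add; [rewrite -e1|rewrite -e2]; apply: esize_ints.
rewrite foldl_iter.
have : size (take i (ticks v)) <= (size v).+1 ^ 10.
  by rewrite size_take size_ticks; case: ltnP => // /ltnW.
move: (size (take i _)) => t ht.
have K0 : (0 <= cube v)%R by rewrite /cube; lia.
suff [h1 h2 h3 h4] : let st := iter t (cover_step O v m (cube v)) ([seq 0%R | _ <- v], [seq 0%R | _ <- v]) in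
  [/\ size st.1 = size v, size st.2 = size v, all (fun x => (0 <= x <= cube v)%R) st.1 &
      all (fun x => `|x|%N <= t * size v) st.2].
  split=> //.
    apply: sub_all h3 => x /andP[x0 xK]; apply: (@leq_trans (size v ^ 3)).
      by move: xK; rewrite /cube !expnS expn0 muln1; lia.
    by apply: (@leq_trans ((size v).+1 ^ 3)); [rewrite leq_exp2r | rewrite leq_pexp2l].
  apply: sub_all h4 => x; move/leq_trans; apply; rewrite /B -/v -[20]/(10 + 10) expnD.
  apply: leq_mul => //; rewrite -[size v]expn1; apply: (@leq_trans ((size v).+1 ^ 1)).
    by rewrite leq_exp2r.
  by rewrite leq_pexp2l.
elim: t {ht} => [|t [h1 h2 h3 h4]] /=.
  split; rewrite ?size_map //; first by rewrite all_map; apply/allP => x _ /=; rewrite K0.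
  by rewrite all_map; apply/allP.
rewrite /cover_step /=; set J := max_basis _ _ _; split; rewrite ?size_map //.
  by rewrite all_map; apply/allP => x _ /=; apply: clip_range.
rewrite all_map; apply/allP => x _ /=.
have ax : `|nth 0%R (iter t (cover_step O v m (cube v)) ([seq 0%R | _ <- v], [seq 0%R | _ <- v])).2 x| <= t * size v.
  set s := (iter _ _ _).2 in h4 *; case: (ltnP x (size s)) => hx; last by rewrite nth_default.
  by apply: (allP h4); apply: mem_nth.
set c := [seq (count (fun f => at2 m v0 f) J)%:Z%R | v0 <- v]; have ac : `|nth 0%R c x| <= size v.
  case: (ltnP x (size v)) => hx; last by rewrite nth_default // size_map.
  rewrite /c (nth_map 0) //= ; apply: leq_trans (count_size _ _) _; exact: size_max_basis_le.
have abs2 (y z : int) : `|(y + z)%R| <= `|y| + `|z| by lia.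
rewrite mulSnr; apply: leq_trans (abs2 _ _) _; exact: leq_add ax ac.
Qed.

Lemma PT_coverage A `{Enc A} (V : oracle -> A -> seq nat) (M : oracle -> A -> seq (seq bool)) : PT V -> PT M -> PT (fun O a => coverage O (V O a) (M O a)).
Proof.
move=> hV hM; rewrite /coverage; do 2 (pt2; try (by [apply: PT_cover_loop; pt2 | apply: PT_ticks; pt2])).
Qed.

Lemma PT_V2 A `{Enc A} (V : oracle -> A -> seq nat) : PT V -> PT (fun O a => V2 (V O a)).
Proof. by move=> *; rewrite /V2; pt2. Qed.

Lemma PT_options A `{Enc A} (V : oracle -> A -> seq nat) (near ed : oracle -> A -> seq (seq bool))
   (al : oracle -> A -> seq nat) (v : oracle -> A -> nat) :
  PT V -> PT near -> PT ed -> PT al -> PT v ->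
  PT (fun O a => options (V O a) (near O a) (ed O a) (al O a) (v O a)).
Proof. by move=> *; rewrite /options /at2; pt2. Qed.

Lemma PT_score A `{Enc A} (K : oracle -> A -> int) (w lam : oracle -> A -> seq int)
   (v j : oracle -> A -> nat) :
  PT K -> PT w -> PT lam -> PT v -> PT j ->
  PT (fun O a => score (K O a) (w O a) (lam O a) (v O a) (j O a)).
Proof. by move=> *; rewrite /score; pt2. Qed.

Ltac pt3 := repeat (cbv beta zeta; lazymatch goal with
  | |- PT (fun O a => V2 _) => apply PT_V2
  | |- PT (fun O a => options _ _ _ _ _) => apply PT_options
  | |- PT (fun O a => score _ _ _ _ _) => apply PT_score
  | |- PT (fun O a => ticks _) => apply PT_ticks
  | |- PT (fun O a => coverage O _ _) => apply PT_coverage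
  | |- PT (fun O a => cover_loop O _ _) => apply PT_cover_loop
  | |- _ => progress pt2
  end); try assumption.

Lemma PT_price_step A `{Enc A} (V : oracle -> A -> seq nat) (near ed : oracle -> A -> seq (seq bool))
   (w : oracle -> A -> seq int) (K m : oracle -> A -> int) (al : oracle -> A -> seq nat)
   (st : oracle -> A -> seq int * bool) :
  PT V -> PT near -> PT ed -> PT w -> PT K -> PT m -> PT al -> PT st ->
  PT (fun O a => price_step O (V O a) (near O a) (ed O a) (w O a) (K O a) (m O a) (al O a) (st O a)).
Proof. by move=> *; rewrite /price_step; pt3. Qed.

(** The demand and supply lists have at most 2n entries each, so a price changes by at most 4n per
    step. *)
Lemma PT_test A `{Enc A} (V : oracle -> A -> seq nat) (near ed : oracle -> A -> seq (seq bool))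
   (w : oracle -> A -> seq int) (m : oracle -> A -> int) (al : oracle -> A -> seq nat) :
  PT V -> PT near -> PT ed -> PT w -> PT m -> PT al ->
  PT (fun O a => test O (V O a) (near O a) (ed O a) (w O a) (m O a) (al O a)).
Proof.
move=> hV hn he hw hm hal; rewrite /test; apply: PT_snd.
pose K := fun O a => (16 * ((size (V O a))%:Z * (size (V O a))%:Z))%R.
pose B := fun O a => (size (V O a)).+1 ^ 10 * (4 * size (V O a)).
pose b := fun O a => (2 * size (V O a) * (B O a).+2 + 1 + 2).+1.
have hl := PB_len hV.
have pB : PB B by rewrite /B; apply: PB_mul; [apply: PB_pow; apply: PB_S | pb].
apply: (PT_foldl (f := fun O a st _ => price_step O (V O a) (near O a) (ed O a) (w O a)
   (K O a) (m O a) (al O a) st) (b := b)).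
- by cbv beta; apply: PT_price_step; rewrite /K; pt3.
- by pt3.
- by pt3.
- by rewrite /b; pb.
move=> O a i; rewrite /b; set v := V O a; set f := (fun st _ => _).
have : size (take i (ticks v)) <= (size v).+1 ^ 10.
  by rewrite size_take size_ticks; case: ltnP => // /ltnW.
have ef (s : seq nat) : foldl f ([seq 0%R | _ <- V2 v], true) s =
   iter (size s) (price_step O v (near O a) (ed O a) (w O a) (K O a) (m O a) (al O a)) ([seq 0%R | _ <- V2 v], true).
  by rewrite /f; apply: foldl_iter.
rewrite ef; move: (size (take i _)) => t ht.
suff [h1 h2] : let st := iter t (price_step O v (near O a) (ed O a) (w O a) (K O a) (m O a) (al O a)) ([seq 0%R | _ <- V2 v], true) in
  size st.1 = 2 * size v /\ all (fun x => `|x|%N <= t * (4 * size v)) st.1.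
  move: h1 h2; case: (iter _ _ _) => s fl /= h1 h2; rewrite esize_pair ltnS.
  apply: leq_add; last by case: fl.
  rewrite -h1; apply: esize_ints; apply: sub_all h2 => x; move/leq_trans; apply.
  by rewrite /B leq_mul2r ht orbT.
have sV2 : size (V2 v) = 2 * size v by rewrite /V2 size_iota size_cat mul2n addnn.
elim: t {ht} => [|t [h1 h2]] /=.
  by split; rewrite ?size_map //; rewrite all_map; apply/allP.
rewrite {1 2}/price_step /=; set st := iter _ _ _ in h1 h2 *.
set J := max_basis _ _ _; set cs := [seq argmax _ _ _ | _ <- v]; set Js := [seq _ | _ <- J].
have sJ : size J <= size v by apply: size_max_basis_le.
split; first by rewrite size_map.
rewrite all_map; apply/allP => j _ /=.
set x := nth _ _ _; set c1 := count _ _; set c2 := count _ _.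
have ax : `|x|%N <= t * (4 * size v).
  rewrite /x; case: (ltnP j (size st.1)) => hx; last by rewrite nth_default.
  by apply: (allP h2); apply: mem_nth.
have a1 : c1 <= 2 * size v.
  by apply: leq_trans (count_size _ _) _; rewrite size_cat !size_map; lia.
have a2 : c2 <= 2 * size v.
  by apply: leq_trans (count_size _ _) _; rewrite size_cat !size_map; lia.
by rewrite mulSn; move: ax a1 a2; move: x c1 c2 (t * _) => x c1 c2 y; lia.
Qed.

Lemma esize_prune_loop (t : seq nat -> bool) al s :
  esize (foldl (fun al f => let al' := [seq g <- al | ~~ (g == f)] in if t al' then al' else al) al s)
  <= esize al.
Proof.
elim: s al => [|x s IH] al //=; apply: leq_trans (IH _) _.
by case: ifP => // _; apply: esize_filter.
Qed.

Lemma PT_prune A `{Enc A} (V : oracle -> A -> seq nat) (near ed : oracle -> A -> seq (seq bool))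
   (w : oracle -> A -> seq int) (m : oracle -> A -> int) :
  PT V -> PT near -> PT ed -> PT w -> PT m ->
  PT (fun O a => prune O (V O a) (near O a) (ed O a) (w O a) (m O a)).
Proof.
move=> hV hn he hw hm; rewrite /prune.
apply: (PT_foldl (f := fun O a al f => let al' := [seq g <- al | ~~ (g == f)] in
      if test O (V O a) (near O a) (ed O a) (w O a) (m O a) al' then al' else al)) (PT_PB hV) _ => //.
- by cbv beta zeta; apply: PT_if; [apply: PT_test | |]; pt3.
by move=> O a i; apply: esize_prune_loop.
Qed.

Lemma PT_decide A `{Enc A} (V : oracle -> A -> seq nat) (near ok ed : oracle -> A -> seq (seq bool))
   (m : oracle -> A -> int) :
  PT V -> PT near -> PT ok -> PT ed -> PT m ->
  PT (fun O a => decide O (V O a) (near O a) (ok O a) (ed O a) (m O a)).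
Proof.
by move=> hV hn hk he hm; rewrite /decide; cbv zeta; apply: PT_prune => //; rewrite /weights /at2; pt3.
Qed.

Lemma PT_fle A `{Enc A} (x y : oracle -> A -> int * int) : PT x -> PT y -> PT (fun O a => fle (x O a) (y O a)).
Proof. by move=> *; rewrite /fle; pt3. Qed.

Lemma PT_fmul A `{Enc A} (x y : oracle -> A -> int * int) : PT x -> PT y -> PT (fun O a => fmul (x O a) (y O a)).
Proof. by move=> *; rewrite /fmul; pt3. Qed.

Lemma PT_fadd A `{Enc A} (x y : oracle -> A -> int * int) : PT x -> PT y -> PT (fun O a => fadd (x O a) (y O a)).
Proof. by move=> *; rewrite /fadd; pt3. Qed.

Lemma PT_fdist A `{Enc A} (d : oracle -> A -> seq (seq (int * int))) (v f : oracle -> A -> nat) :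
  PT d -> PT v -> PT f -> PT (fun O a => fdist (d O a) (v O a) (f O a)).
Proof. by move=> *; rewrite /fdist; pt3. Qed.

Lemma PT_frad A `{Enc A} (r : oracle -> A -> seq (int * int)) (v : oracle -> A -> nat) :
  PT r -> PT v -> PT (fun O a => frad (r O a) (v O a)).
Proof. by move=> *; rewrite /frad; pt3. Qed.

Ltac pt4 := repeat (cbv beta zeta; lazymatch goal with
  | |- PT (fun O a => fle _ _) => apply PT_fle
  | |- PT (fun O a => fmul _ _) => apply PT_fmul
  | |- PT (fun O a => fadd _ _) => apply PT_fadd
  | |- PT (fun O a => fdist _ _ _) => apply PT_fdist
  | |- PT (fun O a => frad _ _) => apply PT_frad
  | |- PT (fun O a => decide O _ _ _ _ _) => apply PT_decide
  | |- _ => progress pt3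
  end); try assumption.

Lemma PT_try_ratio A `{Enc A} (V : oracle -> A -> seq nat) (d : oracle -> A -> seq (seq (int * int)))
   (r : oracle -> A -> seq (int * int)) (m : oracle -> A -> nat)
   (best : oracle -> A -> bool * ((int * int) * seq nat)) (x : oracle -> A -> int * int) :
  PT V -> PT d -> PT r -> PT m -> PT best -> PT x ->
  PT (fun O a => try_ratio O (V O a) (d O a) (r O a) (m O a) (best O a) (x O a)).
Proof.
move=> *; rewrite /try_ratio /accepts /near_mx /ok_mx /ed_mx /touch /shrink; pt4.
Qed.

Lemma all_prefix T (p : pred T) s k : all p s -> all p (take k s).
Proof. by rewrite -{1}(cat_take_drop k s) all_cat => /andP[]. Qed.

Lemma PT_solve : PT solve.
Proof.
rewrite /solve; apply: PT_snd; apply: PT_snd; cbv zeta.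
pose inp := (nat * (nat * (seq (seq (int * int)) * (seq (int * int) * nat))))%type.
pose V := fun (_ : oracle) (i : inp) => iota 0 (size i.2.2.2.1).
pose l := fun (O : oracle) (i : inp) =>
  flatten [seq [seq cand_ratio i.2.2.1 i.2.2.2.1 x y | y <- V O i] | x <- V O i].
have hV : PT V by rewrite /V; pt4.
have hl : PT l by rewrite /l /V /cand_ratio; pt4.
apply: (PT_foldl (l := l) (f := fun O (i : inp) best a => try_ratio O (V O i) i.2.2.1 i.2.2.2.1 i.2.1 best a)
  (b := fun O i => (100 + (esize (l O i) + esize (V O i))))) => //.
- by cbv beta; apply: PT_try_ratio; rewrite /V; pt4.
- by pt4.
- by pb.
move=> O i k; set f := try_ratio _ _ _ _ _.
(* The accumulator holds one candidate ratio and one sublist of the points, up to a constant. *)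
assert (aux : forall s acc, all (fun x => esize x <= esize (l O i)) s ->
   esize acc <= 100 + (esize (l O i) + esize (V O i)) ->
   esize (foldl f acc s) <= 100 + (esize (l O i) + esize (V O i))).
  elim=> [|x s IH] acc //= /andP[hx hs] hacc; apply: IH => //.
  rewrite /f /try_ratio; case: ifP => // _; rewrite !esize_pair.
  have h2 : esize (decide O (V O i) (near_mx (V O i) i.2.2.1 i.2.2.2.1 x) (ok_mx (V O i) i.2.2.1 i.2.2.2.1 x)
    (ed_mx (V O i) i.2.2.1 i.2.2.2.1 x) i.2.1) <= esize (V O i) by apply: esize_prune_loop.
  by rewrite -[esize true]/1; lia.
apply: aux; last by rewrite !esize_pair -![esize _]/1; lia.
by apply: all_prefix; apply: esize_all.
Qed.

(** * Rational instances *)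

Section Fractions.
Local Open Scope ring_scope.

Definition frac_val (x : int * int) : rat := x.1%:~R / x.2%:~R.

Lemma fle_val x y : 0 < x.2 -> 0 < y.2 -> fle x y = (frac_val x <= frac_val y).
Proof.
case: x y => [a b] [c d] /= b0 d0; rewrite /fle /frac_val /=.
by rewrite ler_pdivrMr ?ltr0z // mulrAC ler_pdivlMr ?ltr0z // -!intrM ler_int.
Qed.

Lemma fmul_val x y : frac_val (fmul x y) = frac_val x * frac_val y.
Proof. by rewrite /frac_val /fmul /= !intrM invfM mulrACA. Qed.

Lemma fadd_val x y : 0 < x.2 -> 0 < y.2 -> frac_val (fadd x y) = frac_val x + frac_val y.
Proof.
by move=> x0 y0; rewrite /frac_val /fadd /= intrD !intrM addf_div ?intr_eq0 ?gt_eqF.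
Qed.

Lemma fmul_den x y : 0 < x.2 -> 0 < y.2 -> 0 < (fmul x y).2.
Proof. exact: mulr_gt0. Qed.

Lemma frac_val_rat (q : rat) : frac_val (numq q, denq q) = q.
Proof. exact: divq_num_den. Qed.

End Fractions.

Lemma foldl_prune_sub (t : seq nat -> bool) (al s : seq nat) :
  {subset foldl (fun al f => let al' := [seq g <- al | ~~ (g == f)] in if t al' then al' else al) al s
   <= al}.
Proof.
elim: s al => [|y s IH] al x //= /IH; case: ifP => // _; by rewrite mem_filter => /andP[].
Qed.

(** * The search for the smallest accepted ratio *)

Section Solve.
Variables (n : nat) (F : {set {set 'I_n}}) (O : oracle).
Hypothesis hF : is_matroid F.
Hypothesis hO : forall s : seq 'I_n, O (enc [seq val i | i <- s]) = ([set x in s] \in F).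
Local Open Scope ring_scope.
Local Notation V := (iota 0 n).

Variables (dist : 'I_n -> 'I_n -> rat) (rad : 'I_n -> rat).
Hypothesis dist0 : forall x, dist x x = 0.
Hypothesis dist_sym : forall x y, dist x y = dist y x.
Hypothesis tri : forall x y z, dist x z <= dist x y + dist y z.
Hypothesis rad0 : forall x, 0 < rad x.

Variables (d : seq (seq (int * int))) (r : seq (int * int)).
Hypothesis dE : forall x y : 'I_n, fdist d x y = (numq (dist x y), denq (dist x y)).
Hypothesis rE : forall x : 'I_n, frad r x = (numq (rad x), denq (rad x)).

Lemma dist_ge0 x y : 0 <= dist x y.
Proof. by have := tri x y x; rewrite dist0 (dist_sym y x); lra. Qed.

Lemma oracle_aset (S : seq nat) : {subset S <= V} -> O (enc S) = (aset n S \in F).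
Proof.
move=> sub; have [s es] : exists s : seq 'I_n, S = [seq val i | i <- s].
  elim: S sub => [|x S IH] sub; first by exists [::].
  have [|s ->] := IH; first by move=> y yS; apply: sub; rewrite inE yS orbT.
  have xn : (x < n)%N by have := sub x (mem_head _ _); rewrite mem_iota.
  by exists (Ordinal xn :: s).
rewrite es hO; congr (_ \in F); apply/setP => i; rewrite !inE mem_map //; exact: val_inj.
Qed.

Lemma has_aset (S : seq nat) (p : nat -> bool) : {subset S <= V} ->
  has p S = [exists f in aset n S, p (val f)].
Proof.
move=> sub; apply/hasP/existsP => [[x xS px]|[f /andP[fS pf]]].
  have xn : (x < n)%N by have := sub x xS; rewrite mem_iota.
  by exists (Ordinal xn); rewrite inE /= xS.
by exists (val f) => //; move: fS; rewrite inE.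
Qed.

Lemma accepts_spec m a (S : seq nat) : {subset S <= V} -> 0 < a.2 ->
  accepts O V d r m a S = (aset n S \in F) && (m <= #|reach dist rad (9 * frac_val a) (aset n S)|)%N.
Proof.
move=> sub a0; rewrite /accepts oracle_aset //; congr (_ && (_ <= _)%N).
rewrite -val_enum_ord count_map -size_filter.
rewrite -(card_uniqP (filter_uniq _ (enum_uniq _))); apply: eq_card => v.
rewrite mem_filter mem_enum andbT !inE /= has_aset //; apply: eq_existsb => f; congr (_ && _).
rewrite fle_val ?dE ?rE ?frac_val_rat ?denq_gt0 //; last by do 2 apply: fmul_den => //; rewrite denq_gt0.
by rewrite !fmul_val frac_val_rat [frac_val (9, 1)]/frac_val divr1 mulrA.
Qed.

Lemma touch_spec a (u v : 'I_n) : 0 < a.2 ->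
  touch d r a u v = (dist u v <= frac_val a * (rad u + rad v)).
Proof.
move=> a0; rewrite /touch fle_val ?dE ?rE ?denq_gt0 //; last first.
  by do 2 apply: fmul_den => //; rewrite denq_gt0.
by rewrite fmul_val fadd_val ?denq_gt0 // !frac_val_rat.
Qed.

Lemma shrink_spec (u v : 'I_n) : shrink r u v = (rad v <= 2 * rad u).
Proof.
rewrite /shrink fle_val ?rE ?denq_gt0 //; last by apply: fmul_den => //; rewrite denq_gt0.
by rewrite fmul_val !frac_val_rat [frac_val (2, 1)]/frac_val divr1.
Qed.

Lemma decide_sub near ok ed m : {subset decide O V near ok ed m <= V}.
Proof. exact: foldl_prune_sub. Qed.

Let cand x y := cand_ratio d r x y.

Lemma cand_spec (x y : 'I_n) : 0 < (cand x y).2 /\ frac_val (cand x y) = dist x y / rad x.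
Proof.
have num0 : 0 < numq (rad x) by rewrite numq_gt0.
rewrite /cand /cand_ratio dE rE /=; split; first by apply: mulr_gt0 => //; rewrite denq_gt0.
rewrite -[in RHS](divq_num_den (dist x y)) -[in RHS](divq_num_den (rad x)) /frac_val /= !intrM.
by rewrite [in RHS]invf_div mulf_div.
Qed.

(** Every feasible candidate is accepted by [decide_spec], and the loop keeps the smallest accepted
    ratio, which is therefore at most each feasible one. *)
Lemma solve_spec (inp : nat * (nat * (seq (seq (int * int)) * (seq (int * int) * nat)))) m :
  inp.2.1 = m -> inp.2.2.1 = d -> inp.2.2.2.1 = r -> size r = n ->
  let S := solve O inp in
  [/\ {subset S <= V}, aset n S \in F &
    forall (S0 : {set 'I_n}) x y, S0 \in F -> (m <= #|reach dist rad (dist x y / rad x) S0|)%N ->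
      exists2 a, 0 <= a <= dist x y / rad x & (m <= #|reach dist rad (9 * a) (aset n S)|)%N].
Proof.
move=> em ed er sr S.
pose l := flatten [seq [seq cand x y | y <- V] | x <- V].
pose dec a := decide O V (near_mx V d r a) (ok_mx V d r a) (ed_mx V d r a) m%:Z.
have lP c : c \in l -> exists x y : 'I_n, c = cand x y.
  case/flattenP => s /mapP[x xV ->] /mapP[y yV ->].
  rewrite !mem_iota /= add0n in xV yV; by exists (Ordinal xV), (Ordinal yV).
(* Until something is accepted the stored set is empty, hence independent, so the output is a legal
   one even if no candidate is feasible. *)
have inv s : {subset s <= l} ->
   let b := foldl (fun best a => try_ratio O V d r m best a) (false, ((0, 1), [::])) s in
   [/\ {subset b.2.2 <= V}, aset n b.2.2 \in F,
       b.1 -> [/\ 0 < b.2.1.2, 0 <= frac_val b.2.1 & (m <= #|reach dist rad (9 * frac_val b.2.1) (aset n b.2.2)|)%N] &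
       forall a, a \in s -> accepts O V d r m a (dec a) -> b.1 /\ frac_val b.2.1 <= frac_val a].
  elim/last_ind: s => [_|s a IH sub] /=.
    have e0 : aset n [::] = set0 by apply/setP => x; rewrite !inE.
    by split=> //; rewrite e0; case: hF.
  have [x [y ea]] : exists x y : 'I_n, a = cand x y by apply: lP; apply: sub; rewrite mem_rcons mem_head.
  have [a0 va] := cand_spec x y; rewrite -ea in a0 va.
  have [|] := IH; first by move=> c cs; apply: sub; rewrite mem_rcons inE cs orbT.
  rewrite foldl_rcons; set b := foldl _ _ _ => h1 h2 h3 h4.
  rewrite /try_ratio -/(dec a); case: ifP => [/andP[hacc hb]|hn] /=.
    have sd : {subset dec a <= V} by apply: decide_sub.
    have := hacc; rewrite accepts_spec // => /andP[k1 k2].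
    split=> //.
      by move=> _; split=> //; rewrite va divr_ge0 ?dist_ge0 // ltW.
    move=> c; rewrite mem_rcons inE => /orP[/eqP->//|cs] hc; split=> //.
    have [f le] := h4 c cs hc; apply: le_trans le.
    have [f0 _ _] := h3 f; move: hb; rewrite f /= fle_val // -ltNge; exact: ltW.
  split=> // c; rewrite mem_rcons inE => /orP[/eqP->|cs] hc; last exact: h4.
  move: hn; rewrite hc /=; case f : b.1 => //=; have [f0 _ _] := h3 f.
  by rewrite fle_val // => /negbFE.
have eS : S = (foldl (fun best a => try_ratio O V d r m best a) (false, ((0, 1), [::])) l).2.2.
  by rewrite /S /solve em ed er sr.
have [h1 h2 h3 h4] := inv l (fun _ h => h); rewrite -eS in h1 h2 h3.
split=> // S0 x y hS0 hm.
have n0 : (0 < n)%N by apply: leq_ltn_trans (ltn_ord x).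
have [a0 va] := cand_spec x y; set a := cand x y in a0 va.
have al : a \in l.
  apply/flattenP; exists [seq cand x y | y <- V]; last by apply: map_f; rewrite mem_iota /=.
  by apply: (map_f (fun x : nat => [seq cand x y | y <- V])); rewrite mem_iota /=.
have age0 : 0 <= frac_val a by rewrite va divr_ge0 ?dist_ge0 // ltW.
have acc : accepts O V d r m a (dec a).
  rewrite accepts_spec //; last exact: decide_sub.
  have at2E (g : nat -> nat -> bool) (u v : 'I_n) : at2 [seq [seq g i j | j <- V] | i <- V] u v = g u v.
    by rewrite /at2 !nth_map_iota.
  have [] := decide_spec hF hO n0 dist0 dist_sym tri rad0 age0 (near := near_mx V d r a)
    (ok := ok_mx V d r a) (ed := ed_mx V d r a) _ _ _ hS0 (m := m).
  - move=> v f; rewrite at2E fle_val ?dE ?rE ?denq_gt0 //; last by apply: fmul_den => //; rewrite denq_gt0.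
    by rewrite fmul_val !frac_val_rat.
  - by move=> u v; rewrite at2E touch_spec // shrink_spec.
  - by move=> u v; rewrite at2E touch_spec // shrink_spec.
  - by rewrite va.
  by move=> _ -> ->.
have [f le] := h4 a al acc; have [f0 f1 f2] := h3 f.
exists (frac_val (foldl (fun best a => try_ratio O V d r m best a) (false, ((0, 1), [::])) l).2.1) => //.
by rewrite f1 -va.
Qed.

End Solve.

From mathcomp Require Import all_classical all_reals all_analysis.

(** * From positions and rational numbers back to the metric space *)

Section Transfer.
Variables (R : realType) (X : finMetricType R) (I : pmc_instance X).
Local Open Scope ring_scope.
Local Notation n := #|X|.

Lemma dist_to_le (v : X) (S : {set X}) (c : R) :
  (dist_to v S <= c%:E)%E = [exists s in S, mdist v s <= c].
Proof.
apply/idP/existsP => [|[s /andP[sS le]]]; last first.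
  by apply: (@le_trans _ _ (mdist v s)%:E); [apply: bigmin_le_cond | rewrite lee_fin].
rewrite /dist_to; case: (pickP (mem S)) => [s0 s0S|S0]; last by rewrite big_pred0 // leNgt ltry.
rewrite (bigmin_eq_arg _ _ _ _ s0S) => [|s _]; last exact: leey.
by case: arg_minP => // s sS _ le; exists s; rewrite [_ \in _]sS -lee_fin.
Qed.

Lemma objective_le (S : {set X}) (a : R) :
  0 <= a -> (target I <= #|covered I S a|)%N -> (objective I S <= a%:E)%E.
Proof. by move=> a0 h; apply: ge_ereal_inf; exists a%:E => //; exists a. Qed.

(** Dividing by [rho] leaves a lower bound to prove for an infimum, which is checked against each
    feasible pair of a set and a ratio. *)
Lemma approx_by_scaling (S : {set X}) (rho : R) : 0 < rho ->
  (forall (S0 : {set X}) (a : R), S0 \in indep I -> 0 <= a -> (target I <= #|covered I S0 a|)%N ->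
     exists b : R, [/\ 0 <= b, b <= rho * a & (target I <= #|covered I S b|)%N]) ->
  (objective I S <= rho%:E * optimum I)%E.
Proof.
move=> rho0 h; rewrite -lee_pdivrMl //; apply: le_bigmin; first exact: leey.
move=> S0 hS0; apply: le_ereal_inf_tmp => _ [a [a0 ha] <-].
have [b [b0 le hb]] := h S0 a hS0 a0 ha.
by rewrite lee_pdivrMl //; apply: le_trans (objective_le b0 hb) _; rewrite -EFinM lee_fin.
Qed.

Definition points (A : {set 'I_n}) : {set X} := [set enum_val i | i in A]%SET.

Definition index_indep : {set {set 'I_n}} := [set A | points A \in indep I]%SET.

Lemma mem_points (A : {set 'I_n}) i : (enum_val i \in points A) = (i \in A).
Proof. by rewrite mem_imset //; exact: enum_val_inj. Qed.

Lemma card_points (A : {set 'I_n}) : #|points A| = #|A|.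
Proof. by rewrite card_imset //; exact: enum_val_inj. Qed.

Lemma points_surj (S : {set X}) : S = points [set i | enum_val i \in S]%SET.
Proof.
apply/finset.setP => x; rewrite -(enum_rankK x).
by rewrite (mem_points _ (enum_rank x)) finset.inE.
Qed.

Lemma index_matroid : is_matroid index_indep.
Proof.
have [f0 fd fx] := indep_matroid I; split.
- by rewrite finset.inE /points imset0.
- move=> A B AB; rewrite !finset.inE; apply: fd; exact: imsetS.
move=> A B; rewrite !finset.inE -(card_points A) -(card_points B) => hA hB lt.
have [x] := fx _ _ hA hB lt; rewrite finset.inE => /andP[].
rewrite -(enum_rankK x) !mem_points => xA xB hx.
exists (enum_rank x); first by rewrite finset.inE xA.
by rewrite finset.inE /points imsetU1.
Qed.

Lemma decode_positions (s : seq 'I_n) :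
  decode_set X (enc [seq val i | i <- s]) = Some (points [set i in s]%SET).
Proof.
elim: s => [|i s IH].
  rewrite /= (_ : points _ = finset.set0) //; apply/eqP; rewrite -cards_eq0 card_points cards_eq0.
  by apply/eqP/finset.setP => i; rewrite !finset.inE.
have -> : decode_set X (enc [seq val j | j <- i :: s]) =
  (if insub (val i) is Some k then
     omap (fun A : {set X} => enum_val (k : 'I_#|X|) |: A)%SET (decode_set X (enc [seq val j | j <- s]))
   else None) by [].
have e : ([set j in i :: s] = i |: [set j in s])%SET by apply/finset.setP => j; rewrite !finset.inE.
by rewrite IH valK /= e /points imsetU1.
Qed.

Lemma oracle_positions (s : seq 'I_n) :
  indep_oracle I (enc [seq val i | i <- s]) = ([set i in s]%SET \in index_indep).
Proof. by rewrite /indep_oracle decode_positions finset.inE. Qed.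

Variables (d : X -> X -> rat) (r : X -> rat).
Hypothesis hd : forall x y : X, mdist x y = ratr (d x y).
Hypothesis hr : forall x : X, Defs.radius I x = ratr (r x).

Let dist (i j : 'I_n) := d (enum_val i) (enum_val j).
Let rad (i : 'I_n) := r (enum_val i).

Lemma covered_points (A : {set 'I_n}) (c : R) : covered I (points A) c =
  points [set v | [exists f in A, ratr (dist v f) <= c * ratr (rad v)]]%SET.
Proof.
apply/finset.setP => x; rewrite -(enum_rankK x) mem_points !finset.inE dist_to_le hr.
apply/existsP/existsP => [[y /andP[]]|[f /andP[fA le]]].
  rewrite -(enum_rankK y) mem_points => yA le; exists (enum_rank y).
  by rewrite yA /dist /rad -hd.
by exists (enum_val f); rewrite mem_points fA hd.
Qed.

Lemma covered_reach (A : {set 'I_n}) (c : rat) :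
  #|covered I (points A) (ratr c)| = #|reach dist rad c A|.
Proof.
rewrite covered_points card_points; apply: eq_card => v; rewrite !finset.inE.
by apply: eq_existsb => f; rewrite -rmorphM /= ler_rat.
Qed.

Lemma idx_dist0 x : dist x x = 0.
Proof. by apply: (@fmorph_inj _ _ (ratr : rat -> R)); rewrite /= -hd mdistxx rmorph0. Qed.

Lemma idx_dist_sym x y : dist x y = dist y x.
Proof. by apply: (@fmorph_inj _ _ (ratr : rat -> R)); rewrite /= -!hd metric_sym. Qed.

Lemma idx_tri x y z : dist x z <= dist x y + dist y z.
Proof. by rewrite -(ler_rat R) rmorphD /= -!hd metric_triangle. Qed.

Lemma idx_rad0 x : 0 < rad x.
Proof. by rewrite -(ltr_rat R) rmorph0 -hr radius_gt0. Qed.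

(** Lowering [a] to the largest ratio d(v, f v) / r(v) over the covered points loses none of them.
    If nothing is covered the target is 0, and the ratio 0 of a point to itself serves. *)
Lemma best_candidate (S0 : {set 'I_n}) (a : R) : (0 < n)%N -> 0 <= a ->
  (target I <= #|covered I (points S0) a|)%N ->
  exists x y, ratr (dist x y / rad x) <= a /\ (target I <= #|reach dist rad (dist x y / rad x) S0|)%N.
Proof.
move=> n0 a0; rewrite covered_points card_points.
pose Z : {set 'I_n} := [set v | [exists f in S0, ratr (dist v f) <= a * ratr (rad v)]]%SET.
rewrite -/Z => hm.
have rR x : 0 < ratr (rad x) :> R by rewrite -(rmorph0 (ratr : rat -> R)) ltr_rat idx_rad0.
case: (set_0Vmem Z) => [Z0|[z0 z0Z]].
  pose x := Ordinal n0; exists x, x; rewrite idx_dist0 mul0r rmorph0; split=> //.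
  by rewrite Z0 cards0 leqn0 in hm; rewrite (eqP hm).
have /boolp.choice[f hf] : forall v, exists f, v \in Z -> (f \in S0) && (ratr (dist v f) <= a * ratr (rad v)).
  move=> v; case: (boolP (v \in Z)) => vZ; last by exists v.
  by move: vZ; rewrite finset.inE => /existsP[f hf]; exists f => _.
have [v vZ vmax] := @arg_maxP _ _ _ z0 (mem Z) (fun v => dist v (f v) / rad v) z0Z.
exists v, (f v); split.
  have /andP[_ le] := hf v vZ; rewrite fmorph_div /= ler_pdivrMr //.
apply: leq_trans hm _; apply: subset_leq_card; apply/fintype.subsetP => u uZ.
rewrite finset.inE; apply/existsP; exists (f u); have /andP[-> _] := hf u uZ.
by rewrite /= -ler_pdivrMr ?idx_rad0 //; apply: vmax.
Qed.

Let dl := [seq [seq (numq (d x y), denq (d x y)) | y <- enum X] | x <- enum X].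
Let rl := [seq (numq (r x), denq (r x)) | x <- enum X].

Definition input := (n, (target I, (dl, (rl, 0%N)))).

Lemma input_encodes v : v = enc_seq
    [:: VNum n%:Z; VNum (target I)%:Z;
        enc_seq [seq enc_seq [seq enc_rat (d x y) | y <- enum X] | x <- enum X];
        enc_seq [seq enc_rat (r x) | x <- enum X]] -> v = enc input.
Proof.
move=> ->.
have e (T : Type) (s : seq T) (q : T -> rat) :
    enc [seq (numq (q y), denq (q y)) | y <- s] = enc_seq [seq enc_rat (q y) | y <- s].
  by rewrite /enc /Enc_list -map_comp; congr enc_seq.
have e1 : enc rl = enc_seq [seq enc_rat (r x) | x <- enum X] := e _ _ _.
have e2 : enc dl = enc_seq [seq enc_seq [seq enc_rat (d x y) | y <- enum X] | x <- enum X].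
  rewrite {1}/enc /Enc_list -map_comp; congr enc_seq; apply: eq_map => x /=.
  exact: e.
by rewrite -e1 -e2.
Qed.

Lemma solve_correct : let S := solve (indep_oracle I) input in
  exists2 A : {set X}, decode_set X (enc S) = Some A & approx_solution I 9%:R A.
Proof.
move=> S.
have dE (x y : 'I_n) : fdist dl x y = (numq (dist x y), denq (dist x y)).
  rewrite /fdist /dl (nth_map (enum_val x)) -?cardE // (nth_map (enum_val x)) -?cardE //.
  by rewrite -!enum_val_nth.
have rE (x : 'I_n) : frad rl x = (numq (rad x), denq (rad x)).
  by rewrite /frad /rl (nth_map (enum_val x)) -?cardE // -enum_val_nth.
have sr : size rl = n by rewrite size_map -cardE.
have [h1 h2 h3] := solve_spec index_matroid oracle_positions idx_dist0 idx_dist_sym idx_tri idx_rad0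
  dE rE (inp := input) (m := target I) erefl erefl erefl sr.
rewrite -/S in h1 h2 h3.
have [s es] : exists s : seq 'I_n, S = [seq val i | i <- s].
  elim: S h1 {h2 h3} => [|x S IH] sub; first by exists [::].
  have [|s ->] := IH; first by move=> y yS; apply: sub; rewrite inE yS orbT.
  have xn : (x < n)%N by have := sub x (mem_head _ _); rewrite mem_iota.
  by exists (Ordinal xn :: s).
have ea : aset n S = [set i in s]%SET.
  by apply/finset.setP => i; rewrite !finset.inE es mem_map //; exact: val_inj.
exists (points (aset n S)); first by rewrite es decode_positions -es ea.
split; first by move: h2; rewrite finset.inE.
apply: approx_by_scaling => // S0 a; rewrite (points_surj S0); set A0 := (X in points X).
move=> hS0 a0 hm; have [n0|n0] := posnP n.
  (* In the empty space all covered sets are empty, so the ratio 0 already works. *)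
  exists 0; rewrite lexx mulr_ge0 //; split=> //.
  have c0 (B : {set X}) : #|B| = 0%N.
    by apply/eqP; rewrite -leqn0 -n0 max_card.
  by move: hm; rewrite !c0.
have [x [y [le hxy]]] := best_candidate n0 a0 hm.
have hA0 : A0 \in index_indep by rewrite finset.inE.
have [b /andP[b0 bq] hb] := h3 A0 x y hA0 hxy.
exists (ratr (9 * b)); rewrite covered_reach hb; split=> //.
  by rewrite -(rmorph0 (ratr : rat -> R)) ler_rat mulr_ge0.
rewrite rmorphM /= ratr_nat ler_wpM2l //; apply: le_trans le; by rewrite ler_rat.
Qed.

End Transfer.

Local Open Scope ring_scope.

Theorem theorem4p2 (R : realType) :
  exists c : cmd, poly_time_approximation (9%:R : R) c.
Proof.
have [_ [c [T [[C [k hT]] hc]]]] := PT_solve.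
(* The input is placed on a stack with bottom 0, as [computes] expects, and the result is unpacked
   at the end; the constant 20 in the polynomial pays for this. *)
exists (Defs.Seq (Assign 0 (Pair (Var 0) (Cst 0))) (Defs.Seq c (Assign 0 (Fst (Var 0))))).
exists (C%:P * 'X^k + 20%:P) => X I v [d [r [hd hr hv]]].
have ev := input_encodes hv; have [A hA happ] := solve_correct hd hr.
set inp := input I d r in ev hA happ.
have [t [s [ex le es]]] : runs (indep_oracle I)
    (Defs.Seq (Assign 0 (Pair (Var 0) (Cst 0))) (Defs.Seq c (Assign 0 (Fst (Var 0)))))
    (init_store v) (5 + (T (indep_oracle I) inp + 5).+1).+1%N
    (fun s => s 0%N = enc (solve (indep_oracle I) inp)).
  apply: runs_seq; apply: runs_assign => //; apply: runs_seq.
  apply: runs_weak (hc _ inp (VNum 0) _ _) _ _ => //; first by rewrite /update /= /init_store ev.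
  by move=> s h; apply: runs_assign; rewrite //= /update h.
exists t, s, A; split=> //; last by rewrite es.
rewrite hornerD hornerM !hornerC hornerXn.
apply: leq_trans le _; have := hT (indep_oracle I) inp; rewrite /esize -ev.
by move: (T _ _) => x h; rewrite -[_ * _ + _]/(C * value_size v ^ k + 20)%N; lia.
Qed.
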